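(* Let $K$ be a local field of characteristic $p$ with finite residue field $\overline{K}$, and let $L/K$ be a totally ramified Galois extension with $\mathrm{Gal}(L/K)\cong(\mathbb{Z}/p\mathbb{Z})^{\nu}$ having a single ramification break $b\ge1$. Let $H={\rm N}_{L/K}(L^\times)$, let $B_0$ be as defined in the context, and let $k\ge\lceil b/p\rceil-1$ be an integer. Then $\Lambda_K(H\cap U_K^{k+1})$ is an $\mathbb{F}_{p^\nu}$-subspace of $\mathcal{M}_K$ if and only if $B_0+\mathcal{M}_K^{-k}$ is an $\mathbb{F}_{p^\nu}$-subspace of $K$.
   Context: $\mathcal{M}_K$ is the maximal ideal, $U_K^{r}=1+\mathcal{M}_K^{r}$, $\mathcal{M}_K^{-k}=\{x:v_K(x)\ge-k\}$. $\overline{K}$ is identified with the subfield of Teichmüller representatives of $K$; $\mathbb{F}_{p^\nu}$ is the field with $p^\nu$ elements, and ''is an $\mathbb{F}_{p^\nu}$-subspace'' includes the requirement $\mathbb{F}_{p^\nu}\subseteq\overline{K}\subseteq K$. ''Single ramification break $b$'' means $v_L(\sigma(\pi_L)-\pi_L)=b+1$ for every $\sigma\ne1$. $E_p(X)\in\mathbb{F}_p[[X]]$ is the reduction mod $p$ of the Artin–Hasse series $\prod_{c\ge1,\,p\nmid c}(1-X^c)^{-\mu(c)/c}$; $\Lambda_K:U_K^1\to\mathcal{M}_K$ is the inverse of the bijection $\alpha\mapsto E_p(\alpha)$. Fix a uniformizer $\pi_L$ and let $t={\rm N}_{L/K}(\pi_L)$, so $K=\overline{K}((t))$. Let $\wp(x)=x^p-x$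 and $B=\{\beta\in K: X^p-X-\beta \text{ splits over } L\}$. Fix an additive complement $\overline{K}_0$ of $\wp\overline{K}$ in $\overline{K}$; $K_0=\{x_0+x_1t^{-1}+\dots+x_st^{-s}: s\ge0,\ x_0\in\overline{K}_0,\ x_i\in\overline{K},\ x_{pi}=0 \text{ for } i\ge1\}$ and $B_0=B\cap K_0$. *)

(* Defs.v *)
From HB Require Import structures.
From mathcomp Require Import all_boot all_order all_fingroup all_algebra.
From mathcomp Require Import all_solvable all_field.
From mathcomp Require Import boolp classical_sets constructive_ereal.

Set Implicit Arguments.
Unset Strict Implicit.
Unset Printing Implicit Defensive.

Import Order.TTheory GRing.Theory Num.Theory.
Local Open Scope classical_set_scope.
Local Open Scope ring_scope.

(* Normalized discrete valuation with values in [Z \cup {+oo}]. *)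
Record discrete_valuation (K : fieldType) (v : K -> \bar int) : Prop := {
  val_pinfty : forall x, v x = +oo%E <-> x = 0;
  val_ninfty : forall x, v x <> -oo%E;
  valM : forall x y, v (x * y) = (v x + v y)%E;
  valD : forall x y, (Order.min (v x) (v y) <= v (x + y)%R)%E;
  val_normalized : exists x, v x = 1%:E }.

Section Valued.
Variables (K : fieldType) (v : K -> \bar int).

(* [mpow r] is the fractional ideal M_K^r, for any integer r. *)
Definition mpow (r : int) : set K := [set x | (r%:E <= v x)%E].

Definition punits (r : int) : set K := [set x | mpow r (x - 1)].

Definition vcvg (u : nat -> K) (l : K) : Prop :=
  forall n : int, exists N : nat,
    forall i, (N <= i)%N -> mpow n (u i - l).

Definition vcauchy (u : nat -> K) : Prop :=
  forall n : int, exists N : nat,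
    forall i j, (N <= i)%N -> (N <= j)%N -> mpow n (u i - u j).

Definition vcomplete : Prop := forall u, vcauchy u -> exists l, vcvg u l.

Definition vlim (u : nat -> K) : K := xget 0 [set l | vcvg u l].

(* [res] presents [kK] as the residue field O_K / M_K; the values of [res]
   outside O_K are irrelevant. *)
Record residue_map (kK : fieldType) (res : K -> kK) : Prop := {
  resD : forall x y, mpow 0 x -> mpow 0 y ->
    res (x + y) = res x + res y;
  resM : forall x y, mpow 0 x -> mpow 0 y ->
    res (x * y) = res x * res y;
  res1 : res 1 = 1;
  res_surj : forall a, exists2 x, mpow 0 x & res x = a;
  res_ker : forall x, mpow 0 x -> (res x = 0 <-> mpow 1 x) }.

Record local_field (kK : finFieldType) (res : K -> kK) : Prop := {
  local_val : discrete_valuation v;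
  local_complete : vcomplete;
  local_res : residue_map res }.

(* Teichmueller representatives for a residue field with q elements. *)
Definition teichmuller (q : nat) : set K :=
  [set x | mpow 0 x /\ x ^+ q = x].

End Valued.

(* [A] is an F_q-subspace of [W], where F_q is a subfield of [Kbar] (in
   particular there is none, and the predicate fails, if [Kbar] has no
   subfield with q elements). *)
Definition Fq_subspace (K : fieldType) (Kbar : set K) (q : nat)
    (A W : set K) : Prop :=
  exists (F : finFieldType) (iota : {rmorphism F -> K}),
    [/\ #|F| = q, range iota `<=` Kbar, A `<=` W, A 0 &
        (forall x y, A x -> A y -> A (x + y)) /\
        (forall a x, A x -> A (iota a * x))].

Definition totally_ramified (K : fieldType) (L : fieldExtType K)
    (vK : K -> \bar int) (vL : L -> \bar int) : Prop :=
  forall x : K, vL x%:A = (vK x *+ \dim {:L})%E.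

Definition single_break (K : fieldType) (L : splittingFieldType K)
    (vL : L -> \bar int) (piL : L) (b : nat) : Prop :=
  forall s : gal_of {:L}, s \in 'Gal({:L} / 1)%g -> s != 1%g ->
    vL (s piL - piL) = (b.+1%:Z)%:E.

Definition norm_group (K : fieldType) (L : splittingFieldType K) : set K :=
  [set y | exists2 x : L, x != 0 & y%:A = galNorm 1 {:L} x].

Section ArtinHasse.

Definition moebius (n : nat) : int :=
  if all (fun q => logn q n == 1%N) (primes n)
  then (-1) ^+ size (primes n) else 0.

Definition gen_binom (a : rat) (j : nat) : rat :=
  (\prod_(i < j) (a - i%:R)) / j`!%:R.

(* (1 - X^c)^a, truncated after the term X^(c n) *)
Definition binom_series (a : rat) (c n : nat) : {poly rat} :=
  \sum_(j < n.+1) ((-1) ^+ j * gen_binom a j) *: 'X^(c * j).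

(* Coefficient of X^n in the Artin-Hasse series
     \prod_(c >= 1, p does not divide c) (1 - X^c)^(- moebius c / c);
   the factors with c > n and the omitted terms do not contribute to it. *)
Definition artin_hasse_coef (p n : nat) : rat :=
  (\prod_(1 <= c < n.+1 | ~~ (p %| c)%N)
     binom_series (- (moebius c)%:~R / c%:R) c n)`_n.

(* These coefficients have denominator prime to p, so that [ratr] (quotient of
   the images of numerator and denominator) is reduction modulo p. *)
Definition Ep_coef (p n : nat) : 'F_p := ratr (artin_hasse_coef p n).

Variables (K : fieldType) (v : K -> \bar int) (p : nat).

Definition Ep (alpha : K) : K :=
  vlim v (fun N => \sum_(n < N) (Ep_coef p n : nat)%:R * alpha ^+ n).

Definition LambdaK (u : K) : K :=
  xget 0 [set alpha | mpow v 1 alpha /\ Ep alpha = u].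

End ArtinHasse.

Section ArtinSchreier.
Variables (K : fieldType) (p : nat).

Definition wp (x : K) : K := x ^+ p - x.

(* [C] is an additive complement of [A] in [W]. *)
Definition additive_complement (W A C : set K) : Prop :=
  [/\ C `<=` W, C 0, (forall x y, C x -> C y -> C (x - y)),
      W = [set x + y | x in A & y in C] & A `&` C = [set 0]].

Definition K_0 (Kbar Kbar0 : set K) (t : K) : set K :=
  [set y | exists (s : nat) (x : nat -> K),
    [/\ Kbar0 (x 0%N), (forall i, (1 <= i)%N -> Kbar (x i)),
        (forall i, (1 <= i)%N -> x (p * i)%N = 0) &
        y = \sum_(i < s.+1) x i * t ^- i]].

Definition AS_set (L : fieldExtType K) : set K :=
  [set beta | exists rs : seq L,
    'X^p - 'X - (beta%:A)%:P = \prod_(a <- rs) ('X - a%:P) :> {poly L}].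

Definition B_0 (L : fieldExtType K) (Kbar Kbar0 : set K) (t : K) : set K :=
  AS_set L `&` K_0 Kbar Kbar0 t.

End ArtinSchreier.

Definition sum_set (K : fieldType) (A C : set K) : set K :=
  [set x + y | x in A & y in C].

(* Main.v *)
Require Import Defs.
From HB Require Import structures.
From mathcomp Require Import all_boot all_order all_fingroup all_algebra.
From mathcomp Require Import all_solvable all_field.
From mathcomp Require Import boolp classical_sets constructive_ereal.
From mathcomp Require mxabelem.
From mathcomp Require Import zify ring.

(* For u in U^1 and x in K put <u, x> = Tr(c_0(x delta(u)/u)), where delta = t d/dt, c_0 is the
   constant coefficient of a Laurent series in t and Tr is the trace to F_p; by the Cartier
   operator this kills wp(K).

   Norms from L are orthogonal to B: if alpha = N(x) is not a p-th power, beta = wp(y) and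
   sigma(y) = y + 1, then the operators X = w sigma, with w the norm of x to K(y), and y on L
   satisfy X^p = alpha and X y = (y + 1) X. Writing y = (y - Z) + Z, where Z is the polynomial
   in X with coefficients z_0, .., z_(p-1) in K and Z(1) = y, Hochschild's formula gives
   beta = sum_i z_i^p alpha^i - z_0, and <alpha, .> of this vanishes.

   Conversely, descending from L to K through steps of degree p shows that H contains
   U^(b+1), that U^1 = (H cap U^1) U^b, and that on U^b/U^(b+1) the norm is given by an
   additive map whose kernel has at most p^nu elements. As B_0 is spanned by nu independent
   elements of pole order b, counting at level b shows that H cap U^1 is exactly the orthogonal
   of B_0 in U^1.

   The coefficients of E_p agree with those of exp up to degree p - 1, so delta(E_p(a))/E_p(a)
   is congruent to delta(a) modulo M^(p(k+1)) for a in M^(k+1), and p(k+1) > b because p does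
   not divide b unless B_0 = 0. Hence Lambda(H cap U^(k+1)) is the set of a in M^(k+1) with
   Tr(c_0(beta delta(a))) = 0 for all beta in B_0. Since delta is Kbar-linear, this set and
   B_0 + M^(-k) determine each other as orthogonals, so one is stable under F_(p^nu) exactly
   when the other is. *)

Set Implicit Arguments.
Unset Strict Implicit.
Unset Printing Implicit Defensive.

Import FalgLfun.
Import Order.TTheory GRing.Theory Num.Theory.
Local Open Scope classical_set_scope.
Local Open Scope ring_scope.

(** * Rings of characteristic p *)

(** Local class field theory is not invoked. The operators [X] and [Y] satisfy the relations of the
    cyclic algebra of the symbol [[beta, alpha)]; since they act on [K(y)], of dimension [p], the
    algebra is split explicitly, and this is what supplies [Z]. The powers of [X] applied to 1 are
    independent because [alpha] is not a [p]-th power; [p]-th powers are orthogonal to everything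
    anyway. Orthogonality bounds [H] from one side only. The other side is a count at the single
    level [b], between the kernel of the norm on leading coefficients, controlled by the Galois
    group, and the [nu] independent characters turned into elements of [B_0] by Hilbert 90. No norm
    index is computed. The descent would require a valuation on each intermediate field. These
    fields are replaced by subgroups [A] of the Galois group: their elements are the elements of [L]
    fixed by [A], level [m] means [vL] at least [#|A| * m], and the uniformizer is the norm of [piL]
    over [A]. Facts about [L] come from coordinates in the powers of [piL], not from limits in
    [L]. *)

Section RingCharP.
Variables (R : nzRingType) (p : nat).
Hypothesis pR : p \in [pchar R].

Let p_pr : prime p := pcharf_prime pR.
Let p_gt0 : (0 < p)%N := prime_gt0 p_pr.

Lemma bin_pred_pchar i : (i < p)%N -> 'C(p.-1, i)%:R = (-1) ^+ i :> R.
Proof.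
elim: i => [|i IH] ip; first by rewrite bin0 expr0.
have : 'C(p, i.+1)%:R = 0 :> R.
  by apply/eqP; rewrite -(dvdn_pcharf pR) prime_dvd_bin.
rewrite -(prednK p_gt0) binS natrD IH ?(ltnW ip) // => /eqP.
by rewrite addr_eq0 exprS mulN1r => /eqP.
Qed.

(** With an automorphism for [x] and [y := 1], the right side is a trace; traces over cycles of
    length [p] thus become iterated differences. *)
Lemma subX_pred_pchar (x y : R) : GRing.comm x y ->
  (x - y) ^+ p.-1 = \sum_(i < p) x ^+ (p.-1 - i) * y ^+ i.
Proof.
move=> cxy; rewrite exprBn_comm // (prednK p_gt0); apply: eq_bigr => i _.
rewrite -mulr_natr bin_pred_pchar // commr_sign !mulrA -expr2 sqrr_sign mul1r.
by [].
Qed.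

Definition ad (a z : R) := a * z - z * a.

Lemma iter_ad a z n : iter n (ad a) z =
  \sum_(i < n.+1) ((-1) ^+ i * (a ^+ (n - i) * z * a ^+ i)) *+ 'C(n, i).
Proof.
elim: n => [|n IH].
  by rewrite big_ord_recr big_ord0 /= add0r subnn !expr0 !(mul1r, mulr1).
rewrite iterS {}IH /ad mulr_sumr mulr_suml.
rewrite [X in X - _]big_ord_recl [RHS]big_ord_recl /= !bin0 !subn0 !expr0 !mulr1 !mul1r mulrA -exprS.
rewrite -addrA; congr (_ + _).
under [RHS]eq_bigr => i _ do rewrite /bump /= add1n subSS binS mulrnDr.
rewrite big_split /=; congr (_ + _).
  rewrite [RHS]big_ord_recr /= bin_small // mulr0n addr0.
  apply: eq_bigr => i _; rewrite /bump /= add1n mulrnAr; congr (_ *+ _).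
  have -> : (n - i = (n - i.+1).+1)%N by rewrite subnSK.
  by rewrite mulrA [a * _]commr_sign -!mulrA (exprS a (n - i.+1)%N) -?mulrA.
rewrite -sumrN; apply: eq_bigr => i _.
by rewrite mulrnAl -mulNrn exprS -!mulrA mulN1r -exprSr.
Qed.

Lemma iter_ad_pchar a z :
  iter p.-1 (ad a) z = \sum_(i < p) a ^+ (p.-1 - i) * z * a ^+ i.
Proof.
rewrite iter_ad (prednK p_gt0); apply: eq_bigr => i _.
rewrite -mulr_natr bin_pred_pchar //.
by rewrite commr_sign !mulrA -expr2 sqrr_sign mul1r.
Qed.

End RingCharP.

Section Hochschild.
Variables (R : nzRingType) (p : nat).
Hypothesis pR : p \in [pchar R].

Let p_pr : prime p := pcharf_prime pR.
Let p_gt0 : (0 < p)%N := prime_gt0 p_pr.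

(** As [a] and its derivative need not commute, the terms cannot be collected; for [n = p] their sum
    is an iterated commutator by [iter_ad_pchar]. *)
Lemma derivXn_noncomm (a : {poly R}) n :
  (a ^+ n)^`() = \sum_(i < n) a ^+ (n.-1 - i) * a^`() * a ^+ i.
Proof.
elim: n => [|n IH]; first by rewrite expr0 derivC big_ord0.
rewrite exprSr derivM IH mulr_suml big_ord_recl /= subn0 expr0 mulr1 addrC.
congr (_ + _); apply: eq_bigr => i _.
by rewrite /bump /= add1n -mulrA -exprSr; congr (_ ^+ _ * _ * _); lia.
Qed.

(* Expand [(D + z T)^p] in a central indeterminate [T]: its derivative is
   [ad (D + z T)^(p-1) z = ad D^(p-1) z], which does not involve [T]. *)
Lemma hochschild (D z : R) :
  (forall i, GRing.comm z (iter i (ad D) z)) ->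
  (D + z) ^+ p = D ^+ p + z ^+ p + iter p.-1 (ad D) z.
Proof.
move=> cz; pose a : {poly R} := D%:P + z%:P * 'X.
have a' : a^`() = z%:P by rewrite /a derivD derivC add0r derivM derivC mul0r add0r derivX mulr1.
have coefa (u : R) (b : {poly R}) i : (a * b)`_i.+1 = D * b`_i.+1 + z * b`_i.
  by rewrite /a mulrDl coefD coefCM -mulrA coefCM -commr_polyX coefMX.
have coefa0 (b : {poly R}) : (a * b)`_0 = D * b`_0.
  by rewrite /a mulrDl coefD coefCM -mulrA coefCM -commr_polyX coefMX mulr0 addr0.
have c0 n : (a ^+ n)`_0 = D ^+ n.
  by elim: n => [|n IH]; rewrite ?coef1 // !exprS coefa0 IH.
have cbig n i : (n < i)%N -> (a ^+ n)`_i = 0.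
  elim: n i => [|n IH] [|i] // ni; first by rewrite expr0 coef1.
  by rewrite exprS (coefa 0) !IH ?mulr0 ?addr0 // ltnW.
have cn n : (a ^+ n)`_n = z ^+ n.
  elim: n => [|n IH]; first by rewrite !expr0 coef1.
  by rewrite exprS (coefa 0) cbig // mulr0 add0r IH exprS.
have pP : p \in [pchar {poly R}] by rewrite pchar_poly.
(* Since [z] commutes with its own iterated commutators, the part [z%:P * 'X] of [a] contributes
   nothing to [ad a]. *)
have iterP n : iter n (fun u => a * u - u * a) z%:P = (iter n (ad D) z)%:P.
  elim: n => [|n IH] //; rewrite !iterS IH /ad /a; set u := iter n _ _.
  rewrite mulrDl mulrDr -[z%:P * 'X * _]mulrA -(commr_polyX u%:P) !mulrA -!polyCM (cz n).
  by rewrite opprD addrACA subrr addr0 polyCB.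
have da : (a ^+ p)^`() = (iter p.-1 (ad D) z)%:P.
  by rewrite derivXn_noncomm a' -iterP (iter_ad_pchar pP).
have := @horner_exp_comm _ a 1 p; rewrite /comm_poly mulr1 mul1r => /(_ erefl).
rewrite {2}/a hornerD hornerC hornerMX hornerC mulr1 => <-.
have szp : (size (a ^+ p) <= p.+1)%N by apply/leq_sizeP => j /cbig.
rewrite (horner_coef_wide _ szp) -(big_mkord xpredT (fun i => (a ^+ p)`_i * 1 ^+ i)).
rewrite big_nat_recr //= big_ltn // big_ltn ?prime_gt1 //= !expr1n !mulr1 c0 cn.
have coefda i : (a ^+ p)`_i.+1 *+ i.+1 = (iter p.-1 (ad D) z)%:P`_i.
  by rewrite -da coef_deriv.
have -> : (a ^+ p)`_1 = iter p.-1 (ad D) z by have := coefda 0%N; rewrite mulr1n coefC.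
(* In degrees 2 to [p - 1] the constant derivative has coefficient 0, and the degree itself is
   invertible modulo [p] by Bezout. *)
rewrite big_nat_cond big1 => [|[|i] /andP[/andP[i1 ip] _]] //; last first.
  rewrite expr1n mulr1; have := coefda i; rewrite coefC -mulr_natr.
  case: i i1 ip => // i _ ip /= H.
  have cop : coprime i.+2 p by rewrite coprime_sym prime_coprime // gtnNdvd.
  have [u v Huv _] := egcdnP p (ltn0Sn i.+1).
  have := congr1 (fun x => x * u%:R) H; rewrite mul0r -mulrA -natrM mulnC Huv (eqP cop).
  by rewrite natrD natrM (pcharf0 pR) mulr0 add0r mulr1.
by rewrite addr0 addrAC.
Qed.
End Hochschild.

Section Frobenius.
Variables (K : fieldType) (p : nat).
Hypothesis pK : p \in [pchar K].
Let p_pr : prime p := pcharf_prime pK.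
Let p_gt0 : (0 < p)%N := prime_gt0 p_pr.

Lemma frobD n (x y : K) : (x + y) ^+ (p ^ n) = x ^+ (p ^ n) + y ^+ (p ^ n).
Proof.
rewrite exprDn_pchar // (eq_pnat _ (pcharf_eq pK)).
by rewrite pnatX pnat_id.
Qed.

Lemma frobN n (x : K) : (- x) ^+ (p ^ n) = - x ^+ (p ^ n).
Proof.
apply/eqP; rewrite -addr_eq0 -frobD addNr expr0n expn_eq0.
by rewrite eqn0Ngt p_gt0.
Qed.

Lemma frobB n (x y : K) : (x - y) ^+ (p ^ n) = x ^+ (p ^ n) - y ^+ (p ^ n).
Proof. by rewrite frobD frobN. Qed.

Lemma frob_sum n I (s : seq I) (P : pred I) (F : I -> K) :
  (\sum_(i <- s | P i) F i) ^+ (p ^ n) = \sum_(i <- s | P i) F i ^+ (p ^ n).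
Proof.
elim/big_rec2: _ => [|i y1 y2 _ <-]; last by rewrite frobD.
by rewrite expr0n expn_eq0 eqn0Ngt p_gt0.
Qed.

Lemma frobD1 (x y : K) : (x + y) ^+ p = x ^+ p + y ^+ p.
Proof. by have := frobD 1 x y; rewrite expn1. Qed.
Lemma frobB1 (x y : K) : (x - y) ^+ p = x ^+ p - y ^+ p.
Proof. by have := frobB 1 x y; rewrite expn1. Qed.
Lemma frob_sum1 I (s : seq I) (P : pred I) (F : I -> K) :
  (\sum_(i <- s | P i) F i) ^+ p = \sum_(i <- s | P i) F i ^+ p.
Proof. by have := frob_sum 1 s P F; rewrite expn1. Qed.

Lemma natr_frob n : n%:R ^+ p = n%:R :> K.
Proof.
elim: n => [|n IH]; first by rewrite expr0n eqn0Ngt p_gt0.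
by rewrite mulrS frobD1 expr1n IH.
Qed.

(** The images of [0, .., p - 1] already exhaust the possible roots of [X^p - X]. Elements of the
    prime field are handled in this form in both [K] and [L]. *)
Lemma Fp_natr (r : K) : r ^+ p = r -> exists n : nat, r = n%:R.
Proof.
move=> Hr; pose s : seq K := [seq n%:R | n <- iota 0 p].
have us : uniq s.
  rewrite map_inj_in_uniq ?iota_uniq // => i j; rewrite !mem_iota !add0n /= => ip jp E.
  wlog ij : i j ip jp E / (i <= j)%N.
    by move=> W; case/orP: (leq_total i j) => H; [exact: W|apply/esym/W].
  apply/eqP; rewrite eqn_leq ij /= -subn_eq0; apply/eqP.
  have : (p %| j - i)%N by rewrite (dvdn_pcharf pK) natrB // E subrr.
  by move/dvdn_leq; case: (j - i)%N (leq_subr i j) => // d; lia.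
pose P : {poly K} := 'X^p - 'X.
have szP : size P = p.+1.
  by rewrite /P size_polyDl size_polyXn // size_polyN size_polyX ltnS prime_gt1.
have P0 : P != 0 by rewrite -size_poly_eq0 szP.
have [rs|rs] := boolP (r \in s).
  by case/mapP: rs => n _ ->; exists n.
have := max_poly_roots P0 (rs := r :: s); rewrite /= rs us szP size_map size_iota ltnn.
move=> /(_ _ isT) H; suff: false by []; apply: H; apply/andP; split.
  by rewrite rootE /P hornerD hornerN hornerXn hornerX Hr subrr.
apply/allP => x /mapP [n _ ->].
by rewrite rootE /P hornerD hornerN hornerXn hornerX natr_frob subrr.
Qed.

End Frobenius.

(** * Discretely valued fields *)

Section ValuedField.
Variables (K : fieldType) (v : K -> \bar int).
Hypothesis dv : discrete_valuation v.
Local Notation M := (mpow v).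

Lemma val_fin x : x != 0 -> exists n : int, v x = n%:E.
Proof.
move=> /eqP x0; case E : (v x) => [n||]; first by exists n.
  by case: x0; apply/(val_pinfty dv).
by case: (val_ninfty dv E).
Qed.

Lemma val0 : v 0 = +oo%E.
Proof. exact/(val_pinfty dv). Qed.

Lemma val1 : v 1 = 0%:E.
Proof.
have [n E] := val_fin (oner_neq0 K).
have := Defs.valM dv 1 1; rewrite mulr1 E -EFinD => -[] /eqP.
by rewrite -subr_eq0 opprD addNKr oppr_eq0 => /eqP ->.
Qed.

Lemma valX n x m : v x = m%:E -> v (x ^+ n) = (m * n%:Z)%:E.
Proof.
move=> E; elim: n => [|n IH]; first by rewrite expr0 val1 mulr0.
rewrite exprS (Defs.valM dv) E IH -EFinD; congr EFin; nia.
Qed.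

Lemma val_neq0 x m : v x = m%:E -> x != 0.
Proof. by move=> E; apply/eqP => x0; rewrite x0 val0 in E. Qed.

Lemma valV x m : v x = m%:E -> v x^-1 = (- m)%:E.
Proof.
move=> E; have x0 := val_neq0 E.
have [n En] : exists n : int, v x^-1 = n%:E by apply: val_fin; rewrite invr_eq0.
have := Defs.valM dv x x^-1; rewrite divff // val1 E En -EFinD => -[] H.
by congr EFin; lia.
Qed.

Lemma valz (n : int) x m : v x = m%:E -> v (x ^ n) = (m * n)%:E.
Proof.
by move=> E; case: n => n; [|rewrite NegzE mulrN; apply: valV]; apply: valX.
Qed.

Lemma valN x : v (- x) = v x.
Proof.
have vN1 : v (-1) = 0%:E.
  have [|n E] := @val_fin (-1); first by rewrite oppr_eq0 oner_eq0.
  have := Defs.valM dv (-1) (-1); rewrite mulrNN mulr1 val1 E -EFinD => -[] H.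
  by congr EFin; lia.
rewrite -mulN1r (Defs.valM dv) vN1; case: (v x) => // r.
by rewrite -EFinD add0r.
Qed.

Lemma mpow0 (r : int) : M r 0.
Proof. by rewrite /mpow /= val0 leey. Qed.

Lemma mpowD (r : int) x y : M r x -> M r y -> M r (x + y).
Proof.
rewrite /mpow /= => Hx Hy; apply: le_trans (Defs.valD dv x y).
by rewrite le_min Hx Hy.
Qed.

Lemma mpowN (r : int) x : M r x -> M r (- x).
Proof. by rewrite /mpow /= valN. Qed.

Lemma mpowB (r : int) x y : M r x -> M r y -> M r (x - y).
Proof. by move=> Hx Hy; apply: mpowD => //; apply: mpowN. Qed.

Lemma mpowBC (r : int) x y : M r (x - y) -> M r (y - x).
Proof. by move=> /mpowN; rewrite opprB. Qed.

Lemma mpow_trans (r : int) y x z : M r (x - y) -> M r (y - z) -> M r (x - z).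
Proof. by move=> /mpowD H /H; rewrite addrA subrK. Qed.

Lemma mpowBl (r : int) x y : M r (x - y) -> M r y -> M r x.
Proof. by move=> /mpowD H /H; rewrite subrK. Qed.

Lemma mpow_sum I (s : seq I) (P : pred I) (F : I -> K) (r : int) :
  (forall i, P i -> M r (F i)) -> M r (\sum_(i <- s | P i) F i).
Proof. by move=> H; elim/big_ind: _ => //; [exact: mpow0|exact: mpowD]. Qed.

Lemma mpow_le (r s : int) x : s <= r -> M r x -> M s x.
Proof. by rewrite /mpow /= => sr; apply: le_trans; rewrite lee_fin. Qed.

Lemma mpowM (r s : int) x y : M r x -> M s y -> M (r + s) (x * y).
Proof. by rewrite /mpow /= (Defs.valM dv) EFinD => Hx Hy; apply: leeD. Qed.

Lemma mpowM0 (r : int) x y : M r x -> M 0 y -> M r (x * y).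
Proof. by move=> Hx Hy; rewrite -[r]addr0; apply: mpowM. Qed.

Lemma mpow0M (r : int) x y : M 0 x -> M r y -> M r (x * y).
Proof. by move=> Hx Hy; rewrite -[r]add0r; apply: mpowM. Qed.

Lemma mpowE (r : int) x m : v x = m%:E -> M r x <-> r <= m.
Proof. by rewrite /mpow /= => ->; rewrite lee_fin. Qed.

Lemma mpow_val x m : v x = m%:E -> M m x.
Proof. by move=> E; apply/(mpowE _ E). Qed.

Lemma mpow1 : M 0 1.
Proof. exact: mpow_val val1. Qed.

Lemma mpowX (r : int) n x : M r x -> M (r * n%:Z) (x ^+ n).
Proof.
move=> H; elim: n => [|n IH]; first by rewrite mulr0; apply: mpow1.
have -> : r * n.+1%:Z = r + r * n%:Z by nia.
by rewrite exprS; apply: mpowM.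
Qed.

Lemma mpow0X n x : M 0 x -> M 0 (x ^+ n).
Proof. by move=> /(@mpowX _ n); rewrite mul0r. Qed.

Lemma mpow_nat n : M 0 n%:R.
Proof.
by elim: n => [|n IH]; [exact: mpow0 | rewrite mulrS; apply: mpowD => //; exact: mpow1].
Qed.

Lemma mpow_inf x : (forall n : nat, M n%:Z x) -> x = 0.
Proof.
move=> H; apply/eqP; apply/negPn/negP => /val_fin [n E].
have /(mpowE _ E) := H (`|n|.+1)%N; lia.
Qed.

Lemma mpowMV (r : int) x y m : v y = m%:E -> M r (x * y) -> M (r - m) x.
Proof.
move=> E H; have y0 := val_neq0 E.
by rewrite -(mulfK y0 x); apply: mpowM H (mpow_val (valV E)).
Qed.

Lemma mpow_exact x m : M m x -> ~ M (m + 1) x -> v x = m%:E.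
Proof.
move=> H1 H2; have [x0|/val_fin [n E]] := eqVneq x 0.
  by case: H2; rewrite x0; apply: mpow0.
move: H1 => /(mpowE _ E) H1; have /negP : ~ (m + 1 <= n) by move/(mpowE _ E).
by rewrite E => H3; congr EFin; lia.
Qed.

Lemma val_addl x y m : v x = m%:E -> M (m + 1) y -> v (x + y) = m%:E.
Proof.
move=> E H; apply: mpow_exact.
  by apply: mpowD; [exact: mpow_val|apply: mpow_le H; lia].
move=> H2; have: M (m + 1) x by rewrite -(addrK y x); apply: mpowB.
by move/(mpowE _ E); lia.
Qed.

Lemma val_approx x y m : v y = m%:E -> M (m + 1) (x - y) -> v x = m%:E.
Proof. by move=> E H; rewrite -(subrK y x) addrC; apply: val_addl. Qed.

Lemma mpow_subX (r m : int) n x y : M m x -> M m y ->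
  M (m + r) (x - y) -> M (m * n%:Z + r) (x ^+ n - y ^+ n).
Proof.
move=> Hx Hy H; case: n => [|n].
  by rewrite !expr0 subrr; apply: mpow0.
have -> : m * n.+1%:Z + r = (m + r) + m * n%:Z by nia.
rewrite subrXX; apply: mpowM => //.
apply: mpow_sum => i _.
have -> : m * n%:Z = m * (n - i)%N%:Z + m * (i : nat)%:Z.
  by rewrite -mulrDr; congr (_ * _); have := ltn_ord i; lia.
by apply: mpowM; apply: mpowX.
Qed.

Lemma unit1_val x : M 1 (x - 1) -> v x = 0%:E.
Proof. by apply: val_approx val1. Qed.

Lemma vcvg_unique u l l' : vcvg v u l -> vcvg v u l' -> l = l'.
Proof.
move=> H H'; apply/eqP; rewrite -subr_eq0; apply/eqP/mpow_inf => n.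
have [N HN] := H n; have [N' HN'] := H' n.
apply: (mpow_trans (y := u (maxn N N'))); first by apply: mpowBC; apply: HN; lia.
by apply: HN'; lia.
Qed.

Lemma vlimP u l : vcvg v u l -> vlim v u = l.
Proof.
move=> H; rewrite /vlim; case: xgetP => [x _ /= Hx|/(_ l)]; last by case.
exact: vcvg_unique Hx H.
Qed.

Lemma vcvg_mpow u l (r : int) N : vcvg v u l -> (forall i, (N <= i)%N -> M r (u i)) -> M r l.
Proof.
move=> H Hu; have [N' HN'] := H r.
rewrite -(subKr (u (maxn N N')) l); apply: mpowB; first by apply: Hu; lia.
by apply: HN'; lia.
Qed.

Lemma vcauchy_step u : (forall n : nat, M n%:Z (u n.+1 - u n)) -> vcauchy v u.
Proof.
move=> H n; exists `|n|%N.
have Hj j d : (`|n| <= j)%N -> M n (u (j + d)%N - u j).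
  move=> Hj; elim: d => [|d IH]; first by rewrite addn0 subrr; apply: mpow0.
  apply: (mpow_trans (y := u (j + d)%N)) => //.
  by rewrite addnS; apply: mpow_le (H _); lia.
move=> i j Hi Hj'; case: (leqP i j) => ij.
  by apply: mpowBC; rewrite -(subnKC ij); apply: Hj.
by rewrite -(subnKC (ltnW ij)); apply: Hj.
Qed.

(* Banach fixed point: [s] is the limit of [s_{j+1} = s_j + (w - F s_j)]. *)
Lemma contraction_surj (F : K -> K) (N : nat) :
  vcomplete v -> F 0 = 0 ->
  (forall (r : int) s s', N%:Z <= r -> M N s -> M N s' -> M r (s - s') ->
     M (r + 1) (F s - F s' - (s - s'))) ->
  forall (r : int) w, N%:Z <= r -> M r w -> exists2 s, M r s & F s = w.
Proof.
move=> cpl F0 HF r w Nr Hw.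
have HFN s : M r s -> M r (F s).
  move=> Hs; have := HF r s 0 Nr; rewrite F0 !subr0 => /(_ (mpow_le Nr Hs) (mpow0 _) Hs).
  by move=> /(mpow_le (s := r)) H; rewrite -(subrK s (F s)); apply: mpowD => //; apply: H; lia.
pose g s := s + (w - F s).
have gM s : M r s -> M r (g s).
  by move=> Hs; apply: mpowD => //; apply: mpowB => //; apply: HFN.
pose u n := iter n g 0.
have uE n : u n.+1 = u n + (w - F (u n)) by [].
have uM n : M r (u n).
  by elim: n => [|n IH]; [exact: mpow0|rewrite /u iterS; exact: gM].
have uw (n : nat) : M (r + n%:Z) (w - F (u n)).
  elim: n => [|n IH]; first by rewrite addr0; apply: mpowB => //; apply: HFN.
  have -> : w - F (u n.+1) = - (F (u n.+1) - F (u n) - (u n.+1 - u n)).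
    by rewrite [X in _ - (X - u n)]uE; ring.
  have {1}-> : r + n.+1%:Z = (r + n) + 1 by lia.
  apply: mpowN; apply: HF; [by lia|exact: mpow_le (uM _)|exact: mpow_le (uM _)|].
  by rewrite uE addrAC subrr add0r.
have uS (n : nat) : M (r + n%:Z) (u n.+1 - u n).
  by rewrite uE addrAC subrr add0r.
have [s Hs] : exists l, vcvg v u l.
  apply: cpl; apply: vcauchy_step => n; apply: mpow_le (uS n); lia.
have sM : M r s by apply: (vcvg_mpow (N := 0) Hs).
exists s => //; apply/eqP; rewrite eq_sym -subr_eq0; apply/eqP/mpow_inf => n.
have [N' HN'] := Hs (r + n); pose m := maxn N' n.
apply: (mpow_trans (y := F (u m))).
  by apply: mpow_le (uw m); rewrite /m; lia.
have H1 : M (r + n) (u m - s) by apply: HN'; rewrite /m; lia.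
have := HF (r + n) (u m) s; rewrite (_ : N%:Z <= _) ?(mpow_le Nr) //; last by lia.
move=> /(_ isT (mpow_le Nr (uM m)) (mpow_le Nr sM) H1) H2.
rewrite -(subrK (u m - s) (F (u m) - F s)); apply: mpowD.
  by apply: mpow_le H2; lia.
by apply: mpow_le H1; lia.
Qed.

(** A nonzero term of least valuation is alone at its valuation, so nothing can cancel it and the
    sum has the same valuation. *)
Lemma val_sum_distinct (I : finType) (g : I -> K) (r : int) :
  (forall i j, g i != 0 -> v (g i) = v (g j) -> i = j) ->
  M r (\sum_i g i) -> forall i, M r (g i).
Proof.
move=> inj; move=> Hs i.
case: (@Order.TotalTheory.arg_minP _ _ I i predT (fun j => v (g j)) isT) => i0 _ Hmin.
suff: M r (g i0) by rewrite /mpow /= => H; apply: le_trans H (Hmin i isT).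
have [->|n0] := eqVneq (g i0) 0; first exact: mpow0.
have [m Em] := val_fin n0.
suff E : v (\sum_j g j) = m%:E by move: Hs; rewrite /mpow /= E Em.
rewrite (bigD1 i0) //=; apply: val_addl => //; apply: mpow_sum => j ji0.
have [->|nj] := eqVneq (g j) 0; first exact: mpow0.
have [l El] := val_fin nj; apply/(mpowE _ El).
have := Hmin j isT; rewrite Em El lee_fin => ml.
suff: m != l by lia.
apply/eqP => ml'; move: ji0; rewrite (inj i0 j n0) ?eqxx //.
by rewrite Em El ml'.
Qed.

End ValuedField.

(** * Teichmueller representatives and Laurent expansions *)

Section LocalField.
Set Default Proof Using "All".
Variables (p : nat) (K : fieldType) (v : K -> \bar int).
Variables (kK : finFieldType) (res : K -> kK).
Hypothesis pK : p \in [pchar K].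
Hypothesis lf : local_field v res.

Let dv : discrete_valuation v := local_val lf.
Local Notation M := (mpow v).
Local Notation q := #|kK|.
Local Notation Kbar := (teichmuller v q).

Let p_pr : prime p := pcharf_prime pK.
Let p_gt0 : (0 < p)%N := prime_gt0 p_pr.

Lemma res0 : res 0 = 0.
Proof. by apply/(res_ker (local_res lf)); apply: mpow0. Qed.

Lemma res_sub x y : M 0 x -> M 0 y -> res x = res y -> M 1 (x - y).
Proof.
have rf := local_res lf; move=> Hx Hy E; have HB := mpowB dv Hx Hy.
apply/(res_ker rf) => //; apply: (@addIr _ (res y)).
by rewrite -(resD rf) // subrK E add0r.
Qed.

Lemma resX x n : M 0 x -> res (x ^+ n) = res x ^+ n.
Proof.
have rf := local_res lf; move=> Hx; elim: n => [|n IH]; first by rewrite (res1 rf).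
by rewrite !exprS (resM rf) ?IH //; apply: mpow0X.
Qed.

Lemma res_nat n : res n%:R = n%:R.
Proof.
have rf := local_res lf; elim: n => [|n IH]; first exact: res0.
by rewrite !mulrS (resD rf) ?IH ?(res1 rf) //; [exact: mpow1|exact: mpow_nat].
Qed.

Lemma card_residue : { f : nat | (0 < f)%N /\ q = (p ^ f)%N }.
Proof.
have pk : p \in [pchar kK].
  by rewrite inE p_pr -res_nat pcharf0 // res0 eqxx.
have := card_pprimeChar pk; set m := logn _ _ => E.
exists m; split; last exact: E.
rewrite lt0n; apply/eqP => m0; have := finNzRing_gt1 kK; rewrite -cardsT.
by move: E; rewrite m0 expn0 /= cardsT => ->.
Qed.

Definition resdeg := sval card_residue.
Local Notation f := resdeg.
Lemma resdeg_gt0 : (0 < f)%N. Proof. by case: (svalP card_residue). Qed.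
Lemma card_resdeg : q = (p ^ f)%N. Proof. by case: (svalP card_residue). Qed.

Lemma KbarE c : Kbar c -> c ^+ q = c. Proof. by case. Qed.
Lemma Kbar_int c : Kbar c -> M 0 c. Proof. by case. Qed.
Lemma Kbar_zero : Kbar 0.
Proof. by split; [apply: mpow0|rewrite card_resdeg expr0n expn_eq0 eqn0Ngt p_gt0]. Qed.
Lemma Kbar1 : Kbar 1.
Proof. by split; [apply: mpow1|rewrite expr1n]. Qed.
(** Special to characteristic [p]: as [q] is a power of [p], the map [x |-> x^q] is additive. *)
Lemma KbarD c d : Kbar c -> Kbar d -> Kbar (c + d).
Proof.
move=> [c1 c2] [d1 d2]; split; first exact: mpowD.
by rewrite card_resdeg (frobD pK) -card_resdeg c2 d2.
Qed.
Lemma KbarN c : Kbar c -> Kbar (- c).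
Proof.
move=> [c1 c2]; split; first exact: mpowN.
by rewrite card_resdeg (frobN pK) -card_resdeg c2.
Qed.
Lemma KbarB c d : Kbar c -> Kbar d -> Kbar (c - d).
Proof. by move=> Hc Hd; apply/KbarD/KbarN. Qed.
Lemma KbarM c d : Kbar c -> Kbar d -> Kbar (c * d).
Proof.
move=> [c1 c2] [d1 d2]; split; first exact: mpow0M.
by rewrite exprMn c2 d2.
Qed.
Lemma KbarX n c : Kbar c -> Kbar (c ^+ n).
Proof.
by move=> H; elim: n => [|n IH]; [exact: Kbar1|rewrite exprS; exact: KbarM].
Qed.
Lemma Kbar_nat n : Kbar n%:R.
Proof.
elim: n => [|n IH]; first exact: Kbar_zero.
by rewrite mulrS; apply: KbarD => //; apply: Kbar1.
Qed.
Lemma Kbar_sum I (s : seq I) (P : pred I) (F : I -> K) :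
  (forall i, P i -> Kbar (F i)) -> Kbar (\sum_(i <- s | P i) F i).
Proof. by move=> H; elim/big_ind: _ => //; [exact: Kbar_zero|exact: KbarD]. Qed.

Lemma card_res_gt1 : (1 < q)%N. Proof. exact: finNzRing_gt1. Qed.

Lemma Kbar_M1 c : Kbar c -> M 1 c -> c = 0.
Proof.
move=> [_ cq] c1; apply/eqP/negPn/negP => /(val_fin dv) [n E].
have := valX dv q E; rewrite cq E => -[] En.
move: c1 => /(mpowE _ E) n1; have := card_res_gt1.
by case: #|kK| En => [|[|Q]] // En _; nia.
Qed.

Lemma Kbar_val c : Kbar c -> c != 0 -> v c = 0%:E.
Proof.
move=> Hc /eqP c0; apply: mpow_exact => //; first exact: Kbar_int.
by move=> H; apply/c0/Kbar_M1.
Qed.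

Lemma KbarV c : Kbar c -> Kbar c^-1.
Proof.
move=> Hc; have [->|c0] := eqVneq c 0; first by rewrite invr0; apply: Kbar_zero.
split; last by rewrite exprVn KbarE.
by rewrite /mpow /= (valV dv (Kbar_val Hc c0)).
Qed.

(** Raising to the power [p^(f * n)] is the identity on [Kbar], so the power [p^(f * n - n)] inverts
    the power [p^n]. *)
Lemma Kbar_root n c : Kbar c -> exists2 d, Kbar d & d ^+ (p ^ n) = c.
Proof.
move=> Hc; exists (c ^+ (p ^ (f * n - n))); first exact: KbarX.
rewrite -exprM -expnD subnK; last by rewrite leq_pmull // resdeg_gt0.
elim: n => [|n IH]; first by rewrite muln0 expn0 expr1.
by rewrite mulnS expnD exprM -card_resdeg KbarE.
Qed.

(** The representative is the limit of [x^(q^n)]. Consecutive terms differ by the [q^n]-th power of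
    [x^q - x], which lies in M_K because the residue of [x] is fixed by the [q]-th power. *)
Lemma teich_exists x : M 0 x -> exists2 c, Kbar c & M 1 (x - c).
Proof.
move=> Hx; pose u n := x ^+ (q ^ n).
have uE n : u n.+1 = u n ^+ q by rewrite /u expnSr exprM.
have u0 n : M 0 (u n) by apply: mpow0X.
have d1 : M 1 (x ^+ q - x).
  by apply: res_sub => //; [exact: mpow0X|rewrite resX // expf_card].
have uS n : M n%:Z (u n.+1 - u n).
  have qn : (q ^ n = p ^ (f * n))%N by rewrite card_resdeg -expnM.
  rewrite /u expnS exprM qn -(frobB pK).
  have := mpowX dv (p ^ (f * n)) d1; apply: mpow_le; rewrite -qn mul1r.
  by have := ltn_expl n card_res_gt1; lia.
have [l Hl] := local_complete lf (vcauchy_step dv uS).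
have l0 : M 0 l by apply: (vcvg_mpow dv (N := 0) Hl).
exists l.
  split=> //; apply/eqP; rewrite -subr_eq0; apply/eqP/(mpow_inf dv) => n.
  have [N HN] := Hl n; apply: (mpow_trans dv (y := u N.+1)); last by apply: HN.
  rewrite uE; apply: (mpowBC dv); rewrite card_resdeg -(frobB pK) -card_resdeg.
  have := HN N (leqnn N) => H.
  rewrite -(prednK (ltnW card_res_gt1)) exprSr.
  apply: (mpow0M dv) => //; apply: (mpow0X dv); exact: (mpowB dv).
have [N HN] := Hl 1.
apply: (mpow_trans dv (y := u N)); last exact: HN.
elim: N {HN} => [|N IH]; first by rewrite /u expn0 expr1 subrr; apply: mpow0.
apply: (mpow_trans dv IH); apply: (mpowBC dv).
have qn : (q ^ N = p ^ (f * N))%N by rewrite card_resdeg -expnM.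
rewrite /u expnS exprM qn -(frobB pK).
have := mpowX dv (p ^ (f * N)) d1; apply: mpow_le; rewrite -qn mul1r.
by have := expn_gt0 q N; have := card_res_gt1; lia.
Qed.
End LocalField.

Section Laurent.
Set Default Proof Using "All".
Variables (p : nat) (K : fieldType) (v : K -> \bar int).
Variables (kK : finFieldType) (res : K -> kK) (t : K).
Hypothesis pK : p \in [pchar K].
Hypothesis lf : local_field v res.
Hypothesis vt : v t = 1%:E.

Let dv : discrete_valuation v := local_val lf.
Local Notation M := (mpow v).
Local Notation q := #|kK|.
Local Notation Kbar := (teichmuller v q).

Let p_pr : prime p := pcharf_prime pK.
Let p_gt0 : (0 < p)%N := prime_gt0 p_pr.

Let t0 : t != 0 := val_neq0 dv vt.

Lemma val_texp (n : int) : v (t ^ n) = n%:E.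
Proof. by rewrite (valz dv _ vt) mul1r. Qed.

Lemma texpD (m n : int) : t ^ (m + n) = t ^ m * t ^ n.
Proof. exact: expfzDr. Qed.

Lemma mpow_ct (n : int) c : Kbar c -> M n (c * t ^ n).
Proof. by move=> Hc; apply: mpow0M (Kbar_int pK lf Hc) (mpow_val (val_texp n)). Qed.

Lemma mpow_texp (r n : int) x : M r x -> M (r + n) (x * t ^ n).
Proof. by move=> H; apply: mpowM => //; apply: mpow_val (val_texp n). Qed.

Lemma digit (n : int) x : M n x -> exists2 c, Kbar c & M (n + 1) (x - c * t ^ n).
Proof.
move=> Hx; have H0 : M 0 (x * t ^ (- n)) by rewrite -(subrr n); apply: mpow_texp.
have [c Hc H] := teich_exists pK lf H0; exists c => //.
have := mpow_texp n H; rewrite mulrBl -mulrA -texpD addNr expr0z mulr1.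
by rewrite addrC.
Qed.

(** Finitely many digits separate an element from M^N, so additive statements reduce to monomials
    and to one deep ideal, without summing an infinite expansion. *)
Lemma laurent_ind (Q : K -> Prop) (N : int) :
  (forall x y, Q x -> Q y -> Q (x + y)) ->
  (forall c n, Kbar c -> Q (c * t ^ n)) ->
  (forall x, M N x -> Q x) -> forall x, Q x.
Proof.
move=> QD Qt QN x.
suff H (d : nat) y : M (N - d%:Z) y -> Q y.
  have [->|/(val_fin dv) [n E]] := eqVneq x 0; first by apply: QN; apply: mpow0.
  by apply: (H `|N - n|%N); apply/(mpowE _ E); lia.
elim: d y => [|d IH] y Hy; first by apply: QN; rewrite -[N]subr0.
have [c Hc H] := digit Hy; rewrite -(subrK (c * t ^ (N - d.+1%:Z)) y).
by apply: QD (Qt _ _ Hc); apply: IH; apply: mpow_le H; lia.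
Qed.

(** Only the finite principal part is recorded; everything of positive valuation goes into the
    remainder, so no convergence enters. *)
Definition const_coef (x c : K) := Kbar c /\ exists (m : nat) (y : nat -> K),
  (forall i, Kbar (y i)) /\ M 1 (x - c - \sum_(i < m) y i * t ^ (- i.+1%:Z)).

(** The deepest pole term must vanish, since all the other terms have smaller pole order; peel these
    terms off one at a time. *)
Lemma const_coef_unique0 c : const_coef 0 c -> c = 0.
Proof.
move=> [Hc [m [y [Hy]]]]; rewrite sub0r => /(mpowN dv); rewrite opprD !opprK.
elim: m => [|m IH].
  by rewrite big_ord0 addr0 => H1; exact: (Kbar_M1 pK lf Hc H1).
rewrite big_ord_recr /= addrA => H.
have Hm : M (- m%:Z) (c + \sum_(i < m) y i * t ^ (- i.+1%:Z)).
  apply: mpowD => //; first by apply: mpow_le (Kbar_int pK lf Hc); lia.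
  apply: mpow_sum => // i _; apply: mpow_le (mpow_ct _ (Hy i)).
  by have := ltn_ord i; lia.
have : M (- m%:Z) (y m * t ^ (- m.+1%:Z)).
  have -> : y m * t ^ (- m.+1%:Z) = 
      (c + \sum_(i < m) y i * t ^ (- i.+1%:Z) + y m * t ^ (- m.+1%:Z))
      - (c + \sum_(i < m) y i * t ^ (- i.+1%:Z)) by ring.
  by apply: mpowB => //; apply: mpow_le H; lia.
move/(mpow_texp m.+1%:Z); rewrite -mulrA -texpD addNr expr0z mulr1 => Hym.
have ym0 : y m = 0 by apply: (Kbar_M1 pK lf (Hy m)); apply: mpow_le Hym; lia.
by apply: IH; move: H; rewrite ym0 mul0r addr0.
Qed.

Lemma const_coefD x c x' c' :
  const_coef x c -> const_coef x' c' -> const_coef (x + x') (c + c').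
Proof.
move=> [Hc [m [y [Hy H]]]] [Hc' [m' [y' [Hy' H']]]]; split; first exact: (KbarD pK lf).
pose z m (y : nat -> K) i := if (i < m)%N then y i else 0.
have Hz n w : (forall i, Kbar (w i)) -> forall i, Kbar (z n w i).
  by move=> Hw i; rewrite /z; case: ifP => // _; apply: (Kbar_zero pK lf).
have zE n (w : nat -> K) n' : (n <= n')%N ->
    \sum_(i < n) w i * t ^ (- i.+1%:Z) = \sum_(i < n') z n w i * t ^ (- i.+1%:Z).
  move=> nn'; rewrite (big_ord_widen _ (fun i => w i * t ^ (- i.+1%:Z)) nn').
  by rewrite big_mkcond; apply: eq_bigr => i _; rewrite /z; case: ifP; rewrite ?mul0r.
exists (maxn m m'), (fun i => z m y i + z m' y' i); split.
  by move=> i; apply: (KbarD pK lf); apply: Hz.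
under eq_bigr => i _ do rewrite mulrDl.
rewrite big_split /= -!zE ?leq_maxl ?leq_maxr //.
set s := \sum_(i < m) _ in H *; set s' := \sum_(i < m') _ in H' *.
have -> : x + x' - (c + c') - (s + s') = (x - c - s) + (x' - c' - s') by ring.
exact: mpowD.
Qed.

Lemma const_coefZ a x c : Kbar a -> const_coef x c -> const_coef (a * x) (a * c).
Proof.
move=> Ha [Hc [m [y [Hy H]]]]; split; first exact: (KbarM pK lf).
exists m, (fun i => a * y i); split; first by move=> i; apply: (KbarM pK lf).
under eq_bigr => i _ do rewrite -mulrA.
rewrite -mulr_sumr -!mulrBr; apply: mpow0M => //; exact: Kbar_int pK lf _ Ha.
Qed.

Lemma const_coef_M1 x : M 1 x -> const_coef x 0.
Proof.
move=> Hx; split; first exact: (Kbar_zero pK lf).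
by exists 0%N, (fun _ => 0); split; [move=> _; exact: (Kbar_zero pK lf)|rewrite big_ord0 !subr0].
Qed.

Lemma const_coef_ct c (n : int) : Kbar c -> const_coef (c * t ^ n) (if n == 0 then c else 0).
Proof.
move=> Hc; case: eqVneq => [->|n0].
  rewrite expr0z mulr1; split=> //; exists 0%N, (fun _ => 0).
  by split; [move=> _; exact: (Kbar_zero pK lf)|rewrite big_ord0 subr0 subrr; apply: mpow0].
have [n1|n1] := boolP (1 <= n).
  by apply: const_coef_M1; apply: mpow_le (mpow_ct _ Hc).
split; first exact: (Kbar_zero pK lf).
pose m := (`|n| - 1)%N; exists m.+1, (fun i => if i == m then c else 0); split.
  by move=> i; case: ifP => // _; exact: (Kbar_zero pK lf).
rewrite big_ord_recr /= eqxx big1 => [|i _]; last first.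
  by rewrite ifF ?mul0r //; apply/negbTE; have := ltn_ord i; lia.
have -> : - m.+1%:Z = n by rewrite /m; lia.
by rewrite add0r subr0 subrr; apply: mpow0.
Qed.

Lemma const_coef_exists x : exists c, const_coef x c.
Proof.
apply: (@laurent_ind (fun x => exists c, const_coef x c) 1).
- by move=> y z [c Hc] [d Hd]; exists (c + d); apply: const_coefD.
- by move=> c n Hc; eexists; apply: const_coef_ct.
- by move=> y Hy; exists 0; apply: const_coef_M1.
Qed.

Lemma const_coef_unique x c c' : const_coef x c -> const_coef x c' -> c = c'.
Proof.
move=> H H'; apply/eqP; rewrite -subr_eq0; apply/eqP/const_coef_unique0.
rewrite -(subrr x); apply: const_coefD => //.
rewrite -(mulN1r x) -(mulN1r c'); apply: const_coefZ => //.
by apply: (KbarN pK lf); apply: (Kbar1 pK lf).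
Qed.

Definition ctc x : K := xget 0 [set c | const_coef x c].

Lemma ctcP x : const_coef x (ctc x).
Proof.
by rewrite /ctc; case: xgetP => // H; have [c /H] := const_coef_exists x.
Qed.

Lemma ctcE x c : const_coef x c -> ctc x = c.
Proof. exact: const_coef_unique (ctcP x). Qed.

Lemma ctc_Kbar x : Kbar (ctc x). Proof. by case: (ctcP x). Qed.
Lemma ctcD x y : ctc (x + y) = ctc x + ctc y.
Proof. by apply/ctcE/const_coefD; apply: ctcP. Qed.
Lemma ctcZ a x : Kbar a -> ctc (a * x) = a * ctc x.
Proof. by move=> Ha; apply/ctcE/const_coefZ => //; apply: ctcP. Qed.
Lemma ctcN x : ctc (- x) = - ctc x.
Proof.
by rewrite -mulN1r ctcZ ?mulN1r //; apply: (KbarN pK lf); apply: (Kbar1 pK lf).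
Qed.
Lemma ctcB x y : ctc (x - y) = ctc x - ctc y.
Proof. by rewrite ctcD ctcN. Qed.
Lemma ctcM1 x : M 1 x -> ctc x = 0.
Proof. by move=> H; apply/ctcE/const_coef_M1. Qed.
Lemma ctc0 : ctc 0 = 0.
Proof. exact/ctcM1/mpow0. Qed.
Lemma ctc_mono c (n : int) : Kbar c -> ctc (c * t ^ n) = if n == 0 then c else 0.
Proof. by move=> Hc; apply/ctcE/const_coef_ct. Qed.
Lemma ctc_sum I (s : seq I) (P : pred I) (F : I -> K) :
  ctc (\sum_(i <- s | P i) F i) = \sum_(i <- s | P i) ctc (F i).
Proof. by elim/big_rec2: _ => [|i y1 y2 _ <-]; rewrite ?ctc0 // ctcD. Qed.

Lemma ctc_near x y : M 1 (x - y) -> ctc x = ctc y.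
Proof. by move/ctcM1/eqP; rewrite ctcB subr_eq0 => /eqP. Qed.

Lemma ctc_frob x : ctc (x ^+ p) = ctc x ^+ p.
Proof.
apply: (@laurent_ind (fun x => ctc (x ^+ p) = ctc x ^+ p) 1) => [y z Hy Hz|c n Hc|y Hy].
- by rewrite (frobD1 pK) !ctcD (frobD1 pK) Hy Hz.
- rewrite exprMn (exprnP (t ^ n)) exprz_exp !ctc_mono //; last exact: (KbarX pK lf).
  have -> : (n * p%:Z == 0) = (n == 0) by rewrite mulf_eq0; case: eqP => //=; lia.
  by case: ifP; rewrite // expr0n eqn0Ngt p_gt0.
- rewrite !ctcM1 ?expr0n ?eqn0Ngt ?p_gt0 //.
  by have := mpowX dv p Hy; apply: mpow_le; lia.
Qed.

(** Multiplication by [t ^ (- n)], with [n] the valuation of [x], moves the nonzero leading digit to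
    the constant place. *)
Lemma ctc_detect x : (forall n : int, ctc (x * t ^ n) = 0) -> x = 0.
Proof.
move=> H; apply/eqP/negPn/negP => /(val_fin dv) [n E].
have [c Hc Hx] := digit (mpow_val E).
have := H (- n); rewrite (ctc_near (y := c)) => [|].
  rewrite -{1}[c]mulr1 -(expr0z t) ctc_mono // eqxx => c_0.
  by move: Hx; rewrite c_0 mul0r subr0 => /(mpowE _ E); lia.
have := mpow_texp (- n) Hx; rewrite mulrBl -mulrA -texpD subrr expr0z mulr1.
by apply: mpow_le; lia.
Qed.

Lemma ctc_mpow (r : int) x :
  (forall n : int, n < r -> ctc (x * t ^ (- n)) = 0) -> M r x.
Proof.
move=> H; have [->|/(val_fin dv) [n E]] := eqVneq x 0; first exact: mpow0.
apply/(mpowE _ E); rewrite leNgt; apply/negP => nr.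
have [c Hc Hx] := digit (mpow_val E).
have := H _ nr; rewrite (ctc_near (y := c)) => [|].
  rewrite -{1}[c]mulr1 -(expr0z t) ctc_mono // eqxx => c_0.
  by move: Hx; rewrite c_0 mul0r subr0 => /(mpowE _ E); lia.
have := mpow_texp (- n) Hx; rewrite mulrBl -mulrA -texpD subrr expr0z mulr1.
by apply: mpow_le; lia.
Qed.

End Laurent.

(** * The derivation t d/dt and the pairing *)

Section Derivation.
Set Default Proof Using "All".
Variables (p : nat) (K : fieldType) (v : K -> \bar int).
Variables (kK : finFieldType) (res : K -> kK) (t : K).
Hypothesis pK : p \in [pchar K].
Hypothesis lf : local_field v res.
Hypothesis vt : v t = 1%:E.

Let dv : discrete_valuation v := local_val lf.
Local Notation M := (mpow v).
Local Notation q := #|kK|.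
Local Notation Kbar := (teichmuller v q).
Local Notation ctc := (ctc v kK t).

Let p_pr : prime p := pcharf_prime pK.
Let p_gt0 : (0 < p)%N := prime_gt0 p_pr.
Let t0 : t != 0 := val_neq0 dv vt.

Let cf (j : int) x := ctc (x * t ^ (- j)).

Let cfD j x y : cf j (x + y) = cf j x + cf j y.
Proof. by rewrite /cf mulrDl (ctcD pK lf vt). Qed.

Let cf_Kbar j x : Kbar (cf j x). Proof. exact: (ctc_Kbar pK lf vt). Qed.

Let cf0 (r j : int) x : M r x -> j < r -> cf j x = 0.
Proof.
move=> Hx jr; apply: (ctcM1 pK lf vt); apply: mpow_le (mpow_texp pK lf vt (- j) Hx).
by lia.
Qed.

Let dsum (m N : nat) x :=
  \sum_(i < N) (i%:Z - m%:Z)%:~R * cf (i%:Z - m%:Z) x * t ^ (i%:Z - m%:Z).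

(** The bound on the pole of [x] makes the coefficients below degree [-m] zero. Hence the relation
    survives an increase of [m], and [d] does not depend on the starting degree. *)
Let is_d (m : nat) x d := M (- m%:Z) x /\ forall N : nat, M (N%:Z - m%:Z) (d - dsum m N x).

Let term_mpow (j : int) x : M j (j%:~R * cf j x * t ^ j).
Proof.
apply: (mpow_ct pK lf vt); apply: (KbarM pK lf) (cf_Kbar _ _).
by case: j => n; rewrite ?NegzE ?mulrNz; [|apply: (KbarN pK lf)]; apply: (Kbar_nat pK lf).
Qed.

Let is_d_up m m' x d : (m <= m')%N -> is_d m x d -> is_d m' x d.
Proof.
move=> mm' [Hx Hd]; rewrite -(subnK mm'); elim: (m' - m)%N => [|j [IHx IH]] //.
split=> [|[|N]]; first by apply: mpow_le IHx; lia.
  rewrite /dsum big_ord0 subr0; have := IH 0%N; rewrite /dsum big_ord0 subr0.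
  by apply: mpow_le; lia.
rewrite /dsum big_ord_recl /= (cf0 IHx) ?mulr0 ?mul0r ?add0r; last by lia.
have -> : N.+1%:Z - (j.+1 + m)%N%:Z = N%:Z - (j + m)%N%:Z by lia.
rewrite (eq_bigr (fun i : 'I_N => (i%:Z - (j + m)%N%:Z)%:~R * cf (i%:Z - (j + m)%N%:Z) x
   * t ^ (i%:Z - (j + m)%N%:Z))); first exact: IH.
move=> i _; rewrite /bump /= add1n.
by have -> : i.+1%:Z - (j.+1 + m)%N%:Z = i%:Z - (j + m)%N%:Z by lia.
Qed.

Let is_dD m x y d e : is_d m x d -> is_d m y e -> is_d m (x + y) (d + e).
Proof.
move=> [Hx Hd] [Hy He]; split=> [|N]; first exact: mpowD.
have -> : dsum m N (x + y) = dsum m N x + dsum m N y.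
  rewrite /dsum -big_split; apply: eq_bigr => i _ /=.
  by rewrite cfD mulrDr mulrDl.
by rewrite opprD addrACA; apply: mpowD.
Qed.

Let is_d_unique m m' x d d' : is_d m x d -> is_d m' x d' -> d = d'.
Proof.
move=> /(is_d_up (leq_maxl m m')) [_ H] /(is_d_up (leq_maxr m m')) [_ H'].
apply/eqP; rewrite -subr_eq0; apply/eqP/(mpow_inf dv) => n.
apply: (mpow_trans dv (y := dsum (maxn m m') (n + maxn m m') x)).
  by apply: mpow_le (H _); lia.
by apply: (mpowBC dv); apply: mpow_le (H' _); lia.
Qed.

Let dsum_tail m N j x : M (N%:Z - m%:Z) (dsum m (N + j) x - dsum m N x).
Proof.
elim: j => [|j IH]; first by rewrite addn0 subrr; apply: mpow0.
apply: (mpow_trans dv _ IH); rewrite addnS /dsum big_ord_recr /= addrAC subrr add0r.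
by apply: mpow_le (term_mpow _ _); lia.
Qed.

Let is_d_exists x : exists d m, is_d m x d.
Proof.
have [m Hm] : exists m : nat, M (- m%:Z) x.
  have [->|/(val_fin dv) [n E]] := eqVneq x 0; first by exists 0%N; apply: mpow0.
  by exists `|n|%N; apply/(mpowE _ E); lia.
have [|d Hd] := local_complete lf (u := fun N => dsum m (N + m) x).
  apply: (vcauchy_step dv) => n; rewrite -addn1 addnAC.
  by apply: mpow_le (dsum_tail _ _ _ _); lia.
exists d, m; split=> // N; have [N' HN'] := Hd (N%:Z - m%:Z).
apply: (mpow_trans dv (y := dsum m (maxn N' N + m) x)).
  by apply: (mpowBC dv); apply: HN'; lia.
have -> : (maxn N' N + m = N + (maxn N' N + m - N))%N by lia.
exact: dsum_tail.
Qed.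

(* The derivation [t d/dt] of [K = Kbar((t))]. *)
Definition delta x : K := xget 0 [set d | exists m, is_d m x d].

Let deltaP x : exists m, is_d m x (delta x).
Proof. by rewrite /delta; case: xgetP => // H; have [d /H] := is_d_exists x. Qed.

Let deltaE m x d : is_d m x d -> delta x = d.
Proof. by move=> H; have [m' H'] := deltaP x; apply: is_d_unique H' H. Qed.

Lemma deltaD x y : delta (x + y) = delta x + delta y.
Proof.
have [m Hm] := deltaP x; have [m' Hm'] := deltaP y.
by apply: deltaE; apply: is_dD; [apply: is_d_up Hm|apply: is_d_up Hm'];
  [exact: leq_maxl|exact: leq_maxr].
Qed.

Lemma delta_mpow (r : int) x : M r x -> M r (delta x).
Proof.
move=> Hx; have [m [_ H]] := deltaP x.
have := H (`|r| + m)%N => /(mpow_le (s := r)) H'.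
apply: (mpowBl dv (H' _)); first by lia.
apply: (mpow_sum dv) => i _; have [jr|rj] := ltP (i%:Z - m%:Z) r.
  by rewrite (cf0 Hx jr) mulr0 mul0r; apply: mpow0.
exact: mpow_le (term_mpow _ _).
Qed.

Lemma delta_ct c (n : int) : Kbar c -> delta (c * t ^ n) = n%:~R * (c * t ^ n).
Proof.
move=> Hc; apply: (@deltaE `|n|%N); split=> [|N].
  by apply: mpow_le (mpow_ct pK lf vt n Hc); lia.
have cfE j : cf j (c * t ^ n) = if n == j then c else 0.
  rewrite /cf -mulrA -(texpD pK lf vt) (ctc_mono pK lf vt) //.
  by rewrite subr_eq0.
pose i0 := absz (n + (absz n)%:Z); have i0E : i0%:Z - `|n|%N%:Z = n by rewrite /i0; lia.
have [iN|Ni] := ltnP i0 N.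
  rewrite /dsum (bigD1 (Ordinal iN)) //= big1 ?addr0 => [|i ii0].
    by rewrite i0E cfE eqxx -mulrA subrr; apply: mpow0.
  rewrite cfE ifF ?mulr0 ?mul0r //; apply/negbTE; apply: contra ii0 => /eqP E.
  by apply/eqP/val_inj => /=; rewrite /i0 E; lia.
rewrite /dsum big1 ?subr0 => [|i _].
  have := term_mpow n (c * t ^ n); rewrite cfE eqxx -mulrA.
  by apply: mpow_le; lia.
rewrite cfE ifF ?mulr0 ?mul0r //; apply/negbTE/eqP => E.
by have := ltn_ord i; lia.
Qed.

Lemma delta0 : delta 0 = 0.
Proof. by apply: (@addrI _ (delta 0)); rewrite -deltaD !addr0. Qed.
Lemma deltaN x : delta (- x) = - delta x.
Proof. by apply/eqP; rewrite -addr_eq0 -deltaD addNr delta0. Qed.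
Lemma deltaB x y : delta (x - y) = delta x - delta y.
Proof. by rewrite deltaD deltaN. Qed.
Lemma delta_sum I (s : seq I) (P : pred I) (F : I -> K) :
  delta (\sum_(i <- s | P i) F i) = \sum_(i <- s | P i) delta (F i).
Proof. by elim/big_rec2: _ => [|i y1 y2 _ <-]; rewrite ?delta0 // deltaD. Qed.

(** Both sides are biadditive, so modulo each M^N it is enough to check pairs of monomials; [near]
    disposes of the case where one factor is deep compared with the other. *)
Lemma deltaM x y : delta (x * y) = x * delta y + delta x * y.
Proof.
apply/eqP; rewrite -subr_eq0; apply/eqP/(mpow_inf dv) => N.
have val_lb z : exists r : int, M r z.
  have [->|/(val_fin dv) [n E]] := eqVneq z 0; first by exists 0; apply: mpow0.
  by exists n; apply: mpow_val.
have near (r : int) z w : M (N%:Z - r) z -> M r w ->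
    M N (delta (z * w) - (z * delta w + delta z * w)) /\
    M N (delta (w * z) - (w * delta z + delta w * z)).
  move=> Hz Hw; have E : N%:Z = (N%:Z - r) + r by lia.
  have E' : N%:Z = r + (N%:Z - r) by lia.
  split; apply: (mpowB dv); try apply: (mpowD dv).
  - by apply: delta_mpow; rewrite E; apply: mpowM.
  - by rewrite E; apply: (mpowM dv) => //; apply: delta_mpow.
  - by rewrite E; apply: (mpowM dv) => //; apply: delta_mpow.
  - by apply: delta_mpow; rewrite E'; apply: mpowM.
  - by rewrite E'; apply: (mpowM dv) => //; apply: delta_mpow.
  - by rewrite E'; apply: (mpowM dv) => //; apply: delta_mpow.
have [r Hr] := val_lb y; move: x.
apply: (laurent_ind pK lf vt (N := N%:Z - r)) => [x x' Hx Hx'|c n Hc|x Hx]; last first.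
- by have [] := near r x y Hx Hr.
- have [r' Hr'] := val_lb (c * t ^ n); move: y {r Hr}.
  apply: (laurent_ind pK lf vt (N := N%:Z - r')) => [y y' Hy Hy'|c' n' Hc'|y Hy]; last first.
  + by have [] := near r' y _ Hy Hr'.
  + rewrite mulrACA -(texpD pK lf vt) !delta_ct //; last exact: (KbarM pK lf).
    rewrite (texpD pK lf vt) intrD.
    set A := n%:~R; set B := n'%:~R; set T := t ^ n; set T' := t ^ n'.
    have -> : (A + B) * (c * c' * (T * T')) -
       (c * T * (B * (c' * T')) + A * (c * T) * (c' * T')) = 0 by ring.
    exact: mpow0.
  + rewrite mulrDr !deltaD !mulrDr.
    by rewrite [X in _ - X]addrACA opprD addrACA; apply: mpowD.
- rewrite mulrDl !deltaD !mulrDl.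
  by rewrite [X in _ - X]addrACA opprD addrACA; apply: mpowD.
Qed.

Lemma delta_Kbar c : Kbar c -> delta c = 0.
Proof. by move=> Hc; have := delta_ct 0 Hc; rewrite expr0z mulr1 mul0r. Qed.
Lemma deltaZ c x : Kbar c -> delta (c * x) = c * delta x.
Proof. by move=> Hc; rewrite deltaM (delta_Kbar Hc) mul0r addr0. Qed.
Lemma delta1 : delta 1 = 0.
Proof. exact: delta_Kbar (Kbar1 pK lf). Qed.
Lemma deltaX x n : delta (x ^+ n.+1) = n.+1%:R * (x ^+ n * delta x).
Proof.
elim: n => [|n IH]; first by rewrite expr1 expr0 !mul1r.
rewrite exprS deltaM IH [n.+2%:R]mulrS exprS; ring.
Qed.

Lemma delta_frob x : delta (x ^+ p) = 0.
Proof. by rewrite -(prednK p_gt0) deltaX (prednK p_gt0) pcharf0 // mul0r. Qed.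

Lemma delta_frobM u x : delta (u ^+ p * x) = u ^+ p * delta x.
Proof. by rewrite deltaM delta_frob mul0r addr0. Qed.

(** Exact differentials have no residue: [delta] multiplies the coefficient of degree 0 by 0. *)
Lemma ctc_delta x : ctc (delta x) = 0.
Proof.
apply: (laurent_ind pK lf vt (N := 1) (Q := fun x => ctc (delta x) = 0)).
- by move=> y z Hy Hz; rewrite deltaD (ctcD pK lf vt) Hy Hz addr0.
- move=> c n Hc; rewrite delta_ct // mulrA (ctc_mono pK lf vt).
    by case: eqP => // ->; rewrite mul0r.
  apply: (KbarM pK lf) => //.
  by case: n => n; rewrite ?NegzE ?mulrNz; [|apply: (KbarN pK lf)]; apply: (Kbar_nat pK lf).
- by move=> y Hy; apply: (ctcM1 pK lf vt); apply: delta_mpow.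
Qed.

(** With this normalisation [ctc (z * dlog x)] is the residue of the differential form [z dx/x]. *)
Definition dlog x := delta x / x.

Lemma dlogM (x y : K) : x != 0 -> y != 0 -> dlog (x * y) = dlog x + dlog y.
Proof.
move=> x0 y0; rewrite /dlog deltaM; move: (delta x) (delta y) => a b.
by field; rewrite x0 y0.
Qed.

(** In this range of [i] the form is exact: [delta] kills [z ^+ p], so [z^p x^i / i] is a
    primitive. *)
Lemma ctc_dlogX (z x : K) i : (0 < i < p)%N -> x != 0 -> ctc (z ^+ p * x ^+ i * dlog x) = 0.
Proof.
move=> /andP[i0 ip] x0.
have iK : i%:R != 0 :> K by rewrite -(dvdn_pcharf pK) gtnNdvd.
have -> : z ^+ p * x ^+ i * dlog x = i%:R^-1 * delta (z ^+ p * x ^+ i).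
  case: i i0 ip iK => // i _ _ iK; rewrite delta_frobM deltaX /dlog exprS.
  move: iK (x ^+ i) (z ^+ p) (delta x); move: i.+1%:R => I iK X Z d.
  by field; rewrite ?x0 ?iK.
by rewrite (ctcZ pK lf vt) ?ctc_delta ?mulr0 //; apply: (KbarV pK lf); apply: (Kbar_nat pK lf).
Qed.

(** This makes [x^(p-1) delta x] additive in [x] modulo exact elements, which is what lets the
    Cartier argument be checked on monomials. *)
Lemma addX_pred_delta (x y : K) : exists g,
  (x + y) ^+ p.-1 * delta (x + y) =
  x ^+ p.-1 * delta x + y ^+ p.-1 * delta y + delta g.
Proof.
have [p' pE] : exists p', p = p'.+2 by exists p.-2; have := prime_gt1 p_pr; lia.
have ex (z w : K) : (z + w) ^+ p.-1 = \sum_(i < p) (-1 : K) ^+ i * (z ^+ (p.-1 - i) * w ^+ i).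
  rewrite -[w]opprK (subX_pred_pchar pK); last exact: mulrC.
  by apply: eq_bigr => i _; rewrite opprK [RHS]mulrCA -exprNn.
(* Formally [((x + y)^p - x^p - y^p) / p]: dividing the binomial coefficient of index [i + 1] by [p]
   leaves [(-1)^i / (i + 1)] modulo [p]. *)
pose g : K := \sum_(i < p.-1) ((-1 : K) ^+ i / i.+1%:R) * (x ^+ (p.-1 - i) * y ^+ i.+1).
exists g.
have iK i : (i < p.-1)%N -> i.+1%:R != 0 :> K.
  by move=> ip; rewrite -(dvdn_pcharf pK) gtnNdvd //; lia.
have dg : delta g = \sum_(i < p.-1) (-1 : K) ^+ i * (x ^+ (p.-1 - i) * y ^+ i) * delta y
   + \sum_(i < p.-1) (-1 : K) ^+ i.+1 * (x ^+ (p.-1 - i.+1) * y ^+ i.+1) * delta x.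
  rewrite /g delta_sum -big_split; apply: eq_bigr => i _ /=.
  have HK : Kbar ((-1 : K) ^+ i / i.+1%:R).
    apply: (KbarM pK lf); last by apply: (KbarV pK lf); apply: (Kbar_nat pK lf).
    by apply: (KbarX pK lf); apply: (KbarN pK lf); apply: (Kbar1 pK lf).
  rewrite deltaZ // deltaM deltaX.
  have -> : (p.-1 - i = (p.-1 - i.+1).+1)%N by have := ltn_ord i; lia.
  rewrite deltaX.
  have -> : (p.-1 - i.+1).+1%:R = - i.+1%:R :> K.
    apply/eqP; rewrite -addr_eq0 -natrD.
    have -> : ((p.-1 - i.+1).+1 + i.+1 = p)%N by have := ltn_ord i; lia.
    by rewrite pcharf0.
  have := iK i (ltn_ord i); rewrite !exprS.
  move: (i.+1%:R : K) (x ^+ _) (y ^+ _) ((-1 : K) ^+ i) (delta x) (delta y) => I X Y S a b I0.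
  by field.
rewrite deltaD mulrDr dg ex !mulr_suml.
have E1 : \sum_(i < p) (-1) ^+ i * (x ^+ (p.-1 - i) * y ^+ i) * delta x =
   x ^+ p.-1 * delta x + 
   \sum_(i < p.-1) (-1) ^+ i.+1 * (x ^+ (p.-1 - i.+1) * y ^+ i.+1) * delta x.
  rewrite -[in LHS](prednK p_gt0) big_ord_recl /= subn0 !expr0 mulr1 mul1r //.
have E2 : \sum_(i < p) (-1) ^+ i * (x ^+ (p.-1 - i) * y ^+ i) * delta y =
   \sum_(i < p.-1) (-1) ^+ i * (x ^+ (p.-1 - i) * y ^+ i) * delta y + y ^+ p.-1 * delta y.
  rewrite -[in LHS](prednK p_gt0) big_ord_recr /= subnn expr0 mul1r; congr (_ + _).
  by rewrite -(bin_pred_pchar pK) ?binn ?mul1r // prednK.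
by rewrite E1 E2; ring.
Qed.

(* Logarithmic differentials are fixed by the Cartier operator; for fixed [u]
   both sides of [ctc (u^p x^(p-1) delta x) = ctc (u delta x)^p] are additive in [x]. *)
Lemma ctc_dlog_frob_aux (u x : K) :
  ctc (u ^+ p * (x ^+ p.-1 * delta x)) = ctc (u * delta x) ^+ p.
Proof.
have [r Hr] : exists r : int, M r u.
  have [->|/(val_fin dv) [n E]] := eqVneq u 0; first by exists 0; apply: mpow0.
  by exists n; apply: mpow_val.
move: x; apply: (laurent_ind pK lf vt (N := 1 - r)) => [y y' Hy Hy'|c n Hc|y Hy].
- have [g ->] := addX_pred_delta y y'; rewrite !mulrDr -delta_frobM !(ctcD pK lf vt).
  by rewrite ctc_delta addr0 Hy Hy' deltaD mulrDr (ctcD pK lf vt) (frobD1 pK).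
- rewrite delta_ct // -(ctc_frob pK lf vt); congr ctc.
  rewrite ![in RHS]exprMn (exprnP n%:~R).
  have -> : (n%:~R : K) ^ p = n%:~R.
    case: n => n; first exact: (natr_frob pK).
    by rewrite NegzE mulrNz -exprnP -[p in LHS]expn1 (frobN pK) expn1 (natr_frob pK).
  congr (_ * _); rewrite -[in RHS](prednK p_gt0) !exprS exprMn; ring.
- have H1 : M 1 (u * delta y).
    have -> : 1 = r + (1 - r) by lia.
    by apply: mpowM => //; apply: delta_mpow.
  rewrite (ctcM1 pK lf vt H1) expr0n eqn0Ngt p_gt0 (ctcM1 pK lf vt) //.
  have -> : u ^+ p * (y ^+ p.-1 * delta y) = (u * y) ^+ p.-1 * (u * delta y).
    by rewrite -[in u ^+ p](prednK p_gt0) exprS exprMn; ring.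
  apply: (mpow0M dv) => //; apply: (mpow0X dv).
  by apply: (mpow_le (r := r + (1 - r))); [lia|apply: mpowM].
Qed.

Lemma ctc_dlog_frob (z x : K) : x != 0 -> ctc (z ^+ p * dlog x) = ctc (z * dlog x) ^+ p.
Proof.
move=> x0; have H := ctc_dlog_frob_aux (z / x) x.
have xp0 : x ^+ p.-1 != 0 by rewrite expf_neq0.
transitivity (ctc ((z / x) ^+ p * (x ^+ p.-1 * delta x))).
  rewrite exprMn exprVn -[in x ^+ p](prednK p_gt0) exprS /dlog.
  congr ctc; move: (x ^+ p.-1) (z ^+ p) (delta x) xp0 => X Z d xp0.
  by field; rewrite ?x0 ?xp0.
rewrite H; congr (ctc _ ^+ p); rewrite /dlog.
by rewrite mulrAC mulrA.
Qed.

End Derivation.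

Section Pairing.
Set Default Proof Using "All".
Variables (p : nat) (K : fieldType) (v : K -> \bar int).
Variables (kK : finFieldType) (res : K -> kK) (t : K).
Hypothesis pK : p \in [pchar K].
Hypothesis lf : local_field v res.
Hypothesis vt : v t = 1%:E.

Let dv : discrete_valuation v := local_val lf.
Local Notation M := (mpow v).
Local Notation q := #|kK|.
Local Notation Kbar := (teichmuller v q).
Local Notation ctc := (ctc v kK t).
Local Notation delta := (delta v kK t).
Local Notation dlog := (dlog v kK t).
Local Notation f := (resdeg pK lf).

Let p_pr : prime p := pcharf_prime pK.
Let p_gt0 : (0 < p)%N := prime_gt0 p_pr.

(** On [Kbar] this is the trace to the prime field, with values inside [K]; the polynomial form
    makes it additive on all of [K]. *)
Definition Ktrace (x : K) := \sum_(i < f) x ^+ (p ^ i).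
Local Notation tr := Ktrace.

Lemma trD x y : tr (x + y) = tr x + tr y.
Proof. by rewrite /tr -big_split; apply: eq_bigr => i _; rewrite (frobD pK). Qed.

Lemma tr0 : tr 0 = 0.
Proof. by apply: (@addrI _ (tr 0)); rewrite -trD !addr0. Qed.

Lemma trN x : tr (- x) = - tr x.
Proof. by apply/eqP; rewrite -addr_eq0 -trD addNr tr0. Qed.

Lemma trX x : Kbar x -> tr (x ^+ p) = tr x.
Proof.
move=> Hx; rewrite /tr -(prednK (resdeg_gt0 pK lf)) big_ord_recr big_ord_recl /= addrC.
congr (_ + _).
  by rewrite -exprM -expnS (prednK (resdeg_gt0 pK lf)) -(card_resdeg pK lf) (KbarE pK lf).
by apply: eq_bigr => i _; rewrite -exprM -expnS.
Qed.

Lemma tr_Fp x : Kbar x -> tr x ^+ p = tr x.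
Proof.
move=> Hx; rewrite -[RHS]trX // /tr (frob_sum1 pK); apply: eq_bigr => i _.
by rewrite -!exprM mulnC.
Qed.

Lemma FpX (r : K) n : r ^+ p = r -> r ^+ (p ^ n) = r.
Proof. by move=> Hr; elim: n => [|n IH]; rewrite ?expr1 // expnS exprM Hr. Qed.

Lemma Fp_Kbar (r : K) : r ^+ p = r -> Kbar r.
Proof.
move=> Hr; split; last by rewrite (card_resdeg pK lf) FpX.
have [->|r0] := eqVneq r 0; first exact: mpow0.
have [n E] := val_fin dv r0; apply/(mpowE _ E).
have := valX dv p E; rewrite Hr E => -[] En.
by have := prime_gt1 p_pr; nia.
Qed.

Lemma trZ r x : r ^+ p = r -> tr (r * x) = r * tr x.
Proof.
move=> Hr; rewrite /tr mulr_sumr; apply: eq_bigr => i _.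
by rewrite exprMn (FpX i Hr).
Qed.

Lemma Kbar_seq : exists2 s : seq K, uniq s & size s = q /\ forall c, c \in s <-> Kbar c.
Proof.
have rf := local_res lf.
have H a : exists c, Kbar c /\ res c = a.
  have [x Hx <-] := res_surj rf a.
  have [c Hc cx] := teich_exists pK lf Hx; exists c; split=> //.
  have Hc0 := Kbar_int pK lf Hc; have cx0 := mpowB dv Hx Hc0.
  have /(res_ker rf cx0) E := cx.
  by rewrite -[in RHS](subrK c x) (resD rf) // E add0r.
have [T HT] := choice H.
exists [seq T a | a <- enum kK].
  rewrite map_inj_uniq ?enum_uniq // => a b E.
  by rewrite -(HT a).2 -(HT b).2 E.
split=> [|c]; first by rewrite size_map cardE.
split=> [/mapP [a _ ->]|Hc]; first by case: (HT a).
apply/mapP; exists (res c); first by rewrite mem_enum.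
have [Hd dE] := HT (res c).
have Hc0 := Kbar_int pK lf Hc; have Hd0 := Kbar_int pK lf Hd.
apply/eqP; rewrite -subr_eq0; apply/eqP/(Kbar_M1 pK lf); first exact: (KbarB pK lf).
exact: (res_sub pK lf Hc0 Hd0).
Qed.

(** The trace is a nonzero polynomial of degree less than [q], so it cannot vanish on all [q]
    elements of [Kbar]. *)
Lemma tr_neq0 : exists2 c, Kbar c & tr c != 0.
Proof.
have [s us [szs sK]] := Kbar_seq.
pose P : {poly K} := \sum_(i < f) 'X^(p ^ i).
have P1 : P`_1 = 1.
  rewrite coef_sum (bigD1 (Ordinal (resdeg_gt0 pK lf))) //= coefXn expn0 eqxx big1 ?addr0 // => i i0.
  have i1 : (0 < i)%N by rewrite lt0n; apply: contra i0 => /eqP E; apply/eqP/val_inj.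
  have pi1 : (1 < p ^ i)%N by rewrite -{1}(expn0 p) ltn_exp2l ?prime_gt1.
  by rewrite coefXn (ltn_eqF pi1).
have P0 : P != 0 by apply/eqP => E; move: P1; rewrite E coef0 => /eqP; rewrite eq_sym oner_eq0.
have szP : (size P <= q)%N.
  apply: (leq_trans (size_sum _ _ _)); apply/bigmax_leqP => i _; rewrite size_polyXn.
  by rewrite (card_resdeg pK lf) ltn_exp2l ?prime_gt1.
have [/allP HA|] := boolP (all (root P) s).
  by have := max_poly_roots P0 (introT allP HA) us; rewrite szs ltnNge szP.
case/allPn => c /sK Hc; rewrite rootE => Pc; exists c => //.
suff -> : tr c = P.[c] by [].
by rewrite /P horner_sum; apply: eq_bigr => i _; rewrite hornerXn.
Qed.

(** Schmid's residue formula for the Artin-Schreier symbol: the trace of the residue of [b da/a]. *)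
Definition pairing (a b : K) := tr (ctc (b * dlog a)).

Lemma pairingM a a' b : a != 0 -> a' != 0 ->
  pairing (a * a') b = pairing a b + pairing a' b.
Proof.
by move=> a0 a0'; rewrite /pairing (dlogM pK lf vt) // mulrDr (ctcD pK lf vt) trD.
Qed.

Lemma pairingDr a b b' : pairing a (b + b') = pairing a b + pairing a b'.
Proof. by rewrite /pairing mulrDl (ctcD pK lf vt) trD. Qed.

Lemma pairing_wp a z : a != 0 -> pairing a (wp p z) = 0.
Proof.
move=> a0; rewrite /pairing /wp mulrBl (ctcB pK lf vt) trD trN (ctc_dlog_frob pK lf vt) //.
by rewrite trX ?subrr //; apply: (ctc_Kbar pK lf vt).
Qed.

Lemma pairing_frob a b : pairing (a ^+ p) b = 0.
Proof. by rewrite /pairing /dlog (delta_frob pK lf vt) mul0r mulr0 (ctc0 pK lf vt) tr0. Qed.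

Lemma dlog_mpow (n : int) a : 1 <= n -> M n (a - 1) -> M n (dlog a).
Proof.
move=> n1 Ha; have E := unit1_val dv (mpow_le n1 Ha).
rewrite /dlog -[a](subrK 1) (deltaD pK lf vt) (delta1 pK lf vt) addr0 subrK.
apply: (mpowM0 dv); first exact: delta_mpow pK lf vt _ _ Ha.
exact: mpow_val (valV dv E).
Qed.

Lemma pairing_mpow0 (n : int) a b : 1 <= n -> M n (a - 1) -> M (1 - n) b -> pairing a b = 0.
Proof.
move=> n1 Ha Hb; rewrite /pairing (ctcM1 pK lf vt) ?tr0 //.
by have := mpowM dv Hb (dlog_mpow n1 Ha); rewrite subrK.
Qed.

Lemma dlog_unit (m : nat) a c : (0 < m)%N -> Kbar c -> M m.+1%:Z (a - 1 - c * t ^ m%:Z) ->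
  M m.+1%:Z (dlog a - m%:R * (c * t ^ m%:Z)).
Proof.
move=> m0 Hc Ha.
have Ha1 : M m%:Z (a - 1).
  apply: (mpowBl dv (y := c * t ^ m%:Z)); last exact: mpow_ct pK lf vt _ _ Hc.
  by apply: mpow_le Ha; lia.
have m1 : (1 : int) <= m%:Z by lia.
have E := unit1_val dv (mpow_le m1 Ha1); have a0 := val_neq0 dv E.
have da : M m.+1%:Z (delta a - m%:R * (c * t ^ m%:Z)).
  have := delta_mpow pK lf vt Ha.
  by rewrite !(deltaB pK lf vt) (delta1 pK lf vt) subr0 (delta_ct pK lf vt).
have -> : dlog a - m%:R * (c * t ^ m%:Z) = 
   (delta a - m%:R * (c * t ^ m%:Z) - (a - 1) * (m%:R * (c * t ^ m%:Z))) / a.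
  by rewrite /dlog; field.
apply: (mpowM0 dv); last exact: mpow_val (valV dv E).
apply: (mpowB dv) => //; apply: (mpow_le (r := m%:Z + m%:Z)); first by lia.
apply: (mpowM dv) => //; apply: (mpow0M dv); first exact: mpow_nat.
exact: mpow_ct pK lf vt _ _ Hc.
Qed.

(** Only the leading digits can meet in degree 0. The factor [m], coming from [delta] on [t^m],
    makes levels divisible by [p] degenerate. *)
Lemma pairing_unit (m : nat) a c b : (0 < m)%N -> Kbar c ->
  M m.+1%:Z (a - 1 - c * t ^ m%:Z) -> M (- m%:Z) b ->
  pairing a b = m%:R * tr (c * ctc (b * t ^ m%:Z)).
Proof.
move=> m0 Hc Ha Hb; have H := dlog_unit m0 Hc Ha.
rewrite -trZ; last exact: (natr_frob pK).
rewrite /pairing -(ctcZ pK lf vt) // -(ctcZ pK lf vt); last exact: (Kbar_nat pK lf).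
congr tr; apply: (ctc_near pK lf vt).
have -> : b * dlog a - m%:R * (c * (b * t ^ m%:Z)) = b * (dlog a - m%:R * (c * t ^ m%:Z)) by ring.
by have := mpowM dv Hb H; apply: mpow_le; lia.
Qed.

(** Linear algebra over the prime field, whose scalars are the [r] in [K] with [r^p = r]; [A] may
    have infinite dimension. Induction on [n] expresses [g] on the kernel of the last functional,
    and one vector outside that kernel determines the missing coefficient. *)
Lemma functional_combination (A : K -> Prop) (n : nat) (F : nat -> K -> K) (g : K -> K) :
  (forall x y, A x -> A y -> A (x + y)) ->
  (forall r x, r ^+ p = r -> A x -> A (r * x)) ->
  (forall j x y, F j (x + y) = F j x + F j y) ->
  (forall j r x, r ^+ p = r -> F j (r * x) = r * F j x) ->
  (forall j x, F j x ^+ p = F j x) ->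
  (forall x y, g (x + y) = g x + g y) ->
  (forall r x, r ^+ p = r -> g (r * x) = r * g x) ->
  (forall x, g x ^+ p = g x) ->
  (forall x, A x -> (forall j, (j < n)%N -> F j x = 0) -> g x = 0) ->
  exists2 c : nat -> K, (forall j, c j ^+ p = c j) &
    forall x, A x -> g x = \sum_(j < n) c j * F j x.
Proof.
move=> AD AZ FD FZ FF; elim: n A AD AZ g => [|n IH] A AD AZ g gD gZ gF Hker.
  exists (fun _ => 0) => [_|x Ax]; first by rewrite expr0n eqn0Ngt p_gt0.
  by rewrite big_ord0; apply: Hker.
have [|||c Hc Hg] := IH (fun x => A x /\ F n x = 0) _ _ g gD gZ gF.
- by move=> x y [Ax Fx] [Ay Fy]; split; [exact: AD|rewrite FD Fx Fy addr0].
- by move=> r x Hr [Ax Fx]; split; [exact: AZ|rewrite FZ // Fx mulr0].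
- move=> x [Ax Fx] H; apply: Hker => // j; rewrite ltnS leq_eqVlt => /orP[/eqP ->|] //.
  exact: H.
pose h x := g x - \sum_(j < n) c j * F j x.
have hD x y : h (x + y) = h x + h y.
  rewrite /h gD (eq_bigr (fun j : 'I_n => c j * F j x + c j * F j y)); last first.
    by move=> j _; rewrite FD mulrDr.
  by rewrite big_split opprD addrACA.
have hZ r x : r ^+ p = r -> h (r * x) = r * h x.
  move=> Hr; rewrite /h gZ // mulrBr; congr (_ - _).
  by rewrite mulr_sumr; apply: eq_bigr => j _; rewrite FZ // mulrCA.
have hF x : h x ^+ p = h x.
  rewrite /h (frobB1 pK) gF (frob_sum1 pK); congr (_ - _).
  by apply: eq_bigr => j _; rewrite exprMn Hc FF.
have h0 x : A x -> F n x = 0 -> h x = 0 by move=> Ax Fx; rewrite /h Hg // subrr.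
have [[a [Aa Fa]]|none] := pselect (exists a, A a /\ F n a != 0); last first.
  exists (fun j => if (j < n)%N then c j else 0) => [j|x Ax].
    by case: ifP => // _; rewrite expr0n eqn0Ngt p_gt0.
  rewrite big_ord_recr /= ltnn mul0r addr0 (eq_bigr (fun j : 'I_n => c j * F j x)); last first.
    by move=> j _; rewrite ltn_ord.
  apply/eqP; rewrite -subr_eq0; apply/eqP/h0 => //.
  by apply/eqP/negPn/negP => Fx; apply: none; exists x.
pose s := h a / F n a; have Hs : s ^+ p = s by rewrite /s exprMn exprVn hF FF.
exists (fun j => if (j < n)%N then c j else s) => [j|x Ax]; first by case: ifP.
rewrite big_ord_recr /= ltnn (eq_bigr (fun j : 'I_n => c j * F j x)); last first.
  by move=> j _; rewrite ltn_ord.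
pose r := F n x / F n a; have Hr : r ^+ p = r by rewrite /r exprMn exprVn !FF.
have HN : (- r) ^+ p = - r by have := frobN pK 1 r; rewrite expn1 Hr.
have : h (x + - r * a) = 0.
  apply: h0; first by apply: AD => //; apply: AZ.
  by rewrite FD FZ // /r mulNr divfK // subrr.
rewrite hD hZ // mulNr => /eqP; rewrite subr_eq0 => /eqP.
rewrite {1}/h => /eqP; rewrite subr_eq => /eqP ->; rewrite addrC; congr (_ + _).
by rewrite /s /r; field.
Qed.

End Pairing.

(** * The Artin-Hasse exponential *)

Lemma moebius_sq q c : prime q -> (0 < c)%N -> (q * q %| c)%N -> moebius c = 0.
Proof.
move=> q_pr c0 qc; rewrite /moebius ifF //; apply/negbTE/allPn; exists q.
  by rewrite mem_primes q_pr c0; apply: dvdn_trans qc; apply: dvdn_mulr.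
have := pfactor_dvdn 2 q_pr c0; rewrite expnS expn1 qc => /esym.
by case: (logn q c) => [|[|]].
Qed.

Lemma moebius_primeM q d : prime q -> (0 < d)%N -> ~~ (q %| d)%N -> moebius (q * d) = - moebius d.
Proof.
move=> q_pr d0 qd; have q0 := prime_gt0 q_pr.
have qd' : q \notin primes d by rewrite mem_primes q_pr d0.
have P : perm_eq (primes (q * d)) (q :: primes d).
  apply: uniq_perm; rewrite ?primes_uniq //= ?qd' ?primes_uniq // => r.
  by rewrite primesM // inE primes_prime // inE.
rewrite /moebius (perm_all _ P) (perm_size P) /= lognM // [logn q q]logn_prime // eqxx.
rewrite [logn q d]lognE (negbTE qd) !andbF /=.
have -> : all (fun r => logn r (q * d) == 1%N) (primes d) = all (fun r => logn r d == 1%N) (primes d).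
  apply: eq_in_all => r rd; rewrite lognM // logn_prime //; case: (r =P q) => // rq.
  by case/negP: qd'; rewrite -rq.
by case: ifP; rewrite ?oppr0 // exprS mulN1r.
Qed.

(** Fix a prime [q] dividing [N]. Divisors divisible by [q^2] contribute 0, and the terms of [d] and
    [q d] cancel when [q] does not divide [d]. *)
Lemma sum_moebius N : (0 < N)%N -> \sum_(c <- divisors N) moebius c = (N == 1%N)%:R.
Proof.
move=> N0; have [->|N1] := eqVneq N 1%N; first by rewrite big_seq1.
have {N1} N1 : (1 < N)%N by case: N N0 N1 => [|[|]].
pose q := pdiv N; have q_pr : prime q by exact: pdiv_prime.
have q0 := prime_gt0 q_pr; have qN : (q %| N)%N by exact: pdiv_dvd.
have dN c : (c \in divisors N) = (c %| N)%N by rewrite -dvdn_divisors.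
have pos c : (c %| N)%N -> (0 < c)%N by exact: dvdn_gt0.
rewrite (bigID (fun c => q %| c)%N) /= addrC.
rewrite [X in _ + X](bigID (fun c => q * q %| c)%N) /= [X in _ + (X + _)]big_seq_cond.
rewrite [X in _ + (X + _)]big1 => [|c /andP[]]; last first.
  by rewrite dN => cN /andP[_]; apply: moebius_sq => //; apply: pos.
rewrite add0r -[X in _ + X]big_filter -[X in X + _]big_filter.
set s := filter _ _; set s' := filter _ _.
have -> : \sum_(c <- s') moebius c = \sum_(d <- s) moebius (q * d).
  rewrite -(big_map (muln q) xpredT moebius); apply: perm_big; apply: uniq_perm.
  - by rewrite filter_uniq // divisors_uniq.
  - rewrite map_inj_uniq ?filter_uniq ?divisors_uniq // => i j /eqP.
    by rewrite eqn_pmul2l // => /eqP.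
  move=> c; rewrite mem_filter dN; apply/idP/mapP.
    move=> /andP[/andP[/dvdnP [d ->]]]; rewrite [(d * q)%N]mulnC dvdn_pmul2l // => qd qdN.
    by exists d => //; rewrite mem_filter qd dN; apply: dvdn_trans qdN; apply: dvdn_mull.
  move=> [d]; rewrite mem_filter dN => /andP[qd d_N] ->; rewrite dvdn_mulr // dvdn_pmul2l // qd /=.
  by rewrite Gauss_dvd ?qN // prime_coprime.
rewrite -big_split big_seq big1 //= => d; rewrite mem_filter dN => /andP[qd d_N].
by rewrite moebius_primeM ?subrr //; apply: pos.
Qed.

Section PolyTruncation.
Variable n : nat.
Implicit Types A B C D : {poly rat}.

(** Congruence modulo [X^n]: identities between power series are checked on truncated
    polynomials. *)
Let R A B := exists Q, A - B = Q * 'X^n.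
Let Rrefl A : R A A. Proof. by exists 0; rewrite subrr mul0r. Qed.
Let Rtrans A B C : R A B -> R B C -> R A C.
Proof. by move=> [Q E] [Q' E']; exists (Q + Q'); rewrite mulrDl -E -E'; ring. Qed.
Let Rmul A B C : R A B -> R (A * C) (B * C).
Proof. by move=> [Q E]; exists (Q * C); rewrite -mulrBl E; ring. Qed.
Let Radd A B A' B' : R A B -> R A' B' -> R (A + A') (B + B').
Proof. by move=> [Q E] [Q' E']; exists (Q + Q'); rewrite mulrDl -E -E'; ring. Qed.
Let RC A B : R A B -> R B A.
Proof. by move=> [Q E]; exists (- Q); rewrite mulNr -E; ring. Qed.
Let Rcoef A B i : R A B -> (i < n)%N -> A`_i = B`_i.
Proof.
move=> [Q E] ni; apply/eqP; rewrite -subr_eq0 -coefB E coefMXn ni.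
by [].
Qed.
Let RXn A m : (n <= m)%N -> R (A * 'X^m) 0.
Proof. by move=> nm; exists (A * 'X^(m - n)); rewrite subr0 -mulrA -exprD subnK. Qed.

(** The differential equation of [(1 - X^c)^a]; the truncation disturbs it only in degrees at least
    [n]. *)
Lemma binom_series_deriv a c : (0 < c)%N ->
  R ((1 - 'X^c) * (binom_series a c n)^`()) ((- (c%:R * a)) *: 'X^(c.-1) * binom_series a c n).
Proof.
move=> c0; pose be j : rat := (-1) ^+ j * gen_binom a j.
have beS j : j.+1%:R * be j.+1 = (j%:R - a) * be j.
  have j0 : (j.+1)%:R != 0 :> rat by rewrite pnatr_eq0.
  have f0 : (j`!)%:R != 0 :> rat by rewrite pnatr_eq0 -lt0n fact_gt0.
  rewrite /be /gen_binom big_ord_recr /= factS natrM exprS.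
  by move: (\prod_(i < j) _) ((-1) ^+ j) (j`!)%:R (j.+1)%:R j0 f0 => P e f g g0 f0; field; rewrite g0 f0.
have D : (binom_series a c n)^`() = \sum_(j < n.+1) (be j * (c * j)%:R) *: 'X^((c * j).-1).
  rewrite /binom_series raddf_sum /=; apply: eq_bigr => j _.
  by rewrite derivZ derivXn -scaler_nat scalerA.
pose T j : {poly rat} := (c%:R * (j%:R * be j)) *: 'X^((c * j).-1).
have DT : (binom_series a c n)^`() = \sum_(j < n) T j.+1.
  rewrite D big_ord_recl /= muln0 mulr0 scale0r add0r; apply: eq_bigr => j _.
  by rewrite /T /bump /= add1n natrM; congr (_ *: _); ring.
have XT : 'X^c * (binom_series a c n)^`() = \sum_(j < n.+1) (c%:R * (j%:R * be j)) *: 'X^((c * j.+1).-1).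
  rewrite D mulr_sumr; apply: eq_bigr => j _; rewrite -scalerAr.
  case: (posnP (j : nat)) => [->|j0]; first by rewrite muln0 !(mulr0, mul0r) !scale0r.
  rewrite -exprD natrM; congr (_ *: 'X^_); first by ring.
  by rewrite mulnS -[in RHS](prednK (_ : (0 < c * j)%N)) ?muln_gt0 ?c0 // addnS.
rewrite mulrBl mul1r XT DT.
have BT : (- (c%:R * a)) *: 'X^(c.-1) * binom_series a c n =
    \sum_(j < n.+1) (- (c%:R * a) * be j) *: 'X^((c * j.+1).-1).
  rewrite /binom_series mulr_sumr; apply: eq_bigr => j _.
  rewrite -scalerAl -scalerAr scalerA -exprD; congr (_ *: 'X^_).
  by clear -c0; nia.
rewrite BT !big_ord_recr /= opprD addrA -sumrB.
have -> : \sum_(j < n) (T j.+1 - (c%:R * (j%:R * be j)) *: 'X^((c * j.+1).-1)) =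
          \sum_(j < n) (- (c%:R * a) * be j) *: 'X^((c * j.+1).-1).
  apply: eq_bigr => j _; rewrite /T -scalerBl beS; congr (_ *: _); ring.
apply: Radd; first exact: Rrefl.
have h : (n <= (c * n.+1).-1)%N by clear -c0; nia.
apply: (Rtrans (B := 0)); last apply: RC.
  by rewrite -scaleNr -mul_polyC; apply: RXn.
by rewrite -mul_polyC; apply: RXn.
Qed.

(** A truncation of [moebius c * X^(c-1) / (1 - X^c)], the logarithmic derivative of the factor of
    index [c]. *)
Let G c : {poly rat} := (moebius c)%:~R *: \sum_(m < n) 'X^((c * m.+1).-1).

Let artin_hasse_factor c : (0 < c)%N ->
  R (binom_series (- (moebius c)%:~R / c%:R) c n)^`()
    (G c * binom_series (- (moebius c)%:~R / c%:R) c n).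
Proof.
move=> c0; have := binom_series_deriv (- (moebius c)%:~R / c%:R) c0.
set P := binom_series _ _ _; set S := \sum_(m < n) 'X^(c * m) : {poly rat}.
have -> : - (c%:R * (- (moebius c)%:~R / c%:R)) = (moebius c)%:~R :> rat.
  by rewrite mulrCA divff ?pnatr_eq0 -?lt0n // mulr1 opprK.
have S1 : S * (1 - 'X^c) = 1 - 'X^(c * n).
  rewrite /S; elim: n => [|k IH]; first by rewrite big_ord0 mul0r muln0 subrr.
  rewrite big_ord_recr mulrDl IH /= mulrBr mulr1 -exprD mulnS [(c + _)%N]addnC; ring.
have GE : G c = (moebius c)%:~R *: 'X^(c.-1) * S.
  rewrite /G -scalerAl mulr_sumr; congr (_ *: _); apply: eq_bigr => m _.
  by rewrite -exprD; congr ('X^_); clear -c0; nia.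
move=> /(Rmul S).
have -> : (1 - 'X^c) * P^`() * S = P^`() - P^`() * 'X^(c * n).
  by rewrite mulrAC [_ * S]mulrC S1; ring.
have -> : (moebius c)%:~R *: 'X^(c.-1) * P * S = G c * P by rewrite GE mulrAC.
apply: Rtrans; apply: (@Rtrans _ (P^`() - 0)); first by rewrite subr0.
exists (P^`() * 'X^(c * n - n)); rewrite subr0 opprB addrC subrK -mulrA -exprD subnK //.
by rewrite leq_pmull.
Qed.

(** Below degree [p] the condition on [c] removes no factor. The logarithmic derivative then has in
    degree [i] the sum of [moebius c] over the divisors of [i + 1], so it is 1 modulo [X^n], and
    [E' = E] is the equation of the exponential. *)
Lemma artin_hasse_coefE p : (n < p)%N -> artin_hasse_coef p n = (n`!%:R)^-1.
Proof.
move=> np; pose E := \prod_(1 <= c < n.+1) binom_series (- (moebius c)%:~R / c%:R) c n.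
have EE : \prod_(1 <= c < n.+1 | ~~ (p %| c)%N) binom_series (- (moebius c)%:~R / c%:R) c n = E.
  rewrite big_mkcond /=; apply: eq_big_nat => c /andP[c1 cn].
  by rewrite gtnNdvd //; exact: leq_ltn_trans np.
rewrite /artin_hasse_coef EE.
have dE : R E^`() ((\sum_(1 <= c < n.+1) G c) * E).
  rewrite /E !big_nat; elim/big_rec2: _ => [|c P S /andP[c0 _] IH].
    by rewrite mul0r -[1]/(1%:P) derivC; exact: Rrefl.
  have := Radd (Rmul S (artin_hasse_factor c0)) (Rmul (binom_series (- (moebius c)%:~R / c%:R) c n) IH).
  rewrite derivM; set B := binom_series _ _ _.
  have -> : (G c + P) * (B * S) = G c * B * S + P * S * B by ring.
  by rewrite [B * _]mulrC.
have SG i : (i < n)%N -> (\sum_(1 <= c < n.+1) G c)`_i = (i == 0%N)%:R.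
  move=> ni; rewrite coef_sum.
  rewrite (eq_big_nat _ _ (F2 := fun c => if (c %| i.+1)%N then (moebius c)%:~R else 0)); last first.
    move=> c /andP[c0 cn]; rewrite /G coefZ coef_sum; case: ifP => [/dvdnP [m im]|ci].
      have m0 : (0 < m)%N by case: m im.
      have mn : (m.-1 < n)%N by rewrite prednK //; apply: leq_trans ni; rewrite im leq_pmulr.
      rewrite (bigD1 (Ordinal mn)) //= big1 => [|j jm].
        by rewrite coefXn prednK // mulnC -im /= eqxx addr0 mulr1.
      rewrite coefXn; case: eqP => // E1; case/eqP: jm; apply/val_inj => /=.
      have : (c * j.+1 = c * m)%N by rewrite -[LHS](prednK (_ : 0 < _)%N) ?muln_gt0 ?c0 // -E1 im mulnC.
      by move/eqP; rewrite eqn_pmul2l // => /eqP <-.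
    rewrite big1 ?mulr0 // => j _; rewrite coefXn; case: eqP => // E1.
    by move: ci; rewrite E1 prednK ?muln_gt0 ?c0 // dvdn_mulr.
  rewrite -big_mkcond -big_filter /=.
  have -> : \sum_(c <- [seq c <- index_iota 1 n.+1 | (c %| i.+1)%N]) (moebius c)%:~R =
       \sum_(c <- divisors i.+1) (moebius c)%:~R :> rat.
    apply: perm_big; apply: uniq_perm; rewrite ?filter_uniq ?iota_uniq ?divisors_uniq // => c.
    rewrite mem_filter mem_index_iota -dvdn_divisors //.
    case: (boolP (c %| i.+1)%N) => //= ci; rewrite (dvdn_gt0 _ ci) //= ltnS.
    by apply: leq_trans ni; exact: dvdn_leq.
  rewrite -(rmorph_sum (intmul 1)) sum_moebius // eqSS.
  by case: eqP.
have E0 : E`_0 = 1.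
  rewrite -horner_coef0 /E horner_prod; apply: big1_seq => c; rewrite mem_index_iota => /andP[_ /andP[c0 _]].
  rewrite /binom_series horner_coef0 coef_sum big_ord_recl big1 => [|j _].
    by rewrite addr0 coefZ coefXn muln0 expr0 /gen_binom big_ord0 fact0 eqxx !(mul1r, mulr1, invr1).
  by rewrite coefZ coefXn eq_sym eqn0Ngt muln_gt0 c0 mulr0.
have Ei i : (i < n)%N -> E`_i.+1 *+ i.+1 = E`_i.
  move=> ni; rewrite -coef_deriv (Rcoef dE ni) coefM big_ord_recl /= subn0 SG ?(leq_ltn_trans _ ni) //.
  rewrite mul1r big1 ?addr0 // => j _; rewrite SG ?mul0r //.
  exact: leq_ltn_trans ni.
suff W i : (i <= n)%N -> E`_i = (i`!%:R)^-1 by exact: W.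
elim: i => [|i IH] ni; first by rewrite E0 invr1.
have i0 : (i.+1)%:R != 0 :> rat by rewrite pnatr_eq0.
apply: (mulIf i0); rewrite mulr_natr Ei // IH ?(ltnW ni) // factS natrM invfM mulrAC mulVf // mul1r.
by [].
Qed.
End PolyTruncation.

Lemma ratr_invn (F : unitRingType) n : (0 < n)%N -> ratr (n%:R^-1) = n%:R^-1 :> F.
Proof.
move=> n0; have E : (n%:R^-1 : rat) = 1%:~R / n%:Z%:~R by rewrite mul1r.
have c1n : coprime `|1%:Z| `|n%:Z| by rewrite /= coprime1n.
have := coprimeq_den c1n; have := coprimeq_num c1n.
rewrite /ratr -E eqz_nat eqn0Ngt n0 /= mulr1 gtr0_sg ?ltz_nat // => -> ->.
by rewrite mul1r.
Qed.

Section ArtinHasseExponential.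
Set Default Proof Using "All".
Variables (p : nat) (K : fieldType) (v : K -> \bar int).
Variables (kK : finFieldType) (res : K -> kK) (t : K).
Hypothesis pK : p \in [pchar K].
Hypothesis lf : local_field v res.
Hypothesis vt : v t = 1%:E.

Let dv : discrete_valuation v := local_val lf.
Local Notation M := (mpow v).
Local Notation q := #|kK|.
Local Notation Kbar := (teichmuller v q).
Local Notation ctc := (ctc v kK t).
Local Notation delta := (delta v kK t).
Local Notation dlog := (dlog v kK t).
Local Notation tr := (Ktrace pK lf).
Local Notation pairing := (@pairing p K v kK res t pK lf).

Let p_pr : prime p := pcharf_prime pK.
Let p_gt0 : (0 < p)%N := prime_gt0 p_pr.
Let p_gt1 : (1 < p)%N := prime_gt1 p_pr.

Let e n : K := (Ep_coef p n : nat)%:R.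

Lemma Ep_coefE n : (n < p)%N -> n`!%:R * e n = 1.
Proof.
move=> np; have nf : ~~ (p %| n`!)%N.
  elim: n np => [|n IH] np; first by rewrite fact0 dvdn1 gtn_eqF.
  by rewrite factS Euclid_dvdM // negb_or IH ?(ltnW np) // gtnNdvd.
suff E : (n`! * Ep_coef p n)%N = 1 %[mod p].
  have := congr1 (fun m => m%:R : K) (divn_eq (n`! * Ep_coef p n) p).
  by rewrite E natrD !natrM (pcharf0 pK) mulr0 add0r modn_small.
have F : (n`! * Ep_coef p n)%:R = 1 :> 'F_p.
  rewrite natrM natr_Zp /Ep_coef artin_hasse_coefE // ratr_invn ?fact_gt0 // divff //.
  by rewrite -(dvdn_pcharf (pchar_Fp p_pr)).
have := congr1 val F; rewrite /= val_Fp_nat // => ->.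
by rewrite /= (Fp_cast p_pr).
Qed.

Let e0 : e 0 = 1. Proof. by have := Ep_coefE p_gt0; rewrite fact0 mul1r. Qed.
Let e1 : e 1 = 1. Proof. by have := Ep_coefE p_gt1; rewrite mul1r. Qed.
Let eS n : (n.+1 < p)%N -> e n.+1 * n.+1%:R = e n.
Proof.
move=> np; have nf := Ep_coefE (ltnW np); have := Ep_coefE np.
rewrite factS natrM => E; have f0 : n`!%:R != 0 :> K.
  by apply/eqP => z; move: nf; rewrite z mul0r => /esym/eqP; rewrite oner_eq0.
by apply: (mulfI f0); rewrite nf -[RHS]E; ring.
Qed.
Let e_int n : M 0 (e n). Proof. exact: (mpow_nat dv). Qed.

Let part (a : K) N := \sum_(n < N) e n * a ^+ n.

Let Ep_cvg a : M 1 a -> vcvg v (part a) (Ep v p a).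
Proof.
move=> Ha; have [l Hl] : exists l, vcvg v (part a) l.
  apply: (local_complete lf); apply: (vcauchy_step dv) => n.
  rewrite /part big_ord_recr /= addrAC subrr add0r; apply: (mpow0M dv) => //.
  by have := mpowX dv n Ha; rewrite mul1r.
by rewrite /Ep (vlimP dv Hl).
Qed.

Lemma Ep0 : Ep v p 0 = 1.
Proof.
apply: (vcvg_unique dv (Ep_cvg (mpow0 dv 1))) => n; exists 1%N => -[|i] // _.
rewrite /part big_ord_recl big1 => [|j _]; last by rewrite expr0n mulr0.
by rewrite e0 expr0 mulr1 addr0 subrr; exact: mpow0.
Qed.

(** The coefficients of degree 0 and 1 are 1, and in higher degree the difference of powers gains a
    further factor from M_K. This is the contraction estimate behind surjectivity and
    injectivity. *)
Lemma Ep_near (r : int) a a' : 1 <= r -> M 1 a -> M 1 a' -> M r (a - a') ->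
  M (r + 1) (Ep v p a - Ep v p a' - (a - a')).
Proof.
move=> r1 Ha Ha' Hr.
have [N HN] := Ep_cvg Ha (r + 1); have [N' HN'] := Ep_cvg Ha' (r + 1).
pose m := (N + N').+2.
have Hm := HN m (leq_trans (leq_addr N' N) (leqW (leqnSn _))).
have Hm' := HN' m (leq_trans (leq_addl N N') (leqW (leqnSn _))).
have Hd : M (r + 1) (part a m - part a' m - (a - a')).
  rewrite /part /m !big_ord_recl /= !expr0 !expr1 e0 e1 !mul1r.
  rewrite opprD addrACA subrr add0r opprD addrACA [X in X - _]addrC addrK -sumrB.
  apply: (mpow_sum dv) => i _; rewrite -mulrBr; apply: (mpow0M dv) => //.
  have := @mpow_subX _ _ dv (r - 1) 1 (lift ord0 (lift ord0 i)) a a' Ha Ha'.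
  by rewrite [1 + _]addrC subrK => /(_ Hr); apply: mpow_le; rewrite /= /bump; clear -r1; lia.
have -> : Ep v p a - Ep v p a' - (a - a') =
  (part a m - part a' m - (a - a')) - (part a m - Ep v p a) + (part a' m - Ep v p a') by ring.
by apply: (mpowD dv) => //; apply: (mpowB dv).
Qed.

Lemma Ep_unit (r : int) a : 1 <= r -> M r a -> M r (Ep v p a - 1).
Proof.
move=> r1 Ha; have := Ep_near r1 (mpow_le r1 Ha) (mpow0 dv 1); rewrite !subr0 Ep0.
move=> /(_ Ha) H; rewrite -(subrK a (Ep v p a - 1)); apply: (mpowD dv) => //.
by apply: mpow_le H; rewrite lerDl.
Qed.

Lemma Ep_inj a a' : M 1 a -> M 1 a' -> Ep v p a = Ep v p a' -> a = a'.
Proof.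
move=> Ha Ha' E; apply/eqP; rewrite -subr_eq0; apply/eqP.
have H1 : M 1 (a - a') by exact: (mpowB dv).
apply: (mpow_inf dv); elim=> [|n IH]; first exact: mpow_le H1.
case: n IH => [|n] IH //.
have := @Ep_near n.+1%:Z a a' isT Ha Ha' IH; rewrite E subrr sub0r => /(mpowN dv).
by rewrite opprK; apply: mpow_le; clear; lia.
Qed.

Lemma Ep_surj (r : int) u : 1 <= r -> M r (u - 1) -> exists2 a, M r a & Ep v p a = u.
Proof.
move=> r1 Hu; pose F a := Ep v p a - 1.
have F0 : F 0 = 0 by rewrite /F Ep0 subrr.
have contr (m : int) s s' : 1%N%:Z <= m -> M 1%N s -> M 1%N s' -> M m (s - s') ->
    M (m + 1) (F s - F s' - (s - s')).
  move=> m1 Hs Hs' Hm; have -> : F s - F s' = Ep v p s - Ep v p s' by rewrite /F; ring.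
  exact: Ep_near.
have [a Ha E] := contraction_surj dv (local_complete lf) F0 contr r1 Hu.
by exists a => //; apply: (addIr (-1)).
Qed.

(** [Ep] maps M^r bijectively onto U^r at every level [r], so the image can be described through
    [Ep] alone and the choice in [LambdaK] disappears. *)
Lemma LambdaK_image (A : set K) (r : int) : 1 <= r ->
  (LambdaK v p @` (A `&` punits v r) = [set a | M r a /\ A (Ep v p a)])%classic.
Proof.
move=> r1; have LE a : M 1 a -> LambdaK v p (Ep v p a) = a.
  move=> Ha; rewrite /LambdaK; case: xgetP => [x _ [Hx E]|/(_ a) H]; first exact: Ep_inj.
  by case: H.
apply/seteqP; split=> [_ [u [Au Hu] <-]|a [Ha Aa]] /=.
  by have [a Ha E] := Ep_surj r1 Hu; rewrite -E in Au *; rewrite LE //; apply: mpow_le Ha.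
exists (Ep v p a); last by apply: LE; apply: mpow_le Ha.
by split=> //; apply: Ep_unit.
Qed.

(* [E_p] agrees with [exp] up to degree [p - 1], so that [dlog (E_p a)] is close to [delta a]. *)
Lemma dlog_Ep (r : int) a : 1 <= r -> M r a -> M (p%:Z * r) (dlog (Ep v p a) - delta a).
Proof.
move=> r1 Ha; have Ha1 := mpow_le r1 Ha; pose E := Ep v p a; pose P := part a p.
have EP : M (p%:Z * r) (E - P).
  have [N HN] := Ep_cvg Ha1 (p%:Z * r).
  have := HN (p + N)%N (leq_addl _ _); rewrite /part big_split_ord /= -/(part a p) -/P => H.
  have -> : E - P = \sum_(i < N) e (p + i)%N * a ^+ (p + i)%N -
    (P + \sum_(i < N) e (p + i)%N * a ^+ (p + i)%N - E) by ring.
  apply: (mpowB dv) => //; apply: (mpow_sum dv) => i _; apply: (mpow0M dv) => //.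
  by apply: mpow_le (mpowX dv (p + i)%N Ha); clear -r1; nia.
(* The truncated exponential satisfies the equation of [exp] up to its top term, of valuation at
   least [(p - 1) r + r]; this is the origin of the bound [p r]. *)
have dP : delta P = P * delta a - e p.-1 * a ^+ p.-1 * delta a.
  rewrite -mulrBl /P /part -(prednK p_gt0) [in RHS]big_ord_recr /= addrK big_ord_recl.
  rewrite (deltaD pK lf vt) (delta_sum pK lf vt) expr0 mulr1 e0 (delta1 pK lf vt) add0r.
  rewrite mulr_suml; apply: eq_bigr => i _; rewrite /= /bump /= add1n.
  rewrite (deltaZ pK lf vt) ?(deltaX pK lf vt) ?mulrA ?eS //; last exact: (Kbar_nat pK lf).
  by rewrite -[X in (_ < X)%N](prednK p_gt0) ltnS.
have E1 : v E = 0%:E by apply: (unit1_val dv); apply: Ep_unit.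
have E0 : E != 0 := val_neq0 dv E1.
have -> : dlog E - delta a = (delta E - E * delta a) / E.
  by rewrite /dlog -/E mulrBl [E * _ / E]mulrAC divff // mul1r.
apply: (mpowM0 dv); last by apply: mpow_val; rewrite (valV dv E1) oppr0.
have -> : delta E - E * delta a = delta (E - P) - (E - P) * delta a - e p.-1 * (a ^+ p.-1 * delta a).
  rewrite (deltaB pK lf vt) dP; ring.
have da := delta_mpow pK lf vt Ha.
apply: (mpowB dv); first apply: (mpowB dv).
- exact: (delta_mpow pK lf vt).
- by apply: (mpowM0 dv) => //; apply: mpow_le da; clear -r1; lia.
apply: (mpow0M dv) => //; apply: mpow_le (mpowM dv (mpowX dv p.-1 Ha) da).
by have pE := prednK p_gt0; clear -pE; nia.
Qed.

Lemma pairing_Ep (r : int) a b : 1 <= r -> M r a -> M (1 - p%:Z * r) b ->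
  pairing (Ep v p a) b = tr (ctc (b * delta a)).
Proof.
move=> r1 Ha Hb; rewrite /pairing; congr (tr _); apply: (ctc_near pK lf vt).
rewrite -mulrBr; have := mpowM dv Hb (dlog_Ep r1 Ha).
by rewrite subrK.
Qed.
End ArtinHasseExponential.

(** * The norm group *)

(** Newton's identities between power sums and elementary symmetric functions, from the derivative
    of the product and the expansion of [F j = e / (1 + w j X)]. *)
Lemma newton_elementary (R : comNzRingType) (n : nat) (w : 'I_n -> R) (r : nat) :
  let e := (\prod_(j < n) (1 + w j *: 'X) : {poly R}) in
  e`_r.+1 *+ r.+1 = \sum_(i < r.+1) (-1) ^+ i * (\sum_(j < n) w j ^+ i.+1) * e`_(r - i).
Proof.
move=> e; pose F j : {poly R} := \prod_(i < n | i != j) (1 + w i *: 'X).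
have eF j : e = (1 + w j *: 'X) * F j by rewrite /e (bigD1 j).
have Fr j k : (F j)`_k = \sum_(i < k.+1) (- w j) ^+ i * e`_(k - i).
  elim: k => [|k IH].
    rewrite big_ord_recl big_ord0 addr0 expr0 mul1r (eF j) mulrDl mul1r coefD.
    by rewrite -scalerAl coefZ coefXM mulr0 addr0.
  rewrite big_ord_recl expr0 mul1r subn0.
  have -> : e`_k.+1 = (F j)`_k.+1 + w j * (F j)`_k.
    by rewrite (eF j) mulrDl mul1r coefD -scalerAl coefZ coefXM.
  rewrite IH mulr_sumr -addrA -big_split big1 ?addr0 // => i _ /=.
  by rewrite /bump /= add1n subSS exprS; ring.
have de m (u : 'I_m -> R) : (\prod_(j < m) (1 + u j *: 'X) : {poly R})^`() =
    \sum_j u j *: \prod_(i < m | i != j) (1 + u i *: 'X).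
  elim: m u => [|m IH] u.
    by rewrite !big_ord0 derivC.
  rewrite big_ord_recl derivM IH big_ord_recl; congr (_ + _).
    rewrite derivD derivC add0r derivZ derivX alg_polyC mul_polyC; congr (_ *: _).
    rewrite [RHS]big_mkcond [RHS]big_ord_recl /= mul1r; exact: eq_bigr.
  rewrite mulr_sumr; apply: eq_bigr => j _; rewrite -scalerAr; congr (_ *: _).
  rewrite [in RHS]big_mkcond [in RHS]big_ord_recl neq_lift /=; congr (_ * _).
  rewrite [in LHS]big_mkcond; apply: eq_bigr => i _.
  by rewrite (inj_eq lift_inj).
have := congr1 (fun P : {poly R} => P`_r) (de n w); rewrite coef_deriv => ->.
rewrite coef_sum; under eq_bigr => j _ do rewrite coefZ Fr mulr_sumr.
rewrite exchange_big; apply: eq_bigr => i _ /=.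
rewrite mulr_sumr mulr_suml; apply: eq_bigr => j _.
by rewrite [(- w j) ^+ i]exprNn exprS; ring.
Qed.

Lemma divz_rem_unique (D i j : nat) (n n' : int) : (i < D)%N -> (j < D)%N ->
  n * D%:Z + i%:Z = n' * D%:Z + j%:Z -> i = j.
Proof. by move=> iD jD E; have [|H|H] := ltgtP n n'; nia. Qed.

Lemma divz_rem_ge1 (D i : nat) (n : int) : (0 < i < D)%N ->
  0 <= n * D%:Z + i%:Z -> 1 <= n * D%:Z + i%:Z.
Proof. by move=> /andP[i0 iD] H; have [|] := leP 0 n; nia. Qed.

Section Extension.
Set Default Proof Using "All".
Variables (p nu b : nat).
Variables (K : fieldType) (vK : K -> \bar int) (kK : finFieldType) (res : K -> kK).
Variables (L : splittingFieldType K) (vL : L -> \bar int) (piL : L).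
Hypothesis pK : p \in [pchar K].
Hypothesis lf : local_field vK res.
Hypothesis galL : galois 1 {:L}.
Hypothesis isoG : 'Gal({:L} / 1) \isog [set: 'rV['F_p]_nu]%SET.
Hypothesis dvL : discrete_valuation vL.
Hypothesis tram : totally_ramified vK vL.
Hypothesis vpi : vL piL = 1%:E.
Hypothesis b_gt0 : (1 <= b)%N.
Hypothesis brk : single_break vL piL b.

Let dvK : discrete_valuation vK := local_val lf.
Local Notation MK := (mpow vK).
Local Notation ML := (mpow vL).
Local Notation q := #|kK|.
Local Notation Kbar := (teichmuller vK q).
Local Notation G := ('Gal({:L} / 1))%g.
Local Notation d := (p ^ nu)%N.

Let p_pr : prime p := pcharf_prime pK.
Let p_gt0 : (0 < p)%N := prime_gt0 p_pr.
Let d_gt0 : (0 < d)%N. Proof. by rewrite expn_gt0 p_gt0. Qed.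
Let pi0 : piL != 0 := val_neq0 dvL vpi.

Lemma card_Gal : #|G| = d.
Proof.
by rewrite (card_isog isoG) cardsT card_mx mul1n card_Fp.
Qed.

Lemma abelem_Gal : (p.-abelem G)%g.
Proof. by rewrite (isog_abelem isoG); apply: mxabelem.mx_Fp_abelem. Qed.

Lemma Gal_comm (s u : gal_of {:L}) : s \in G -> u \in G -> (s * u = u * s)%g.
Proof. by move=> sG uG; apply: (centsP (abelem_abelian abelem_Gal)). Qed.

Lemma Gal_exp (s : gal_of {:L}) : s \in G -> (s ^+ p = 1)%g.
Proof.
by move=> sG; have [_ /(_ _ sG)] := abelemP p_pr abelem_Gal.
Qed.

Lemma dimL : \dim {:L} = d.
Proof. by have := galois_dim galL; rewrite dimv1 divn1 card_Gal. Qed.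

Lemma GalM (s u : gal_of {:L}) (x : L) : (s * u)%g x = u (s x).
Proof. exact: galM (memvf x). Qed.

Lemma Gal_alg (s : gal_of {:L}) (a : K) : s \in G -> s a%:A = a%:A.
Proof.
by move=> sG; rewrite linearZ /= rmorph1.
Qed.

Lemma Gal_commE (s u : gal_of {:L}) (x : L) : s \in G -> u \in G -> s (u x) = u (s x).
Proof. by move=> sG uG; rewrite -!GalM Gal_comm. Qed.

Lemma valA (a : K) n : vK a = n%:E -> vL a%:A = (n * d%:Z)%:E.
Proof. by move=> E; rewrite tram E dimL -EFin_natmul -mulr_natr natz. Qed.

Lemma mpowA (r : int) (a : K) : MK r a -> ML (r * d%:Z) a%:A.
Proof.
move=> H; have [->|/(val_fin dvK) [n E]] := eqVneq a 0; first by rewrite scale0r; apply: mpow0.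
by apply/(mpowE _ (valA E)); move: H => /(mpowE _ E); nia.
Qed.

Lemma mpowA_inv (m r : int) (a : K) : ML m a%:A -> (r - 1) * d%:Z < m -> MK r a.
Proof.
move=> H; have [->|/(val_fin dvK) [n E]] := eqVneq a 0; first by move=> _; apply: mpow0.
move: H => /(mpowE _ (valA E)) H1 H2; apply/(mpowE _ E); nia.
Qed.

Lemma mpowA0 (a : K) : MK 0 a -> ML 0 a%:A.
Proof. by move/mpowA; rewrite mul0r. Qed.

Lemma KbarA_int c : Kbar c -> ML 0 c%:A.
Proof. by move/(Kbar_int pK lf)/mpowA0. Qed.

Lemma KbarA_M1 c : Kbar c -> ML 1 c%:A -> c = 0.
Proof.
move=> Hc H; apply: (Kbar_M1 pK lf Hc); apply: mpowA_inv H _; lia.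
Qed.

Let term_val (k : K) n (i : nat) : vK k = n%:E -> vL (k *: piL ^+ i) = (n * d%:Z + i%:Z)%:E.
Proof.
by move=> E; rewrite -mulr_algl (Defs.valM dvL) (valA E) (valX dvL _ vpi) mul1r -EFinD.
Qed.

Let term_inj (k : 'I_d -> K) (i j : 'I_d) : k i *: piL ^+ i != 0 ->
  vL (k i *: piL ^+ i) = vL (k j *: piL ^+ j) -> i = j.
Proof.
move=> ki0; have ki : k i != 0 by apply: contraNneq ki0 => ->; rewrite scale0r.
have [n En] := val_fin dvK ki; rewrite (term_val i En).
have [->|kj] := eqVneq (k j) 0; first by rewrite scale0r (val0 dvL).
have [n' En'] := val_fin dvK kj; rewrite (term_val j En') => -[] E.
apply/val_inj; exact: (divz_rem_unique (ltn_ord i) (ltn_ord j) E).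
Qed.

(** Valuations of nonzero [K]-multiples of [piL ^+ i] are congruent to [i] modulo [d], so these
    powers are independent; since [d] is the degree, they form a basis. *)
Lemma coordL (x : L) : exists a : 'I_d -> K, x = \sum_i a i *: piL ^+ i.
Proof.
pose X := [tuple piL ^+ (i : nat) | i < d].
have XE (i : 'I_d) : X`_i = piL ^+ i by rewrite -tnth_nth tnth_mktuple.
have frX : free X.
  apply/freeP => k; under eq_bigr => i _ do rewrite XE.
  move=> H i; have Hi : k i *: piL ^+ i = 0.
    apply: (mpow_inf dvL) => n; apply: (val_sum_distinct dvL (term_inj (k := k))).
    by rewrite H; apply: mpow0.
  by move/eqP: Hi; rewrite scaler_eq0 expf_eq0 (negPf pi0) andbF orbF => /eqP.
have bX : basis_of {:L} X by rewrite basisEfree frX subvf size_tuple dimL leqnn.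
exists (fun i => coord X i x); rewrite [LHS](coord_basis bX (memvf x)).
by apply: eq_bigr => i _; rewrite XE.
Qed.

Lemma mpow_coord (m : int) (a : 'I_d -> K) : ML m (\sum_i a i *: piL ^+ i) ->
  forall i, ML m (a i *: piL ^+ i).
Proof. exact: (val_sum_distinct dvL (term_inj (k := a))). Qed.

Lemma Gal_pi_val (s : gal_of {:L}) : s \in G -> vL (s piL) = 1%:E.
Proof.
move=> sG; have [->|s1] := eqVneq s 1%g; first by rewrite gal_id.
apply: (val_approx dvL vpi); apply: mpow_le (mpow_val (brk sG s1)); lia.
Qed.

(** An automorphism replaces [piL] by another element of valuation 1, by the break condition, and
    leaves the coordinates in [K] alone; no extension theorem for valuations enters. *)
Lemma Gal_mpow (m : int) (s : gal_of {:L}) (x : L) : s \in G -> ML m x -> ML m (s x).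
Proof.
move=> sG; have [a ->] := coordL x => Hx.
rewrite rmorph_sum; apply: (mpow_sum dvL) => i _ /=.
have := mpow_coord Hx i.
rewrite -mulr_algl rmorphM rmorphXn /= Gal_alg //.
by rewrite /mpow /= !(Defs.valM dvL) !(valX dvL _ (Gal_pi_val sG)) !(valX dvL _ vpi).
Qed.

Lemma Gal_val (s : gal_of {:L}) (x : L) m : s \in G -> vL x = m%:E -> vL (s x) = m%:E.
Proof.
move=> sG E; apply: (mpow_exact dvL); first by apply: Gal_mpow => //; apply: mpow_val.
move=> H; have : ML (m + 1) (s^-1%g (s x)) by apply: Gal_mpow; rewrite ?groupV.
by rewrite -GalM mulgV gal_id => /(mpowE _ E); lia.
Qed.

(** Only the coordinate of [piL ^+ 0] can have a term of valuation 0, so residues of [L] are already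
    represented by [Kbar]. *)
Lemma residueL (z : L) : ML 0 z -> exists2 c, Kbar c & ML 1 (z - c%:A).
Proof.
have [a ->] := coordL z => Hz; have H := mpow_coord Hz.
pose i0 : 'I_d := Ordinal d_gt0.
have H0 : MK 0 (a i0).
  have := H i0; rewrite -mulr_algl expr0 mulr1 => H0.
  by apply: mpowA_inv H0 _; lia.
have [c Hc Hac] := teich_exists pK lf H0; exists c => //.
rewrite (bigD1 i0) //= expr0 addrAC; apply: (mpowD dvL).
  rewrite -scalerBl; apply: mpow_le (mpowA Hac); lia.
apply: (mpow_sum dvL) => i ii0.
have [ai|ai] := eqVneq (a i) 0; first by rewrite ai scale0r; apply: mpow0.
have [n En] := val_fin dvK ai; apply/(mpowE _ (term_val i En)).
move: (H i) => /(mpowE _ (term_val i En)).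
have i1 : (0 < i)%N by rewrite lt0n; apply: contra ii0 => /eqP E; apply/eqP/val_inj.
by apply: divz_rem_ge1; rewrite i1 /=.
Qed.

(** Typically [w] is the uniformizer of the field fixed by a subgroup of order [V], whose level [m]
    is level [V * m] of [vL]. *)
Lemma digitL (w z : L) (V m : nat) : vL w = V%:Z%:E -> ML (V * m)%N%:Z z ->
  exists2 c, Kbar c & ML (V * m).+1%:Z (z - c%:A * w ^+ m).
Proof.
move=> vw Hz; have vwm := valX dvL m vw; have w0 := val_neq0 dvL vwm.
have [c Hc H] : exists2 c, Kbar c & ML 1 (z / w ^+ m - c%:A).
  apply: residueL; have := mpowM dvL Hz (mpow_val (valV dvL vwm)).
  by apply: mpow_le; lia.
exists c => //; have := mpowM dvL H (mpow_val vwm).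
by rewrite mulrBl divfK //; apply: mpow_le; lia.
Qed.

(** * Norms and traces along subgroups of the Galois group *)

Definition normG (A : {set gal_of {:L}}) (x : L) : L := \prod_(a in A) a x.
Definition fixedby (A : {set gal_of {:L}}) (z : L) := forall a, a \in A -> a z = z.

Lemma normG1 x : normG 1%g x = x.
Proof. by rewrite /normG big_set1 gal_id. Qed.

Lemma normGM A x y : normG A (x * y) = normG A x * normG A y.
Proof. by rewrite /normG -big_split; apply: eq_bigr => a _; rewrite rmorphM. Qed.

Lemma normGV A x : normG A x^-1 = (normG A x)^-1.
Proof. by rewrite /normG -prodfV; apply: eq_bigr => a _; rewrite fmorphV. Qed.

Lemma normG_neq0 A x : x != 0 -> normG A x != 0.
Proof. by move=> x0; apply/prodf_neq0 => a _; rewrite fmorph_eq0. Qed.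

Lemma normG_val (A : {set gal_of {:L}}) x (m : int) : A \subset G ->
  vL x = m%:E -> vL (normG A x) = (#|A|%:Z * m)%:E.
Proof.
move=> AG vx; rewrite /normG -sum1_card -big_enum.
have : {subset enum A <= G} by move=> a; rewrite mem_enum; apply: (fintype.subsetP AG).
rewrite -[X in (X%:Z * m)]big_enum /=; elim: (enum A) => [|a s IH] sG.
  by rewrite !big_nil (val1 dvL) mul0r.
rewrite !big_cons (Defs.valM dvL) IH => [|c cs]; last by apply: sG; rewrite inE cs orbT.
rewrite (Gal_val _ vx) -?EFinD; last by apply: sG; rewrite inE eqxx.
by congr EFin; lia.
Qed.

Lemma normG_gal (A : {set gal_of {:L}}) s x : A \subset G -> s \in G ->
  s (normG A x) = normG A (s x).
Proof.
move=> AG sG; rewrite /normG rmorph_prod; apply: eq_bigr => a aA /=.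
by apply: Gal_commE => //; apply: (fintype.subsetP AG).
Qed.

Lemma normG_fix (A : {group gal_of {:L}}) x : A \subset G -> fixedby A (normG A x).
Proof.
move=> AG a aA; rewrite normG_gal ?(fintype.subsetP AG) // /normG.
rewrite (reindex_inj (mulgI a^-1%g)) /=.
apply: eq_big => [u|u uA]; first by rewrite groupMl ?groupV.
by rewrite -GalM mulKVg.
Qed.

Lemma fixedbyB A x y : fixedby A x -> fixedby A y -> fixedby A (x - y).
Proof. by move=> Hx Hy a aA; rewrite rmorphB /= Hx ?Hy. Qed.
Lemma fixedbyM A x y : fixedby A x -> fixedby A y -> fixedby A (x * y).
Proof. by move=> Hx Hy a aA; rewrite rmorphM /= Hx ?Hy. Qed.
Lemma fixedbyX A x n : fixedby A x -> fixedby A (x ^+ n).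
Proof. by move=> Hx a aA; rewrite rmorphXn /= Hx. Qed.
Lemma fixedby_alg (A : {set gal_of {:L}}) (c : K) : A \subset G -> fixedby A c%:A.
Proof. by move=> AG a aA; apply: Gal_alg; apply: (fintype.subsetP AG). Qed.
Lemma fixedby_gal (A : {set gal_of {:L}}) s x : A \subset G -> s \in G -> fixedby A x -> fixedby A (s x).
Proof.
by move=> AG sG Hx a aA; have aG := fintype.subsetP AG a aA; rewrite (Gal_commE _ aG sG) Hx.
Qed.

Definition cnorm (s : gal_of {:L}) (x : L) := \prod_(j < p) (s ^+ j)%g x.
Definition ctrace (s : gal_of {:L}) (x : L) := \sum_(j < p) (s ^+ j)%g x.

Section Join.
Variables (A : {group gal_of {:L}}) (s : gal_of {:L}).
Hypotheses (AG : A \subset G) (sG : s \in G) (sA : s \notin A).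

Lemma join_sub : (A <*> <[s]>)%g \subset G.
Proof. by rewrite join_subG AG cycle_subG. Qed.

Lemma joinE : (A <*> <[s]>)%g = [set (x.1 * s ^+ (x.2 : 'I_p))%g | x in finset.setX A [set: 'I_p]]%SET.
Proof.
have cAs : commute A <[s]>%g.
  apply: centC; rewrite centsC cycle_subG; apply/centP => a aA.
  by apply: Gal_comm => //; apply: (fintype.subsetP AG).
rewrite comm_joingE //; apply/setP => u; apply/mulsgP/imsetP => [[a w aA /cycleP [j ->] ->]|].
  exists (a, Ordinal (ltn_pmod j p_gt0)); first by rewrite inE aA inE.
  by rewrite /= expg_mod // Gal_exp.
case=> -[a j] /finset.setXP [/= aA _] ->; exists a (s ^+ j)%g => //; exact: mem_cycle.
Qed.

(** If a power of [s] with exponent between 0 and [p], both excluded, were in [A], then [s] would be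
    in [A] by Bezout, as [s^p = 1]. *)
Lemma join_inj : {in finset.setX A [set: 'I_p]%SET &, injective (fun x => (x.1 * s ^+ (x.2 : 'I_p))%g)}.
Proof.
move=> [a j] [a' j'] /finset.setXP [/= aA _] /finset.setXP [/= aA' _].
wlog jj : a j a' j' aA aA' / (j <= j')%N.
  move=> W E; case/orP: (leq_total j j') => H; first exact: W.
  by apply/esym/W.
move=> E; have Ea : (a'^-1 * a = s ^+ (j' - j))%g.
  move: E; rewrite -{1}(subnK jj) expgD mulgA => /mulIg ->; exact: mulKg.
have jE : j = j'.
  apply/val_inj/eqP; rewrite eqn_leq jj /= -subn_eq0; apply/negPn/negP => k0.
  case/negP: sA; have [u v Huv _] := egcdnP p (m := (j' - j)%N) (ltac:(by rewrite lt0n)).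
  have cop : coprime (j' - j) p.
    rewrite coprime_sym prime_coprime // gtnNdvd ?lt0n //.
    by rewrite (leq_ltn_trans (leq_subr _ _)).
  have : (s ^+ ((j' - j) * u) \in A)%g by rewrite expgM -Ea groupX // groupM ?groupV.
  by rewrite mulnC Huv (eqP cop) expgD mulnC expgM Gal_exp // expg1n mul1g expg1.
move: E; rewrite jE => /mulIg -> //.
Qed.

Lemma card_join : #|(A <*> <[s]>)%g| = (p * #|A|)%N.
Proof.
by rewrite joinE (card_in_imset join_inj) cardsX cardsT card_ord mulnC.
Qed.

Lemma normG_join x : normG (A <*> <[s]>)%g x = cnorm s (normG A x).
Proof.
rewrite /normG joinE (big_imset _ join_inj) /=.
rewrite (eq_bigl (fun x => (x.1 \in A) && (x.2 \in [set: 'I_p]%SET))) => [|[a j]]; last by rewrite finset.in_setX.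
rewrite -(pair_big (fun a => a \in A) (fun j => j \in [set: 'I_p]%SET) 
  (fun a (j : 'I_p) => (a * s ^+ j)%g x)) /=.
rewrite exchange_big /cnorm; apply: eq_big => [j|j _]; first by rewrite inE.
by rewrite rmorph_prod; apply: eq_bigr => a _; rewrite GalM.
Qed.

Lemma fixedby_join x : fixedby (A <*> <[s]>)%g x <-> fixedby A x /\ s x = x.
Proof.
split=> [H|[HA Hs] u].
  split=> [a aA|]; apply: H; first by rewrite mem_gen // inE aA.
  by rewrite mem_gen // inE cycle_id orbT.
rewrite joinE => /imsetP [[a j] /finset.setXP [/= aA _] ->]; rewrite GalM HA //.
by elim: (j : nat) => [|n IH]; rewrite ?gal_id // expgS GalM Hs.
Qed.

End Join.

Lemma Gal_exp_in s (j : nat) : s \in G -> (s ^+ j)%g \in G.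
Proof. by move=> sG; apply: groupX. Qed.

Lemma gal_expS (s : gal_of {:L}) (j : nat) (x : L) : (s ^+ j.+1)%g x = (s ^+ j)%g (s x).
Proof. by rewrite expgS GalM. Qed.

Lemma ctraceD s x y : ctrace s (x + y) = ctrace s x + ctrace s y.
Proof. by rewrite /ctrace -big_split; apply: eq_bigr => j _; rewrite rmorphD. Qed.

Lemma ctraceM (s : gal_of {:L}) (x y : L) : s x = x -> ctrace s (x * y) = x * ctrace s y.
Proof.
move=> sx; rewrite /ctrace mulr_sumr; apply: eq_bigr => j _ /=; rewrite rmorphM /=.
congr (_ * _); elim: (j : nat) => [|n IH]; first by rewrite gal_id.
by rewrite gal_expS sx IH.
Qed.

Lemma pchar_End : p \in [pchar 'End(L)].
Proof.
rewrite inE p_pr /=; apply/eqP/lfunP => x.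
have -> : (p%:R : 'End(L)) = (p%:R : K) *: 1 by rewrite scaler_nat.
by rewrite pcharf0 // scale0r.
Qed.

(** In ['End(L)] the sum of the powers of [S] is [(S - 1)^(p-1)]. As each difference raises the
    level by [b], the trace gains [(p - 1) b], the role usually played by the different. *)
Lemma ctrace_iter s x : ctrace s x = iter p.-1 (fun z => s z - z) x.
Proof.
pose S : 'End(L) := s.
have cS : GRing.comm S 1 by rewrite /GRing.comm mulr1 mul1r.
have Sx j z : (S ^+ j) z = (s ^+ j)%g z.
  elim: j z => [|j IH] z; first by rewrite expr0 expg0 id_lfunE gal_id.
  by rewrite exprS lfun_mulE IH gal_expS.
have Dx n z : ((S - 1) ^+ n) z = iter n (fun z => s z - z) z.
  elim: n z => [|n IH] z; first by rewrite expr0 id_lfunE.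
  by rewrite exprS lfun_mulE IH iterSr add_lfunE opp_lfunE id_lfunE.
rewrite -Dx (subX_pred_pchar pchar_End cS) sum_lfunE /ctrace.
rewrite (reindex_inj rev_ord_inj); apply: eq_bigr => j _.
have -> : rev_ord j = (p.-1 - j)%N :> nat by rewrite /= -subn1 subnAC subn1 -subnS.
by rewrite expr1n mulr1 Sx.
Qed.

Lemma natr_inv (F : fieldType) (r : nat) : p \in [pchar F] -> (0 < r < p)%N ->
  exists u : nat, u%:R * r%:R = 1 :> F.
Proof.
move=> pF /andP[r0 rp]; have [u v Huv _] := egcdnP p r0; exists u.
have cop : coprime r p by rewrite coprime_sym prime_coprime // gtnNdvd.
by rewrite -natrM Huv (eqP cop) natrD natrM (pcharf0 pF) mulr0 add0r.
Qed.

Lemma pL : p \in [pchar L].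
Proof. by rewrite pchar_lalg. Qed.

Section Step.
Variables (A : {group gal_of {:L}}) (s : gal_of {:L}).
Hypotheses (AG : A \subset G) (sG : s \in G).
Variable V : nat.
Hypothesis Pa : forall u z (m : nat), u \in G -> fixedby A z -> 
  ML (V * m)%N%:Z z -> ML (V * (m + b))%N%:Z (u z - z).

Lemma ctrace_mpow w (m : nat) : fixedby A w -> ML (V * m)%N%:Z w ->
  ML (V * (m + p.-1 * b))%N%:Z (ctrace s w).
Proof.
move=> Aw Hw; rewrite ctrace_iter; move: w m Aw Hw.
elim: p.-1 => [|n IH] w m Aw Hw; first by rewrite mul0n addn0.
rewrite iterSr; have := IH (s w - w) (m + b)%N.
rewrite mulSn addnA; apply; last exact: Pa.
by apply: fixedbyB => //; apply: fixedby_gal.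
Qed.

Lemma gal_exp_diff w (m j : nat) : fixedby A w -> ML (V * m)%N%:Z w ->
  ML (V * (m + b))%N%:Z ((s ^+ j)%g w - w).
Proof. by move=> Aw Hw; apply: Pa => //; apply: Gal_exp_in. Qed.

Lemma cnorm_frob w (m : nat) : fixedby A w -> ML (V * m)%N%:Z w ->
  ML (V * (p * m + b))%N%:Z (cnorm s w - w ^+ p).
Proof.
move=> Aw Hw; have H j := gal_exp_diff j Aw Hw.
have Hs j : ML (V * m)%N%:Z ((s ^+ j)%g w) by apply: Gal_mpow => //; apply: Gal_exp_in.
rewrite /cnorm; elim: p => [|n IH]; first by rewrite big_ord0 expr0 subrr; apply: mpow0.
rewrite big_ord_recr exprSr /=; set P := \prod_(i < n) _ in IH *.
have -> : P * (s ^+ n)%g w - w ^+ n * w = (P - w ^+ n) * (s ^+ n)%g w + w ^+ n * ((s ^+ n)%g w - w) by ring.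
have Hwn := mpowX dvL n Hw.
apply: (mpowD dvL).
  apply: mpow_le (mpowM dvL IH (Hs n)); clear. nia.
by apply: mpow_le (mpowM dvL Hwn (H n)); clear; nia.
Qed.

(** The elementary symmetric functions of degree strictly between 1 and [p] form the error. Newton's
    identities express them by the traces of the powers of [w], each gaining [(p - 1) b], and the
    division by [r < p] is harmless. *)
Lemma cnorm_expand w (n : nat) : fixedby A w -> ML (V * n)%N%:Z w ->
  ML (V * (2 * n + p.-1 * b))%N%:Z (cnorm s (1 + w) - (1 + ctrace s w + cnorm s w)).
Proof.
move=> Aw Hw; pose W (j : 'I_p) := (s ^+ j)%g w.
pose e := \prod_(j < p) (1 + W j *: 'X) : {poly L}.
have newt r : e`_r.+1 *+ r.+1 = \sum_(i < r.+1) (-1) ^+ i * (\sum_(j < p) W j ^+ i.+1) * e`_(r - i).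
  exact: newton_elementary.
have pw i : ML (V * (i.+1 * n + p.-1 * b))%N%:Z (\sum_(j < p) W j ^+ i.+1).
  rewrite (eq_bigr (fun j : 'I_p => (s ^+ j)%g (w ^+ i.+1))); last by move=> j _; rewrite rmorphXn.
  apply: ctrace_mpow; first exact: fixedbyX.
  by apply: mpow_le (mpowX dvL i.+1 Hw); clear; nia.
have ebig m (u : 'I_m -> L) i : (m < i)%N -> (\prod_(j < m) (1 + u j *: 'X))`_i = 0.
  elim: m u i => [|m IH] u [|i] // mi; first by rewrite big_ord0 coef1.
  rewrite big_ord_recl mulrDl mul1r coefD -scalerAl coefZ coefXM !IH ?mulr0 ?addr0 //.
  exact: ltnW.
have e0 m (u : 'I_m -> L) : (\prod_(j < m) (1 + u j *: 'X))`_0 = 1.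
  elim: m u => [|m IH] u; first by rewrite big_ord0 coef1.
  by rewrite big_ord_recl mulrDl mul1r coefD -scalerAl coefZ coefXM IH mulr0 addr0.
have etop m (u : 'I_m -> L) : (\prod_(j < m) (1 + u j *: 'X))`_m = \prod_j u j.
  elim: m u => [|m IH] u; first by rewrite !big_ord0 coef1.
  rewrite !big_ord_recl mulrDl mul1r coefD -scalerAl coefZ coefXM IH ebig ?add0r //.
have er r : (0 < r < p)%N -> ML (V * (r * n + p.-1 * b))%N%:Z e`_r.
  elim/ltn_ind: r => -[|r] IH // rp; have [u Hu] := natr_inv pL rp.
  rewrite -[e`_r.+1]mul1r -Hu -mulrA; apply: (mpow0M dvL); first exact: mpow_nat.
  rewrite mulr_natl newt; apply: (mpow_sum dvL) => i _.
  rewrite -mulrA; apply: (mpow0M dvL).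
    by apply: (mpow0X dvL); apply: (mpowN dvL); apply: mpow1.
  have [ir|ir] := eqVneq (i : nat) r.
    by rewrite ir subnn e0 mulr1; apply: pw.
  have ilt : (i < r)%N by rewrite ltn_neqAle ir -ltnS ltn_ord.
  have ri : (0 < r - i < p)%N by case/andP: rp; lia.
  have rr : (r - i < r.+1)%N by lia.
  apply: mpow_le (mpowM dvL (pw i) (IH (r - i)%N rr ri)).
  have -> : (r.+1 * n = i.+1 * n + (r - i) * n)%N by rewrite -mulnDl; congr (_ * _)%N; clear -ilt; lia.
  by clear; nia.
have szp : (size e <= p.+1)%N by apply/leq_sizeP => j; apply: ebig.
have eN : cnorm s (1 + w) = e.[1].
  rewrite /cnorm /e horner_prod; apply: eq_bigr => j _.
  by rewrite rmorphD rmorph1 hornerD hornerC hornerZ hornerX mulr1.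
rewrite eN (horner_coef_wide _ szp) -(big_mkord xpredT (fun i => e`_i * 1 ^+ i)).
rewrite big_nat_recr // big_ltn // big_ltn ?prime_gt1 //= !expr1n !mulr1.
rewrite (e0 p W : e`_0 = 1) (etop p W : e`_p = _).
have e1 : e`_1 = ctrace s w.
  have := newt 0%N; rewrite mulr1n big_ord_recl big_ord0 addr0 => ->.
  by rewrite expr0 mul1r subn0 /e e0 mulr1 /ctrace; apply: eq_bigr => j _; rewrite expr1.
rewrite e1 (eq_bigr (fun i => e`_i)) => [|i _]; last by rewrite expr1n mulr1.
have -> : 1 + (ctrace s w + \sum_(2 <= i < p) e`_i) + \prod_(j < p) W j
   - (1 + ctrace s w + cnorm s w) = \sum_(2 <= i < p) e`_i.
  by rewrite /cnorm -/W; ring.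
rewrite big_nat_cond; apply: (mpow_sum dvL) => i /andP[/andP[i1 ip] _].
by apply: mpow_le (er i _); [clear -i1; nia|clear -i1 ip; lia].
Qed.

End Step.

Lemma algM (x y : K) : (x * y)%:A = x%:A * y%:A :> L.
Proof. by rewrite mulr_algl scalerA. Qed.

(** * Leading coefficients at the break and the descent by steps of degree p *)

Lemma break_exists s : s \in G -> exists c, Kbar c /\ ML b.+1%:Z (s piL / piL - 1 - c%:A * piL ^+ b).
Proof.
move=> sG; have Hb : ML (1 * b)%N%:Z (s piL / piL - 1).
  have [->|s1] := eqVneq s 1%g; first by rewrite gal_id divff // subrr; apply: mpow0.
  have -> : s piL / piL - 1 = (s piL - piL) / piL by rewrite mulrBl divff.
  apply: mpow_le (mpowM dvL (mpow_val (brk sG s1)) (mpow_val (valV dvL vpi))).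
  by clear; lia.
have [c Hc H] := digitL (w := piL) (V := 1%N) vpi Hb.
by exists c; split=> //; rewrite -[b in b.+1]mul1n.
Qed.

(** The classical embedding of the ramification group at the break into [U^b/U^(b+1)], identified
    with the additive group [Kbar]. *)
Definition break_coef (s : gal_of {:L}) : K :=
  xget 0 [set c | Kbar c /\ ML b.+1%:Z (s piL / piL - 1 - c%:A * piL ^+ b)].
Local Notation dG := break_coef.

Lemma break_coefP s : s \in G -> Kbar (dG s) /\ ML b.+1%:Z (s piL / piL - 1 - (dG s)%:A * piL ^+ b).
Proof.
move=> sG; rewrite /dG; case: xgetP => // H.
by have [c /H] := break_exists sG.
Qed.

Lemma Kbar_coef_unique w (V : nat) c c' m : vL w = V%:Z%:E -> Kbar c -> Kbar c' ->
  ML (V * m).+1%:Z (c%:A * w ^+ m - c'%:A * w ^+ m) -> c = c'.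
Proof.
move=> vw Hc Hc' H; apply/eqP; rewrite -subr_eq0; apply/eqP.
apply: KbarA_M1; first exact: (KbarB pK lf).
move: H; rewrite -mulrBl -scalerBl => /(mpowMV dvL (valX dvL m vw)).
by apply: mpow_le; clear; lia.
Qed.

Lemma break_coefE s c : s \in G -> Kbar c ->
  ML b.+1%:Z (s piL / piL - 1 - c%:A * piL ^+ b) -> dG s = c.
Proof.
move=> sG Hc H; have [Hd Hs] := break_coefP sG.
apply: (@Kbar_coef_unique piL 1 _ _ b) => //; rewrite mul1n.
have -> : (dG s)%:A * piL ^+ b - c%:A * piL ^+ b =
  (s piL / piL - 1 - c%:A * piL ^+ b) - (s piL / piL - 1 - (dG s)%:A * piL ^+ b) by ring.
exact: mpowB.
Qed.

(** With [1 + x] and [1 + y] the two factors of [(s * u) piL / piL], the product [x y] lies above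
    level [b], as does the change of [piL ^+ b] under [u]. *)
Lemma break_coefM s u : s \in G -> u \in G -> dG (s * u)%g = dG s + dG u.
Proof.
move=> sG uG; have [Hs Es] := break_coefP sG; have [Hu Eu] := break_coefP uG.
apply: break_coefE; [exact: groupM|exact: (KbarD pK lf)|].
have u0 : u piL != 0 by rewrite fmorph_eq0.
pose x := u (s piL / piL - 1); pose y := u piL / piL - 1.
have -> : (s * u)%g piL / piL - 1 = x + y + x * y.
  by rewrite /x /y rmorphB rmorph1 rmorphM fmorphV GalM /=; field; rewrite u0 pi0.
have piB : ML (b%:Z) (piL ^+ b) by apply: mpow_le (mpowX dvL b (mpow_val vpi)); clear; lia.
have Hy : ML b%:Z y.
  apply: (mpowBl dvL (y := (dG u)%:A * piL ^+ b)); first by apply: mpow_le Eu; clear; lia.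
  exact: (mpow0M dvL (KbarA_int Hu)).
have Hx : ML b.+1%:Z (x - (dG s)%:A * u (piL ^+ b)).
  have := Gal_mpow uG Es; rewrite rmorphB rmorphM /= Gal_alg //.
have Hpu : ML b.+1%:Z (u (piL ^+ b) - piL ^+ b).
  rewrite rmorphXn /=.
  have Hup : ML (1 + b%:Z) (u piL - piL).
    have -> : u piL - piL = y * piL by rewrite /y mulrBl divfK // mul1r.
    by have := mpowM dvL Hy (mpow_val vpi); apply: mpow_le; clear; lia.
  have := mpow_subX dvL b (mpow_val (Gal_val uG vpi)) (mpow_val vpi) Hup.
  by apply: mpow_le; clear -b_gt0; lia.
have Hx' : ML b.+1%:Z (x - (dG s)%:A * piL ^+ b).
  apply: (mpow_trans dvL Hx); rewrite -mulrBr; exact: (mpow0M dvL (KbarA_int Hs)).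
have Hxb : ML b%:Z x.
  apply: (mpowBl dvL (y := (dG s)%:A * piL ^+ b)); first by apply: mpow_le Hx'; clear; lia.
  exact: (mpow0M dvL (KbarA_int Hs)).
have -> : x + y + x * y - (dG s + dG u)%:A * piL ^+ b =
  (x - (dG s)%:A * piL ^+ b) + (y - (dG u)%:A * piL ^+ b) + x * y.
  by rewrite scalerDl; ring.
apply: (mpowD dvL); first exact: mpowD.
by apply: mpow_le (mpowM dvL Hxb Hy); clear -b_gt0; lia.
Qed.

Lemma break_coef1 : dG 1%g = 0.
Proof.
apply: break_coefE; [exact: group1|exact: (Kbar_zero pK lf)|].
by rewrite gal_id divff // subrr scale0r mul0r subrr; apply: mpow0.
Qed.

Lemma break_coefX s j : s \in G -> dG (s ^+ j)%g = j%:R * dG s.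
Proof.
move=> sG; elim: j => [|j IH]; first by rewrite expg0 break_coef1 mul0r.
by rewrite expgS break_coefM ?groupX // IH mulrS mulrDl mul1r.
Qed.

Lemma break_coef_neq0 s : s \in G -> s != 1%g -> dG s != 0.
Proof.
move=> sG s1; apply/eqP => d0; have [_] := break_coefP sG.
rewrite d0 scale0r mul0r subr0 => H.
have E : vL (s piL / piL - 1) = b%:Z%:E.
  have -> : s piL / piL - 1 = (s piL - piL) / piL by rewrite mulrBl divff.
  by rewrite (Defs.valM dvL) (brk sG s1) (valV dvL vpi) -EFinD; congr EFin; clear; lia.
by move: H => /(mpowE _ E); clear; lia.
Qed.

Lemma break_coef_inj s u : s \in G -> u \in G -> dG s = dG u -> s = u.
Proof.
move=> sG uG E; apply/eqP; rewrite eq_mulgV1; apply/negPn/negP => H.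
have suG : (s * u^-1)%g \in G by rewrite groupM ?groupV.
have := break_coef_neq0 suG H; rewrite -(addrK (dG u) (dG (s * u^-1)%g)).
by rewrite -break_coefM // mulgKV E subrr eqxx.
Qed.

(** The invariants carried from [L] down to the field fixed by [A]. The map at the break stays
    abstract: in fact a composite of additive polynomials, it matters only through additivity and an
    upper bound on its kernel. [tw_gap] expresses that [vL] takes values divisible by [V] on fixed
    elements, and [tw_shift] that the break is still at least [b]. *)
Record tower (A : {group gal_of {:L}}) (V : nat) : Prop := Tower {
  tw_sub : A \subset G;
  tw_card : #|A| = V;
  tw_shift : forall u z (m : nat), u \in G -> fixedby A z ->
    ML (V * m)%N%:Z z -> ML (V * (m + b))%N%:Z (u z - z);
  tw_break : exists f : K -> K, [/\
    forall c c', Kbar c -> Kbar c' -> f (c + c') = f c + f c',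
    forall c, Kbar c -> Kbar (f c),
    forall c, Kbar c -> f c = 0 -> exists2 a, a \in A & c = dG a &
    forall c h, Kbar c -> ML b.+1%:Z (h - 1 - c%:A * piL ^+ b) ->
      ML (V * b).+1%:Z (normG A h - 1 - (f c)%:A * normG A piL ^+ b)];
  tw_low : forall n c h, (0 < n < b)%N -> Kbar c -> ML n.+1%:Z (h - 1 - c%:A * piL ^+ n) ->
    ML (V * n).+1%:Z (normG A h - 1 - (c ^+ V)%:A * normG A piL ^+ n);
  tw_high : forall n a, (b < n)%N -> Kbar a ->
    exists x, ML (V * n).+1%:Z (normG A x - 1 - a%:A * normG A piL ^+ n);
  tw_gap : forall z m, fixedby A z -> ML (V * m).+1%:Z z -> ML (V * m.+1)%N%:Z z }.

(** Any fixed [z] is a digit times a power of [w] plus a fixed remainder one level deeper, so the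
    displacement of [w] controls that of [z]. *)
Lemma shift_of_uniformizer (A : {group gal_of {:L}}) (V : nat) w u : (0 < V)%N ->
  A \subset G -> fixedby A w -> vL w = V%:Z%:E ->
  (forall z m, fixedby A z -> ML (V * m).+1%:Z z -> ML (V * m.+1)%N%:Z z) ->
  u \in G -> ML (V * b.+1)%N%:Z (u w - w) ->
  forall z m, fixedby A z -> ML (V * m)%N%:Z z -> ML (V * (m + b))%N%:Z (u z - z).
Proof.
move=> V0 AG Aw vw gap uG Huw.
(* Induction on the gain [k], capped at [b]: passing to the deeper remainder earns one more unit of
   gain. *)
suff H k z m : fixedby A z -> ML (V * m)%N%:Z z -> ML (V * (m + minn k b))%N%:Z (u z - z).
  by move=> z m Az Hz; have := H b z m Az Hz; rewrite minnn.
elim: k z m => [|k IH] z m Az Hz.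
  by rewrite min0n addn0; apply: mpowB => //; apply: Gal_mpow.
have [c Hc Hz1] := digitL vw Hz; set z1 := z - _ in Hz1.
have Az1 : fixedby A z1.
  by apply: fixedbyB => //; apply: fixedbyM; [exact: fixedby_alg|exact: fixedbyX].
have H1 := IH _ _ Az1 (gap _ _ Az1 Hz1).
have -> : u z - z = (u z1 - z1) + c%:A * (u (w ^+ m) - w ^+ m).
  by rewrite /z1 rmorphB rmorphM /= Gal_alg //; ring.
apply: (mpowD dvL).
  by apply: mpow_le H1; rewrite lez_nat leq_mul2l; apply/orP; right; clear; lia.
apply: (mpow0M dvL (KbarA_int Hc)); rewrite rmorphXn /=.
have Huw' : ML (V%:Z + (V * b)%N%:Z) (u w - w) by apply: mpow_le Huw; clear; nia.
apply: mpow_le (mpow_subX dvL m (mpow_val (Gal_val uG vw)) (mpow_val vw) Huw').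
have : (minn k.+1 b <= b)%N by rewrite geq_minr.
by clear; nia.
Qed.

Lemma normG_unif_val (A : {group gal_of {:L}}) (V : nat) : tower A V ->
  vL (normG A piL) = V%:Z%:E.
Proof. by case=> AG cA *; rewrite (normG_val AG vpi) cA mulr1. Qed.

Lemma tower1 : tower 1%G 1%N.
Proof.
have sub1 : 1%G \subset G by exact: sub1G.
have gap1 z m : fixedby 1%G z -> ML (1 * m).+1%:Z z -> ML (1 * m.+1)%N%:Z z.
  by move=> _; rewrite !mul1n.
split=> //; first by rewrite cards1.
- move=> u z m uG; apply: (shift_of_uniformizer (w := piL)) => //.
    by move=> a /set1P ->; rewrite gal_id.
  rewrite mul1n; have [->|u1] := eqVneq u 1%g; first by rewrite gal_id subrr; apply: mpow0.
  exact: mpow_val (brk uG u1).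
- exists id; split=> // [c _ ->|c h _]; first by exists 1%g => //; rewrite break_coef1.
  by rewrite !normG1 mul1n.
- by move=> n c h _ _; rewrite !normG1 mul1n expr1.
- move=> n a _ _; exists (1 + a%:A * piL ^+ n); rewrite !normG1.
  have -> : 1 + a%:A * piL ^+ n - 1 - a%:A * piL ^+ n = 0 by ring.
  exact: mpow0.
Qed.

Section TowerStep.
Variables (A : {group gal_of {:L}}) (V : nat) (s : gal_of {:L}) (f : K -> K).
Hypothesis tA : tower A V.
Hypotheses (sG : s \in G) (sA : s \notin A).
Hypothesis fD : forall c c', Kbar c -> Kbar c' -> f (c + c') = f c + f c'.
Hypothesis fK : forall c, Kbar c -> Kbar (f c).
Hypothesis fker : forall c, Kbar c -> f c = 0 -> exists2 a, a \in A & c = dG a.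
Hypothesis fN : forall c h, Kbar c -> ML b.+1%:Z (h - 1 - c%:A * piL ^+ b) ->
      ML (V * b).+1%:Z (normG A h - 1 - (f c)%:A * normG A piL ^+ b).

Let AG : A \subset G := tw_sub tA.
Let cA : #|A| = V := tw_card tA.
Local Notation w := (normG A piL).
Local Notation w' := (normG (A <*> <[s]>)%g piL).
Let vw : vL w = V%:Z%:E := normG_unif_val tA.
Let w0 : w != 0 := val_neq0 dvL vw.
Let Aw : fixedby A w. Proof. exact: normG_fix. Qed.
Let V_gt0 : (0 < V)%N. Proof. by rewrite -cA cardG_gt0. Qed.
Let gap := tw_gap tA.
Let wX m : ML (V * m)%N%:Z (w ^+ m).
Proof. by apply: mpow_le (mpowX dvL m (mpow_val vw)); clear; lia. Qed.
Let w'E : w' = cnorm s w. Proof. exact: normG_join. Qed.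
Let card_A' : #|(A <*> <[s]>)%g| = (p * V)%N. Proof. by rewrite card_join // cA. Qed.
Let vw' : vL w' = (p * V)%N%:Z%:E.
Proof. by rewrite (normG_val (join_sub AG sG sA) vpi) card_A' mulr1. Qed.

Let w'_near : ML (V * (p + b))%N%:Z (w' - w ^+ p).
Proof.
rewrite w'E; have := cnorm_frob AG sG (tw_shift tA) (m := 1) Aw.
rewrite !muln1; apply; exact: mpow_val.
Qed.

Let w'X_near m : ML (V * (p * m + b))%N%:Z (w' ^+ m - w ^+ (p * m)).
Proof.
rewrite exprM; have H : ML ((p * V)%N%:Z + (V * b)%N%:Z) (w' - w ^+ p).
  by apply: mpow_le w'_near; clear; nia.
have Hwp : ML (p * V)%N%:Z (w ^+ p) by rewrite mulnC; apply: wX.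
by apply: mpow_le (mpow_subX dvL m (mpow_val vw') Hwp H); clear; nia.
Qed.

(** In units of [V], the trace term lies at level [n + (p - 1) b] or deeper and the Frobenius term
    at [p n], with equality of the two bounds at [n = b]. The first estimate on [r] serves at and
    below the break; the second, which discards the Frobenius term too, serves above it. *)
Let cnorm_lead x (e : K) n : (0 < n)%N -> Kbar e -> fixedby A x ->
  ML (V * n).+1%:Z (x - 1 - e%:A * w ^+ n) ->
  exists r, [/\ cnorm s x = 1 + e%:A * ctrace s (w ^+ n) + (e ^+ p)%:A * w' ^+ n + r,
    forall m : nat, (m <= p * n)%N -> (m <= n + p.-1 * b)%N -> ML (V * m).+1%:Z r &
    forall m : nat, (m <= n + p.-1 * b)%N -> (m < p * n)%N -> 
      ML (V * m).+1%:Z ((e ^+ p)%:A * w' ^+ n + r)].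
Proof.
move=> n0 He Ax; pose y := x - 1; pose h := y - e%:A * w ^+ n => Hh.
have Ay : fixedby A y by apply: fixedbyB => // a _; rewrite rmorph1.
have Ah : fixedby A h.
  by apply: fixedbyB => //; apply: fixedbyM; [exact: fixedby_alg|exact: fixedbyX].
have Hh1 : ML (V * n.+1)%N%:Z h by apply: gap.
have Hew : ML (V * n)%N%:Z (e%:A * w ^+ n) by apply: (mpow0M dvL (KbarA_int He)).
have Hy : ML (V * n)%N%:Z y.
  by rewrite -(subrK (e%:A * w ^+ n) y); apply: (mpowD dvL) => //; apply: mpow_le Hh1; clear; nia.
have sh := tw_shift tA.
have E1 := cnorm_expand AG sG sh Ay Hy.
have E2 := cnorm_frob AG sG sh Ay Hy.
have E3 := ctrace_mpow AG sG sh Ah Hh1.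
have E4 := w'X_near n.
have E5 : ML (V * (p * n.+1))%N%:Z (h ^+ p) by apply: mpow_le (mpowX dvL p Hh1); clear; nia.
have yE : y = e%:A * w ^+ n + h by rewrite /h; ring.
have pP : p \in [pchar L] by exact: pL.
have ypE : y ^+ p = (e ^+ p)%:A * w ^+ (p * n) + h ^+ p.
  rewrite yE (frobD1 pP) exprMn -exprM [(n * p)%N]mulnC; congr (_ * _ + _).
  by rewrite -[RHS]/(in_alg L (e ^+ p)) rmorphXn.
have TyE : ctrace s y = e%:A * ctrace s (w ^+ n) + ctrace s h.
  by rewrite {1}yE ctraceD ctraceM // Gal_alg.
pose r := cnorm s x - (1 + e%:A * ctrace s (w ^+ n) + (e ^+ p)%:A * w' ^+ n).
have rE : r = (cnorm s (1 + y) - (1 + ctrace s y + cnorm s y)) + (cnorm s y - y ^+ p)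
   + ctrace s h + h ^+ p - (e ^+ p)%:A * (w' ^+ n - w ^+ (p * n)).
  by rewrite TyE ypE /r /y [1 + (x - 1)]addrC subrK; ring.
have Hep : ML 0 ((e ^+ p)%:A) by apply: KbarA_int; apply: (KbarX pK lf).
have Hr m : (m <= p * n)%N -> (m <= n + p.-1 * b)%N -> ML (V * m).+1%:Z r.
  move=> m1 m2; rewrite rE; apply: (mpowB dvL); last first.
    by apply: (mpow0M dvL Hep); apply: mpow_le E4; clear -m1 b_gt0 V_gt0; nia.
  apply: (mpowD dvL); [apply: (mpowD dvL); [apply: (mpowD dvL)|]|].
  - by apply: mpow_le E1; clear -m2 n0 V_gt0; nia.
  - by apply: mpow_le E2; clear -m1 b_gt0 V_gt0; nia.
  - by apply: mpow_le E3; clear -m2 V_gt0; nia.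
  - by apply: mpow_le E5; clear -m1 p_gt0 V_gt0; nia.
exists r; split=> //; first by rewrite /r; ring.
move=> m m2 m1; apply: (mpowD dvL); last by apply: Hr => //; exact: ltnW.
apply: (mpow0M dvL Hep); apply: mpow_le (mpowX dvL n (mpow_val vw')).
by clear -m1 V_gt0; nia.
Qed.

Let Tb : ML (V * (p * b))%N%:Z (ctrace s (w ^+ b)).
Proof.
have := ctrace_mpow AG sG (tw_shift tA) (fixedbyX b Aw) (wX b).
by apply: mpow_le; clear -p_gt0; nia.
Qed.

Let Tw'_fix : s w' = w'.
Proof.
have := normG_fix piL (join_sub AG sG sA); apply.
by rewrite mem_gen // inE cycle_id orbT.
Qed.

Lemma trace_coef : exists2 l, Kbar l &
  ML (V * (p * b)).+1%:Z (ctrace s (w ^+ b) - l%:A * w ^+ (p * b)).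
Proof. exact: digitL vw Tb. Qed.

Section Lambda.
Variable l : K.
Hypotheses (lK : Kbar l)
  (lE : ML (V * (p * b)).+1%:Z (ctrace s (w ^+ b) - l%:A * w ^+ (p * b))).

(** At the break the trace and Frobenius terms meet at level [p * b], so leading coefficients
    undergo the additive polynomial [X^p + l X]. *)
Let f' c := f c ^+ p + l * f c.

Let f'K c : Kbar c -> Kbar (f' c).
Proof.
by move=> Hc; apply: (KbarD pK lf); [apply: (KbarX pK lf)|apply: (KbarM pK lf) => //]; apply: fK.
Qed.

Let f'D c c' : Kbar c -> Kbar c' -> f' (c + c') = f' c + f' c'.
Proof. by move=> Hc Hc'; rewrite /f' fD // (frobD1 pK); ring. Qed.

Let lw'E m : ML (V * (p * m) + V * (p * b)).+1%:Z (ctrace s (w ^+ b) * w' ^+ m - l%:A * w' ^+ (m + b)).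
Proof.
have -> : ctrace s (w ^+ b) * w' ^+ m - l%:A * w' ^+ (m + b) =
  ((ctrace s (w ^+ b) - l%:A * w ^+ (p * b)) - l%:A * (w' ^+ b - w ^+ (p * b))) * w' ^+ m.
  by rewrite exprD; ring.
have Hw'm : ML (V * (p * m))%N%:Z (w' ^+ m).
  by apply: mpow_le (mpowX dvL m (mpow_val vw')); clear; nia.
have H : ML (V * (p * b)).+1%:Z (ctrace s (w ^+ b) - l%:A * w ^+ (p * b) - l%:A * (w' ^+ b - w ^+ (p * b))).
  apply: (mpowB dvL) => //; apply: (mpow0M dvL (KbarA_int lK)).
  by apply: mpow_le (w'X_near b); clear -b_gt0 V_gt0; nia.
by apply: mpow_le (mpowM dvL H Hw'm); clear; lia.
Qed.

Let f'N c h : Kbar c -> ML b.+1%:Z (h - 1 - c%:A * piL ^+ b) ->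
  ML (p * V * b).+1%:Z (normG (A <*> <[s]>)%g h - 1 - (f' c)%:A * w' ^+ b).
Proof.
move=> Hc /(fN Hc) Hh; rewrite normG_join //.
have [r [-> Hr _]] := cnorm_lead b_gt0 (fK Hc) (normG_fix h AG) Hh.
have -> : 1 + (f c)%:A * ctrace s (w ^+ b) + (f c ^+ p)%:A * w' ^+ b + r - 1 - (f' c)%:A * w' ^+ b
  = (f c)%:A * (ctrace s (w ^+ b) * w' ^+ 0 - l%:A * w' ^+ (0 + b)) + r.
  by rewrite /f' scalerDl algM expr0 add0n; ring.
apply: (mpowD dvL).
  apply: (mpow0M dvL (KbarA_int (fK Hc))); apply: mpow_le (lw'E 0); clear; nia.
have H1 : (p * b <= b + p.-1 * b)%N by clear -p_gt0; nia.
by apply: mpow_le (Hr _ (leqnn _) H1); clear; nia.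
Qed.

Let w'neq0 : w' != 0 := val_neq0 dvL vw'.

Let eps := f (dG s).
Let epsK : Kbar eps. Proof. by apply: fK; case: (break_coefP sG). Qed.
Let eps_neq0 : eps != 0.
Proof.
apply/eqP => e0; have [Hs _] := break_coefP sG; have [a aA E] := fker Hs e0.
by case/negP: sA; rewrite (break_coef_inj sG _ E) //; apply: (fintype.subsetP AG).
Qed.

(** The unit [s piL / piL] has norm 1 over the enlarged group, so its leading coefficient is killed.
    This determines [l] and shows that it is nonzero. *)
Let f'_break : f' (dG s) = 0.
Proof.
have [Hs Es] := break_coefP sG; apply/eqP; rewrite -oppr_eq0; apply/eqP.
have := f'N Hs Es; rewrite normGM normGV.
have -> : normG (A <*> <[s]>)%g (s piL) = w' by rewrite -normG_gal ?join_sub.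
rewrite divff // subrr add0r => H.
apply: (@Kbar_coef_unique w' (p * V)%N _ _ b) => //.
- by apply: (KbarN pK lf); apply: f'K.
- exact: (Kbar_zero pK lf).
- by rewrite scale0r mul0r subr0 scaleNr mulNr.
Qed.

Let lambdaE : l = - eps ^+ p.-1.
Proof.
apply: (mulIf eps_neq0); rewrite mulNr -exprSr (prednK p_gt0).
by apply/eqP; rewrite -addr_eq0 addrC; apply/eqP; rewrite -f'_break.
Qed.

Let lambda_neq0 : l != 0.
Proof. by rewrite lambdaE oppr_eq0 expf_neq0. Qed.

(** The zeros of [X^p - eps^(p-1) X] are the prime-field multiples of [eps]. Subtracting the
    matching multiple of [dG s] brings [c] into the kernel of [f], hence into the coefficients of
    [A]. *)
Let f'ker c : Kbar c -> f' c = 0 -> exists2 a, a \in (A <*> <[s]>)%g & c = dG a.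
Proof.
move=> Hc; rewrite /f' lambdaE => E; have [Hs _] := break_coefP sG.
have Er : (f c / eps) ^+ p = f c / eps.
  rewrite exprMn exprVn -[in eps ^+ p](prednK p_gt0) exprS.
  have {1}-> : f c ^+ p = eps ^+ p.-1 * f c.
    by apply/eqP; rewrite -subr_eq0 -mulNr E.
  by field; rewrite eps_neq0 expf_neq0.
have [j Hj] := Fp_natr pK Er.
have fj (i : nat) : f (i%:R * dG s) = i%:R * eps.
  elim: i => [|i IH].
    rewrite !mul0r; apply: (@addIr _ (f 0)); rewrite -fD ?addr0 ?add0r //; exact: (Kbar_zero pK lf).
  rewrite mulrS !mulrDl !mul1r fD ?IH //; apply: (KbarM pK lf) => //; exact: (Kbar_nat pK lf).
have HK2 : Kbar (j%:R * dG s) by apply: (KbarM pK lf) => //; exact: (Kbar_nat pK lf).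
have [|a aA Ea] := fker (KbarB pK lf Hc HK2).
  have := fD (KbarB pK lf Hc HK2) HK2; rewrite subrK => E2.
  by apply: (@addIr _ (f (j%:R * dG s))); rewrite -E2 add0r fj -Hj divfK.
exists (a * s ^+ j)%g.
  by rewrite joinE //; rewrite -joinE // groupM ?groupX // mem_gen // inE ?aA ?cycle_id ?orbT.
have aG := fintype.subsetP AG a aA.
by rewrite (break_coefM aG (Gal_exp_in j sG)) (break_coefX j sG) -Ea subrK.
Qed.

(** Below the break [p n < n + (p - 1) b], so the Frobenius term dominates and the trace is
    negligible. *)
Let low' n c h : (0 < n < b)%N -> Kbar c -> ML n.+1%:Z (h - 1 - c%:A * piL ^+ n) ->
  ML (p * V * n).+1%:Z (normG (A <*> <[s]>)%g h - 1 - (c ^+ (p * V))%:A * w' ^+ n).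
Proof.
move=> nb Hc /(tw_low tA nb Hc) Hh; have /andP[n0 nb'] := nb; rewrite normG_join //.
have HcV : Kbar (c ^+ V) by apply: (KbarX pK lf).
have [r [-> Hr _]] := cnorm_lead n0 HcV (normG_fix h AG) Hh.
have -> : c ^+ (p * V) = (c ^+ V) ^+ p by rewrite mulnC exprM.
set e := c ^+ V in HcV *.
have -> : 1 + e%:A * ctrace s (w ^+ n) + (e ^+ p)%:A * w' ^+ n + r - 1 - (e ^+ p)%:A * w' ^+ n
  = e%:A * ctrace s (w ^+ n) + r by ring.
apply: (mpowD dvL).
  apply: (mpow0M dvL (KbarA_int HcV)).
  have := ctrace_mpow AG sG (tw_shift tA) (fixedbyX n Aw) (wX n).
  apply: mpow_le; have : (p * n < n + p.-1 * b)%N.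
    have [p' ->] : exists p', p = p'.+2 by exists p.-2; have := prime_gt1 p_pr; clear; lia.
    by clear -nb'; nia.
  by clear -V_gt0; nia.
have H1 : (p * n <= n + p.-1 * b)%N by clear -p_gt0 nb'; nia.
by apply: mpow_le (Hr _ (leqnn _) H1); clear; nia.
Qed.

Let high' n a : (b < n)%N -> Kbar a ->
  exists x, ML (p * V * n).+1%:Z (normG (A <*> <[s]>)%g x - 1 - a%:A * w' ^+ n).
Proof.
(* [psi] is the Herbrand function of the step: [psi + (p - 1) b = p n], so the trace term lands at
   the target level, and [c := a / l] gives it the coefficient [a]. *)
move=> bn Ha; pose psi := (b + p * (n - b))%N; pose c := a / l.
have Hc : Kbar c by apply: (KbarM pK lf) => //; apply: (KbarV pK lf).
have bpsi : (b < psi)%N by rewrite /psi; clear -bn p_gt0; nia.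
have [x Hx] := tw_high tA bpsi Hc; exists x; rewrite normG_join //.
have psi0 : (0 < psi)%N by exact: leq_ltn_trans bpsi.
have [r [-> _ Hr]] := cnorm_lead psi0 Hc (normG_fix x AG) Hx.
have m1 : (p * n <= psi + p.-1 * b)%N by rewrite /psi; clear -bn p_gt0; nia.
have m2 : (p * n < p * psi)%N.
  have := @ltn_Pmull (n - b) p (prime_gt1 p_pr); rewrite subn_gt0 => /(_ bn).
  by rewrite ltn_pmul2l // /psi; clear -bn; lia.
have {}Hr := Hr _ m1 m2.
have nE : n = ((n - b) + b)%N by rewrite subnK // ltnW.
(* Comparing [w ^+ psi] with [w ^+ b * w' ^+ (n - b)] reduces its trace to that of [w ^+ b], because
   [w'] is fixed by [s] and leaves the trace. *)
pose k := w ^+ psi - w ^+ b * w' ^+ (n - b).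
have Aw' : fixedby A w' by have [] := (fixedby_join AG sG sA w').1 (normG_fix _ (join_sub AG sG sA)).
have Ak : fixedby A k.
  by apply: fixedbyB; [exact: fixedbyX|apply: fixedbyM; exact: fixedbyX].
have Hk : ML (V * (psi + b))%N%:Z k.
  have -> : k = - (w ^+ b * (w' ^+ (n - b) - w ^+ (p * (n - b)))) by rewrite /k /psi exprD; ring.
  apply: (mpowN dvL); apply: mpow_le (mpowM dvL (wX b) (w'X_near (n - b))).
  by rewrite /psi; clear; nia.
have Hk2 := ctrace_mpow AG sG (tw_shift tA) Ak Hk.
have Epsi : ctrace s (w ^+ psi) = ctrace s (w ^+ b) * w' ^+ (n - b) + ctrace s k.
  rewrite -[w ^+ psi](subrK (w ^+ b * w' ^+ (n - b))) -/k ctraceD [w ^+ b * _]mulrC.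
  by rewrite ctraceM ?rmorphXn /= ?Tw'_fix // addrC [_ * ctrace _ _]mulrC.
have -> : 1 + c%:A * ctrace s (w ^+ psi) + (c ^+ p)%:A * w' ^+ psi + r - 1 - a%:A * w' ^+ n =
   c%:A * (ctrace s (w ^+ b) * w' ^+ (n - b) - l%:A * w' ^+ (n - b + b)) + c%:A * ctrace s k
   + ((c ^+ p)%:A * w' ^+ psi + r).
  have -> : a%:A = c%:A * l%:A :> L by rewrite mulr_algl scalerA divfK.
  by rewrite Epsi -nE; ring.
apply: (mpowD dvL); last by apply: mpow_le Hr; clear; nia.
apply: (mpowD dvL); apply: (mpow0M dvL (KbarA_int Hc)).
  by apply: mpow_le (lw'E _); clear -bn; nia.
by apply: mpow_le Hk2; rewrite /psi; clear -bn b_gt0 V_gt0 p_gt0; nia.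
Qed.

Let s_w_near m : ML (V * (m + b)).+1%:Z (s (w ^+ m) - w ^+ m - (m%:R * eps)%:A * w ^+ (m + b)).
Proof.
have [Hs Es] := break_coefP sG; have := fN Hs Es.
rewrite normGM normGV -normG_gal // -/eps => H.
pose u := s w / w - 1; rewrite -/u in H.
have swE : s w = (1 + u) * w by rewrite /u addrC subrK divfK.
have Hu : ML (V * b)%N%:Z u.
  apply: (mpowBl dvL (y := eps%:A * w ^+ b)); first by apply: mpow_le H; clear; lia.
  exact: (mpow0M dvL (KbarA_int epsK)).
have H1 n : ML (V * b).+1%:Z ((1 + u) ^+ n - 1 - (n%:R * eps)%:A * w ^+ b).
  elim: n => [|n IH]; first by rewrite expr0 subrr mul0r scale0r mul0r subrr; apply: mpow0.
  have -> : (1 + u) ^+ n.+1 - 1 - (n.+1%:R * eps)%:A * w ^+ b =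
    ((1 + u) ^+ n - 1 - (n%:R * eps)%:A * w ^+ b) + (u - eps%:A * w ^+ b) + u * ((1 + u) ^+ n - 1).
    by rewrite mulrS mulrDl mul1r scalerDl exprSr; ring.
  apply: (mpowD dvL); first exact: mpowD.
  have Hn : ML (V * b)%N%:Z ((1 + u) ^+ n - 1).
    apply: (mpowBl dvL (y := (n%:R * eps)%:A * w ^+ b)); first by apply: mpow_le IH; clear; lia.
    apply: (mpow0M dvL) => //; apply: KbarA_int; apply: (KbarM pK lf) => //; exact: (Kbar_nat pK lf).
  by apply: mpow_le (mpowM dvL Hu Hn); clear -b_gt0 V_gt0; nia.
rewrite rmorphXn /= swE exprMn.
have -> : (1 + u) ^+ m * w ^+ m - w ^+ m - (m%:R * eps)%:A * w ^+ (m + b) =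
   ((1 + u) ^+ m - 1 - (m%:R * eps)%:A * w ^+ b) * w ^+ m by rewrite exprD; ring.
by apply: mpow_le (mpowM dvL (H1 m) (wX m)); clear; nia.
Qed.

(** If [c w^i] is the leading term of [z], then [s z - z] has coefficient [c i eps] at level
    [i + b]. It is 0 as [s] fixes [z], while [i] and [eps] are nonzero in [K]. *)
Let gap1 z i : fixedby (A <*> <[s]>)%g z -> ~~ (p %| i)%N -> ML (V * i)%N%:Z z ->
  ML (V * i.+1)%N%:Z z.
Proof.
move=> /(fixedby_join AG sG sA) [Az sz] pi Hz; have [c Hc Hz1] := digitL vw Hz.
set z1 := z - _ in Hz1.
have Az1 : fixedby A z1.
  by apply: fixedbyB => //; apply: fixedbyM; [exact: fixedby_alg|exact: fixedbyX].
have Hz2 := gap Az1 Hz1.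
suff c_0 : c = 0 by move: Hz2; rewrite /z1 c_0 scale0r mul0r subr0.
have H1 := tw_shift tA sG Az1 Hz2.
have HK : Kbar (c * (i%:R * eps)).
  by do !apply: (KbarM pK lf) => //; exact: (Kbar_nat pK lf).
have : c * (i%:R * eps) = 0.
  apply: (@Kbar_coef_unique w V _ _ (i + b)) => //; first exact: (Kbar_zero pK lf).
  rewrite scale0r mul0r subr0.
  have -> : (c * (i%:R * eps))%:A * w ^+ (i + b) =
     - (c%:A * (s (w ^+ i) - w ^+ i - (i%:R * eps)%:A * w ^+ (i + b)) + (s z1 - z1)).
    rewrite /z1 rmorphB rmorphM /= sz Gal_alg //.
    have -> : (c * (i%:R * eps))%:A = c%:A * (i%:R * eps)%:A :> L by rewrite mulr_algl scalerA.
    by ring.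
  apply: (mpowN dvL); apply: (mpowD dvL).
    by apply: (mpow0M dvL (KbarA_int Hc)).
  by apply: mpow_le H1; clear -V_gt0; nia.
move/eqP; rewrite !mulf_eq0 (negPf eps_neq0) orbF -(dvdn_pcharf pK) (negPf pi) orbF.
by move/eqP.
Qed.

(** Between two consecutive multiples of [p] there are [p - 1] levels of the old field, each
    excluded by [gap1]. *)
Let gap' z m : fixedby (A <*> <[s]>)%g z -> ML (p * V * m).+1%:Z z -> ML (p * V * m.+1)%N%:Z z.
Proof.
move=> Az Hz; have [Az' _] := (fixedby_join AG sG sA z).1 Az.
have H1 : ML (V * (p * m).+1)%N%:Z z.
  by apply: gap => //; apply: mpow_le Hz; clear; nia.
suff H i : (i < p)%N -> ML (V * (p * m + i.+1))%N%:Z z.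
  have := H p.-1; rewrite (prednK p_gt0) => /(_ (leqnn _)); apply: mpow_le; clear; nia.
elim: i => [|i IH] ip; first by rewrite addn1.
rewrite addnS; apply: gap1 => //; last exact: IH (ltnW ip).
by rewrite dvdn_addr ?dvdn_mulr // gtnNdvd.
Qed.

Lemma tower_step_lambda : tower (A <*> <[s]>)%G (p * V)%N.
Proof.
have subA' := join_sub AG sG sA.
split=> //.
- move=> u z m uG; apply: (shift_of_uniformizer (w := w')) => //.
  + by rewrite muln_gt0 p_gt0.
  + exact: normG_fix.
  + have [Hu Eu] := break_coefP uG; have := f'N Hu Eu.
    rewrite normGM normGV -normG_gal //= => H.
    have -> : u w' - w' = (u w' / w' - 1) * w' by rewrite mulrBl divfK ?mul1r.
    have H2 : ML (p * V * b)%N%:Z (u w' / w' - 1).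
      apply: (mpowBl dvL (y := (f' (dG u))%:A * w' ^+ b)); first by apply: mpow_le H; clear; lia.
      apply: (mpow0M dvL (KbarA_int (f'K Hu))).
      by apply: mpow_le (mpowX dvL b (mpow_val vw')); clear; nia.
    by apply: mpow_le (mpowM dvL H2 (mpow_val vw')); clear; nia.
- by exists f'; split; [exact: f'D|exact: f'K|exact: f'ker|exact: f'N].
Qed.

End Lambda.

Lemma tower_step_f : tower (A <*> <[s]>)%G (p * V)%N.
Proof. by have [l lK lE] := trace_coef; apply: tower_step_lambda lE. Qed.

End TowerStep.

Lemma tower_step (A : {group gal_of {:L}}) (V : nat) s : tower A V -> s \in G -> s \notin A ->
  tower (A <*> <[s]>)%G (p * V)%N.
Proof.
move=> tA sG sA; have [f [fD fK fker fN]] := tw_break tA.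
exact: (tower_step_f tA sG sA fD fK fker fN).
Qed.

Lemma tower_Gal : tower [group of G] d.
Proof.
suff H n (A : {group gal_of {:L}}) V : (#|G| - #|A| <= n)%N -> tower A V -> tower [group of G] d.
  exact: H (leqnn _) tower1.
elim: n A V => [|n IH] A V Hn tA; have AG := tw_sub tA.
  have AE : A = [group of G] :> {group gal_of {:L}}.
    by apply/val_inj/eqP; rewrite /= eqEcard AG -subn_eq0 -leqn0.
  by rewrite -AE -card_Gal -[G]/(gval [group of G]) -AE (tw_card tA).
have [GA|/subsetPn [s sG sA]] := boolP (G \subset A).
  have AE : A = [group of G] :> {group gal_of {:L}} by apply/val_inj/eqP; rewrite finset.eqEsubset AG.
  by rewrite -AE -card_Gal -[G]/(gval [group of G]) -AE (tw_card tA).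
apply: (IH _ _ _ (tower_step tA sG sA)); rewrite /= (card_join AG sG sA).
have := cardG_gt0 A; move: Hn (prime_gt1 p_pr); rewrite (tw_card tA).
by move: #|G| => g; clear; nia.
Qed.

(** * The norm group and the filtration of the units of K *)

Variable t : K.
Hypothesis tN : t%:A = galNorm 1 {:L} piL.
Local Notation H := (norm_group L).

Lemma galNormE x : galNorm 1 {:L} x = normG G x.
Proof. by []. Qed.

Lemma fixedby_Gal z : fixedby G z -> exists a : K, z = a%:A.
Proof.
move=> Hz; have : z \in (1%AS : {vspace L}).
  have /galois_fixedField <- := galL.
  by apply/fixedFieldP; [exact: memvf|exact: Hz].
by move/vlineP => [a ->]; exists a.
Qed.

Lemma normG_K x : exists y : K, y%:A = normG G x.
Proof.
have [y ->] := fixedby_Gal (normG_fix (A := [group of G]) x (subxx _)); by exists y.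
Qed.

Lemma algI (x y : K) : x%:A = y%:A :> L -> x = y.
Proof. exact: (fmorph_inj (in_alg L)). Qed.

Lemma alg_eq0 (x : K) : (x%:A == 0 :> L) = (x == 0).
Proof. exact: (fmorph_eq0 (in_alg L)). Qed.

Lemma valt : vK t = 1%:E.
Proof.
have E : vL t%:A = d%:Z%:E by rewrite tN galNormE (normG_unif_val tower_Gal).
have t0 : t != 0 by apply/eqP => t0; move: E; rewrite t0 scale0r (val0 dvL).
have [n En] := val_fin dvK t0; move: E; rewrite (valA En) => -[] E.
by rewrite En; congr EFin; move: d_gt0 E; move: (p ^ nu)%N => D; clear; nia.
Qed.

Lemma norm_group_neq0 y : H y -> y != 0.
Proof. by case=> x x0 E; rewrite -alg_eq0 E galNormE normG_neq0. Qed.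

Lemma norm_group1 : H 1.
Proof.
exists 1; rewrite ?oner_neq0 // scale1r galNormE /normG big1 // => a _; exact: rmorph1.
Qed.

Lemma norm_groupM y z : H y -> H z -> H (y * z).
Proof.
move=> [x x0 E] [x' x0' E']; exists (x * x'); first by rewrite mulf_neq0.
by rewrite algM E E' !galNormE normGM.
Qed.

Lemma norm_group_approx x a n : (0 < n)%N -> Kbar a ->
  ML (d * n).+1%:Z (normG G x - 1 - a%:A * normG G piL ^+ n) ->
  exists2 y, H y & MK n.+1%:Z (y - 1 - a * t ^+ n).
Proof.
move=> n0 Ha Hx; have [y Ey] := normG_K x.
have HK : MK n.+1%:Z (y - 1 - a * t ^+ n).
  have E : normG G x - 1 - a%:A * normG G piL ^+ n = (y - 1 - a * t ^+ n)%:A.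
    rewrite -Ey -galNormE -tN !scalerBl scale1r algM; congr (_ - _ * _).
    by rewrite -[RHS]/(in_alg L (t ^+ n)) rmorphXn.
  by move: Hx; rewrite E => Hx; apply: mpowA_inv Hx _; move: d_gt0; move: (p ^ nu)%N => D; clear; nia.
exists y => //; exists x => //; apply/eqP => x0.
have y0 : y = 0.
  apply/algI; rewrite Ey x0 scale0r /normG; apply/eqP/prodf_eq0.
  by exists 1%g; rewrite ?group1 // rmorph0.
have H1 : MK 1 (y - 1).
  have Ht : MK n%:Z (t ^+ n) by apply: mpow_le (mpowX dvK n (mpow_val valt)); clear; lia.
  apply: (mpowBl dvK (y := a * t ^+ n)); first by apply: mpow_le HK; clear; lia.
  by apply: (mpow_le (r := n%:Z)); [clear -n0; lia|apply: (mpow0M dvK (Kbar_int pK lf Ha))].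
by have := val_neq0 dvK (unit1_val dvK H1); rewrite y0 eqxx.
Qed.

Lemma unit_step u y a n : (0 < n)%N -> Kbar a -> MK n.+1%:Z (u - 1 - a * t ^+ n) ->
  MK n.+1%:Z (y - 1 - a * t ^+ n) -> MK n.+1%:Z (u / y - 1).
Proof.
move=> n0 Ha Hu Hy.
have Ht : MK n%:Z (t ^+ n) by apply: mpow_le (mpowX dvK n (mpow_val valt)); clear; lia.
have Hy1 : MK 1 (y - 1).
  apply: (mpowBl dvK (y := a * t ^+ n)); first by apply: mpow_le Hy; clear; lia.
  by apply: (mpow_le (r := n%:Z)); [clear -n0; lia|apply: (mpow0M dvK (Kbar_int pK lf Ha))].
have E := unit1_val dvK Hy1; have y0 := val_neq0 dvK E.
have -> : u / y - 1 = ((u - 1 - a * t ^+ n) - (y - 1 - a * t ^+ n)) / y by field.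
by apply: (mpowM0 dvK); [exact: mpowB|exact: (mpow_val (valV dvK E))].
Qed.

Lemma unit_digit u n : MK n%:Z (u - 1) -> exists2 a, Kbar a & MK n.+1%:Z (u - 1 - a * t ^+ n).
Proof.
by move=> /(digit pK lf valt) [a Ha]; rewrite -exprnP => H1; exists a => //; apply: mpow_le H1; clear; lia.
Qed.

Lemma norm_group_low u n : (0 < n < b)%N -> MK n%:Z (u - 1) ->
  exists2 y, H y & MK n.+1%:Z (u / y - 1).
Proof.
move=> nb /unit_digit [a Ha Hu]; have /andP[n0 _] := nb.
(* The norm raises leading coefficients below the break to the power [p^nu], which is onto
   [Kbar]. *)
have [c Hc ca] := Kbar_root pK lf nu Ha.
have [|y Hy Hy1] := @norm_group_approx (1 + c%:A * piL ^+ n) a n n0 Ha.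
  rewrite -ca; apply: (tw_low tower_Gal nb Hc).
  have -> : 1 + c%:A * piL ^+ n - 1 - c%:A * piL ^+ n = 0 by ring.
  exact: mpow0.
by exists y => //; apply: unit_step Hu Hy1.
Qed.

Lemma norm_group_high u n : (b < n)%N -> MK n%:Z (u - 1) ->
  exists2 y, H y & MK n.+1%:Z (u / y - 1).
Proof.
move=> nb /unit_digit [a Ha Hu]; have n0 : (0 < n)%N by exact: leq_ltn_trans nb.
have [x Hx] := tw_high tower_Gal nb Ha.
have [y Hy Hy1] := norm_group_approx n0 Ha Hx.
by exists y => //; apply: unit_step Hu Hy1.
Qed.

Lemma norm_group_break : exists f : K -> K, [/\
    forall c c', Kbar c -> Kbar c' -> f (c + c') = f c + f c',
    forall c, Kbar c -> Kbar (f c),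
    forall c, Kbar c -> f c = 0 -> exists2 a, a \in G & c = dG a &
    forall c, Kbar c -> exists2 y, H y & MK b.+1%:Z (y - 1 - f c * t ^+ b)].
Proof.
have [f [fD fK fker fN]] := tw_break tower_Gal; exists f; split=> // c Hc.
apply: (@norm_group_approx (1 + c%:A * piL ^+ b)) => //; first exact: fK.
apply: fN => //; have -> : 1 + c%:A * piL ^+ b - 1 - c%:A * piL ^+ b = 0 by ring.
exact: mpow0.
Qed.

Lemma trace_surj : exists th : L, \sum_(s in G) s th != 0.
Proof.
have [|a _ Ha] := @gal_independent_contra _ _ {:L}%AS (mem G) (fun _ => 1) 1%g (group1 _).
  exact: oner_neq0.
by exists a; move: Ha; under eq_bigr => s _ do rewrite mul1r.
Qed.

(* The linear coefficient [e 1] is the trace of [th]. *)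
Lemma norm_poly : exists (n : nat) (e : nat -> K) (th : L), [/\ (1 < n)%N, e 0%N = 1, e 1%N != 0 &
  forall s : K, normG G (1 + s%:A * th) = (\sum_(i < n) e i * s ^+ i)%:A].
Proof.
have [th Hth] := trace_surj.
pose w (j : 'I_#|G|) := (enum_val j) th.
pose P : {poly L} := \prod_(j < #|G|) (1 + w j *: 'X).
have PG : P = \prod_(s in G) (1 + (s th) *: 'X) by rewrite (big_enum_val (fun s : gal_of {:L} => 1 + (s th) *: 'X)).
have P0 : P`_0 = 1.
  rewrite /P; elim: #|G| w {P PG} => [|m IH] w; first by rewrite big_ord0 coef1.
  by rewrite big_ord_recl mulrDl mul1r coefD -scalerAl coefZ coefXM IH mulr0 addr0.
have P1 : P`_1 != 0.
  have := newton_elementary w 0; rewrite /= -/P mulr1n big_ord_recl big_ord0 addr0 => ->.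
  rewrite expr0 mul1r subn0 P0 mulr1; under eq_bigr => j _ do rewrite expr1.
  by rewrite /w -(big_enum_val (fun s : gal_of {:L} => s th)).
have PK i : exists c : K, c%:A = P`_i.
  have [|c Hc] := @fixedby_Gal P`_i; last by exists c.
  move=> s sG; rewrite -coef_map; suff -> : map_poly s P = P by []; rewrite PG rmorph_prod.
  rewrite [RHS](reindex_inj (mulIg s)) /=; apply: eq_big => [u|u uG].
    by rewrite groupMr.
  by rewrite rmorphD rmorph1 /= map_polyZ map_polyX /= GalM.
have [e He] := choice PK.
exists (maxn (size P) 2), e, th; split.
- by rewrite leq_maxr.
- by apply: algI; rewrite He P0 scale1r.
- by rewrite -alg_eq0 He.
move=> s; rewrite scaler_suml.
have -> : normG G (1 + s%:A * th) = P.[s%:A].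
  rewrite PG horner_prod /normG; apply: eq_bigr => u uG.
  by rewrite hornerD hornerC hornerZ hornerX rmorphD rmorph1 rmorphM /= Gal_alg // mulrC.
rewrite (horner_coef_wide _ (leq_maxl (size P) 2)); apply: eq_bigr => i _.
rewrite algM He; congr (_ * _); by rewrite -[RHS]/(in_alg L (s ^+ i)) rmorphXn.
Qed.

(** The norm of [1 + s th] is a polynomial in [s] whose linear coefficient, the trace of [th], is
    nonzero, so the contraction principle in [K] reaches every unit close to 1. This ends the
    level-by-level recursion above the break, where [tw_high] only gives approximations. *)
Lemma norm_group_open : exists N : nat, forall u, MK N%:Z (u - 1) -> H u.
Proof.
have [n [e [th [n1 e0 e1 He]]]] := norm_poly.
pose g i := e i / e 1%N.
(* [C] bounds the denominators of the normalised coefficients; on M^(C+1) the terms of degree at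
   least 2 are then contracting. *)
have [C HC] : exists C : nat, forall i, (i < n)%N -> MK (- C%:Z) (g i).
  elim: n {n1 He} => [|n [C HC]]; first by exists 0%N.
  have [C' HC'] : exists C' : nat, MK (- C'%:Z) (g n).
    have [->|/(val_fin dvK) [m Em]] := eqVneq (g n) 0; first by exists 0%N; apply: mpow0.
    by exists `|m|%N; apply/(mpowE _ Em); clear; lia.
  exists (maxn C C') => i; rewrite ltnS leq_eqVlt => /orP[/eqP ->|/HC].
    by apply: mpow_le HC'; clear; lia.
  by apply: mpow_le; clear; lia.
pose F s := (\sum_(i < n) e i * s ^+ i - 1) / e 1%N.
have FE s : F s = s + \sum_(2 <= i < n) g i * s ^+ i.
  rewrite /F -(big_mkord xpredT (fun i => e i * s ^+ i)) big_ltn ?(ltnW n1) // big_ltn //.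
  rewrite e0 expr0 expr1 mulr1 addrAC subrr add0r mulrDl mulrAC divff // mul1r.
  by rewrite mulr_suml; congr (_ + _); apply: eq_bigr => i _; rewrite /g mulrAC.
have F0 : F 0 = 0.
  rewrite FE add0r big_nat_cond big1 // => i /andP[/andP[i2 _] _].
  by rewrite expr0n; case: i i2 => // i _; rewrite mulr0.
have contr (r : int) s s' : C.+1%:Z <= r -> MK C.+1%:Z s -> MK C.+1%:Z s' -> MK r (s - s') ->
     MK (r + 1) (F s - F s' - (s - s')).
  move=> Cr Hs Hs' Hss; rewrite !FE.
  have -> : s + \sum_(2 <= i < n) g i * s ^+ i - (s' + \sum_(2 <= i < n) g i * s' ^+ i) - (s - s')
    = \sum_(2 <= i < n) (g i * s ^+ i - g i * s' ^+ i).
    by rewrite sumrB; ring.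
  rewrite big_nat_cond; apply: (mpow_sum dvK) => i /andP[/andP[i2 ip] _]; rewrite -mulrBr.
  have Hss' : MK (C.+1%:Z + (r - C.+1%:Z)) (s - s') by apply: mpow_le Hss; clear; lia.
  have := mpowM dvK (HC i ip) (mpow_subX dvK i Hs Hs' Hss').
  apply: mpow_le; clear -i2 Cr; nia.
have [m Em] := val_fin dvK e1.
(* The summand with [m] pays for the division of [u - 1] by [e 1]. *)
exists (C.+1 + `|m|)%N => u Hu.
have Hw : MK C.+1%:Z ((u - 1) / e 1%N).
  apply: mpow_le (mpowM dvK Hu (mpow_val (valV dvK Em))); clear; lia.
have [s _ Fs] := contraction_surj dvK (local_complete lf) F0 contr (lexx _) Hw.
have Es : \sum_(i < n) e i * s ^+ i = u.
  have : F s * e 1%N = u - 1 by rewrite Fs divfK.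
  by rewrite /F divfK // => /addIr.
exists (1 + s%:A * th); last by rewrite galNormE He Es.
apply/eqP => E0; have u0 : u = 0.
  apply: algI; rewrite -Es -He E0 scale0r /normG; apply/eqP/prodf_eq0.
  by exists 1%g; rewrite ?group1 // rmorph0.
have U1 : MK 1 (u - 1) by apply: mpow_le Hu; clear; lia.
by have := val_neq0 dvK (unit1_val dvK U1); rewrite u0 eqxx.
Qed.

(** Divide by norms one level at a time, starting above the break, until the open neighbourhood of 1
    is reached. *)
Lemma norm_group_top u : MK b.+1%:Z (u - 1) -> H u.
Proof.
have [N HN] := norm_group_open.
suff W k n v : (b < n)%N -> (N <= n + k)%N -> MK n%:Z (v - 1) -> H v.
  by apply: (W N b.+1); rewrite // leq_addl.
elim: k n v => [|k IH] n v bn Nn Hv.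
  by apply: HN; apply: mpow_le Hv; clear -Nn; lia.
have [y Hy Hvy] := norm_group_high bn Hv.
have Hvy' : H (v / y) by apply: (IH n.+1) => //; [exact: ltnW|rewrite addSnnS].
by rewrite -(divfK (norm_group_neq0 Hy) v); apply: norm_groupM.
Qed.

Lemma norm_group_reduce u : MK 1 (u - 1) -> exists2 y, H y & MK b%:Z (u / y - 1).
Proof.
suff W k n v : (0 < n)%N -> (b <= n + k)%N -> MK n%:Z (v - 1) -> exists2 y, H y & MK b%:Z (v / y - 1).
  by apply: (W b 1%N); rewrite // leq_addl.
elim: k n v => [|k IH] n v n0 bn Hv.
  exists 1; [exact: norm_group1|rewrite divr1]; apply: mpow_le Hv; clear -bn; lia.
have [nb|nb] := ltnP n b; last first.
  exists 1; [exact: norm_group1|rewrite divr1]; apply: mpow_le Hv; clear -nb; lia.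
have nb' : (0 < n < b)%N by rewrite n0.
have [y Hy Hvy] := norm_group_low nb' Hv.
have [||y' Hy' Hv'] := IH n.+1 (v / y) _ _ Hvy => //; first by rewrite addSnnS.
exists (y * y'); first exact: norm_groupM.
by rewrite invfM mulrA.
Qed.

Local Notation ctc := (ctc vK kK t).
Local Notation pairing := (@pairing p K vK kK res t pK lf).

(** A monic common factor [g] of degree [m + 1 < r] has a companion matrix [C] with [C^r = a].
    Taking determinants makes [a^(m+1)] an [r]-th power, and Bezout makes [a] one. *)
Lemma coprime_Xp_sub (F : fieldType) (r : nat) (a : F) (P : {poly F}) : prime r ->
  (forall x, x ^+ r <> a) -> P != 0 -> (size P <= r)%N -> coprimep P ('X^r - a%:P).
Proof.
move=> r_pr na P0 szP; have r0 := prime_gt0 r_pr.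
have a0 : a != 0 by apply/eqP => a0; apply: (na 0); rewrite a0 expr0n eqn0Ngt r0.
apply/negPn/negP => ncop; pose g0 := gcdp P ('X^r - a%:P).
have g00 : g0 != 0 by rewrite gcdp_eq0 (negPf P0).
pose g := (lead_coef g0)^-1 *: g0.
have lc0 : lead_coef g0 != 0 by rewrite lead_coef_eq0.
have gm : g \is monic by rewrite monicE lead_coefZ mulVf.
have szg : size g = size g0 by rewrite size_scale ?invr_eq0.
have gd : g %| 'X^r - a%:P by rewrite dvdpZl ?invr_eq0 // dvdp_gcdr.
have szg1 : (1 < size g)%N.
  by rewrite szg ltn_neqAle size_poly_gt0 g00 andbT eq_sym -/(coprimep _ _).
have szgr : (size g <= r)%N by rewrite szg (leq_trans _ szP) // dvdp_leq ?dvdp_gcdl.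
case Em : (size g).-1 => [|m]; first by move: szg1 Em; clear; case: (size g) => [|[]].
pose C : 'M[F]_m.+1 := castmx (Em, Em) (companionmx g).
have chC : char_poly C = g.
  have cE n n' (e : n = n') (D : 'M[F]_n) : char_poly (castmx (e, e) D) = char_poly D.
    by case: n' / e; rewrite castmx_id.
  by rewrite /C cE companionmxK.
have CH : horner_mx C g = 0 by rewrite -[g in horner_mx _ g]chC; apply: Cayley_Hamilton.
have Cr : C ^+ r = a%:M.
  have [h Eh] := dvdpP _ _ gd.
  have := congr1 (horner_mx C) Eh; rewrite rmorphM /= CH mulr0 rmorphB rmorphXn /=.
  by rewrite horner_mx_X horner_mx_C => /eqP; rewrite subr_eq0 => /eqP.
have detE : (\det C) ^+ r = a ^+ m.+1.
  have := congr1 determinant Cr; rewrite det_scalar => <-; elim: (r) => [|i IH]; first by rewrite !expr0 det1.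
  by rewrite !exprS IH -det_mulmx.
have mr : (m.+1 < r)%N by rewrite -Em prednK // ltnW.
have [u v Huv _] := egcdnP r (ltn0Sn m).
have cop : gcdn m.+1 r = 1%N.
  by apply/eqP; rewrite -/(coprime _ _) coprime_sym prime_coprime // gtnNdvd.
apply: (na ((\det C) ^+ u / a ^+ v)).
rewrite exprMn exprVn -exprM mulnC exprM detE -!exprM [(m.+1 * u)%N]mulnC Huv cop.
by rewrite exprD expr1 mulrAC divff ?mul1r // expf_neq0.
Qed.

(** * Orthogonality of norms and Artin-Schreier elements *)

Section Orthogonal.
Variables (x y : L) (alpha beta : K).
Hypotheses (x0 : x != 0) (yE : y ^+ p - y = beta%:A) (aE : alpha%:A = normG G x).
Hypothesis not_power : forall a, a ^+ p <> alpha.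

Section Shift.
Variable s : gal_of {:L}.
Hypotheses (sG : s \in G) (sy : s y = y + 1).

Local Notation U := <<1; y>>%AS.
Local Notation C := ('Gal({:L} / U))%g.

Let CG : C \subset G. Proof. exact: galS (sub1v _). Qed.
Let galU : galois U {:L}. Proof. by apply: galoisS galL; rewrite sub1v subvf. Qed.
Let Cy a : a \in C -> a y = y.
Proof. by move=> aC; apply: (fixed_gal (subvf U) aC); apply: memv_adjoin. Qed.
Let fixC z : fixedby C z -> z \in U.
Proof.
move=> Hz; have /galois_fixedField <- := galU.
by apply/fixedFieldP; [exact: memvf|exact: Hz].
Qed.
Let sC : s \notin C.
Proof.
apply/negP => /Cy; rewrite sy => /eqP; rewrite -subr_eq0 addrAC subrr add0r.
by rewrite oner_eq0.
Qed.

Let dimU : (\dim U <= p)%N.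
Proof.
rewrite dim_Fadjoin dimv1 muln1 -ltnS -size_minPoly.
pose P : {poly L} := 'X^p - 'X - (beta%:A)%:P.
have szP : size P = p.+1.
  rewrite /P -addrA -opprD size_polyDl size_polyXn // size_polyN.
  by rewrite size_XaddC ltnS prime_gt1.
have P0 : P != 0 by rewrite -size_poly_eq0 szP.
rewrite -szP dvdp_leq // minPoly_dvdp //.
  rewrite /P !rpredB ?rpredX ?polyOverX // polyOverC; apply/vlineP; by exists beta.
by rewrite rootE /P !hornerD !hornerN hornerXn hornerX hornerC yE subrr.
Qed.

(** By orders: [K(y)] has degree at most [p], so its Galois subgroup [C] has index at most [p],
    while adjoining [s] multiplies the order of [C] by [p]. *)
Let joinC : (('Gal({:L} / U))%G <*> <[s]>)%g = G.
Proof.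
apply/eqP; rewrite eqEcard join_sub //= card_join //.
have := galois_dim galU; have := galois_dim galL; rewrite dimv1 divn1 => <- E.
have := field_dimS (subvf U); rewrite -E => /divnK {1}<-.
by rewrite mulnC leq_mul2r dimU orbT.
Qed.

Let w := normG C x.
Let w0 : w != 0. Proof. exact: normG_neq0. Qed.
Let aw : alpha%:A = cnorm s w.
Proof. by rewrite aE -[in LHS]joinC normG_join. Qed.

Let S : 'End(L) := s.
Let X : 'End(L) := S * amull w.
Let Y : 'End(L) := amull y.
Let XE z : X z = w * s z. Proof. by rewrite lfun_mulE lfunE. Qed.
Let YE z : Y z = y * z. Proof. by rewrite lfunE. Qed.

Let YX : Y * X = X * Y + X.
Proof.
apply/lfunP => z; rewrite add_lfunE (lfun_mulE Y X) (lfun_mulE X Y) !XE !YE rmorphM /= sy; ring.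
Qed.

Let Xn n z : (X ^+ n) z = \prod_(j < n) (s ^+ j)%g w * (s ^+ n)%g z.
Proof.
elim: n z => [|n IH] z; first by rewrite expr0 id_lfunE big_ord0 mul1r expg0 gal_id.
rewrite exprSr lfun_mulE IH XE rmorphM rmorph_prod /= big_ord_recl expg0 gal_id -mulrA.
congr (_ * (_ * _)).
  by apply: eq_bigr => j _; rewrite -GalM -expgSr.
by rewrite -GalM -expgSr.
Qed.

Let Xp : X ^+ p = alpha *: 1.
Proof.
apply/lfunP => z; rewrite Xn Gal_exp // gal_id scale_lfunE id_lfunE -mulr_algl aw.
by [].
Qed.

Let hX (P : {poly K}) : 'End(L) := horner_alg X P.

(** Apply a Bezout relation between [P] and [X^p - alpha] to the vector 1: if [P] killed it, both
    summands would vanish, since [X^p - alpha] acts as 0. *)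
Let h_eq0 (P : {poly K}) : P != 0 -> (size P <= p)%N -> hX P 1 <> 0.
Proof.
move=> P0 szP H0; have cop := coprime_Xp_sub p_pr not_power P0 szP.
have [[u v] /= Euv] := Bezout_eq1_coprimepP _ _ cop.
have := congr1 (fun Q => hX Q 1) Euv; rewrite /hX rmorphD rmorph1 /= add_lfunE id_lfunE.
rewrite [u * P]mulrC [v * _]mulrC !rmorphM /= !lfun_mulE -/(hX P) H0.
rewrite rmorphB rmorphXn /= horner_algX horner_algC Xp subrr lfunE /= !linear0 addr0.
by move/eqP; rewrite eq_sym oner_eq0.
Qed.

(** The vectors [(X ^+ i) 1] are products of conjugates of [w], so they lie in [K(y)]; being [p]
    independent vectors there, they form a basis. *)
Let z_exists : exists z : 'I_p -> K, y = \sum_i z i *: (X ^+ i) 1.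
Proof.
pose E := [tuple (X ^+ (i : nat)) 1 | i < p].
have EE (i : 'I_p) : E`_i = (X ^+ i) 1 by rewrite -tnth_nth tnth_mktuple.
have wfix j : fixedby C ((s ^+ j)%g w).
  by apply: fixedby_gal => //; [exact: Gal_exp_in|exact: (normG_fix (A := [group of C]))].
have EU : {subset E <= U}.
  move=> e /tnthP [i ->]; rewrite tnth_mktuple Xn rmorph1 mulr1; apply: rpred_prod => j _.
  exact: fixC.
have frE : free E.
  apply/freeP => k; under eq_bigr => i _ do rewrite EE.
  pose P : {poly K} := \poly_(i < p) (if insub i is Some j then k j else 0).
  have Pk (i : 'I_p) : P`_i = k i by rewrite coef_poly ltn_ord valK.
  move=> H; have hP : hX P 1 = 0.
    rewrite -H /hX /P poly_def rmorph_sum /= sum_lfunE; apply: eq_bigr => i _.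
    rewrite -mul_polyC rmorphM /= horner_algC rmorphXn /= horner_algX.
    by rewrite -scalerAl mul1r scale_lfunE valK.
  have [P0|P0] := eqVneq P 0; first by move=> i; rewrite -Pk P0 coef0.
  by case: (h_eq0 P0 _ hP); apply: size_poly.
have bE : basis_of U E.
  rewrite basisEfree frE size_tuple dimU andbT /=; apply/span_subvP; exact: EU.
exists (fun i => coord E i y); rewrite [LHS](coord_basis bE (memv_adjoin _ _)).
by apply: eq_bigr => i _; rewrite EE.
Qed.

(* The operators [X = w s] and [Y = y] satisfy [Y X = X (Y + 1)], where the product of
   ['End(L)] composes from left to right; as [Y] agrees
   with [Z], a polynomial in [X], at 1, Hochschild's formula for
   [Y = (Y - Z) + Z] evaluates [y^p - y]. *)
Lemma hochschild_norm : exists z : nat -> K,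
  beta = \sum_(i < p) z i ^+ p * alpha ^+ i - z 0%N.
Proof.
have [z0 yz] := z_exists; pose z i := if insub i is Some j then z0 j else 0.
have zE (i : 'I_p) : z i = z0 i by rewrite /z valK.
exists z; pose P : {poly K} := \poly_(i < p) z i; pose Z := hX P.
have ZE : Z = \sum_(i < p) z i *: X ^+ i.
  rewrite /Z /hX /P poly_def rmorph_sum /=; apply: eq_bigr => i _.
  by rewrite -mul_polyC rmorphM /= horner_algC rmorphXn /= horner_algX -scalerAl mul1r.
have Z1 : Z 1 = y.
  rewrite ZE sum_lfunE yz; apply: eq_bigr => i _; by rewrite scale_lfunE zE.
have ZX : Z * X = X * Z.
  have XX : X = hX 'X by rewrite /hX horner_algX.
  by rewrite {1 2}XX /Z /hX -!rmorphM mulrC.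
(* [Z] commutes with [X], so [ad (Y - Z)] acts on powers of [X] as [ad Y] does, as a derivation with
   eigenvalue [i] on [X ^+ i]. *)
have adXi i : (Y - Z) * X ^+ i - X ^+ i * (Y - Z) = i%:R *: X ^+ i.
  elim: i => [|i IH]; first by rewrite expr0 mulr1 mul1r subrr scale0r.
  have E1 : (Y - Z) * X = X * (Y - Z) + X.
    by rewrite mulrBl mulrBr YX ZX addrAC.
  have -> : (Y - Z) * X ^+ i.+1 = X * ((Y - Z) * X ^+ i) + X ^+ i.+1.
    by rewrite exprS mulrA E1 mulrDl mulrA.
  have -> : (Y - Z) * X ^+ i = i%:R *: X ^+ i + X ^+ i * (Y - Z) by rewrite -IH subrK.
  rewrite mulrDr -scalerAr -exprS mulrA -exprS addrAC addrK -[X in _ + X = _]scale1r -scalerDl.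
  by rewrite -mulrSr.
have adn n : iter n (ad (Y - Z)) Z = \sum_(i < p) (z i * i%:R ^+ n) *: X ^+ i.
  elim: n => [|n IH]; first by rewrite ZE; apply: eq_bigr => i _; rewrite expr0 mulr1.
  rewrite iterS IH /ad mulr_sumr mulr_suml -sumrB; apply: eq_bigr => i _.
  by rewrite -scalerAr -scalerAl -scalerBr adXi scalerA exprSr mulrA.
have cZ n : GRing.comm Z (iter n (ad (Y - Z)) Z).
  rewrite adn; apply: commr_sum => i _; rewrite /GRing.comm -scalerAl -scalerAr; congr (_ *: _).
  by apply: commrX.
have := hochschild pchar_End cZ; rewrite subrK => HH.
(* [Y - Z] is applied to 1 first, and kills it because [Z 1 = y = Y 1]. *)
have D1 : ((Y - Z) ^+ p) 1 = 0.
  rewrite -(prednK p_gt0) exprS lfun_mulE add_lfunE opp_lfunE YE mulr1 Z1 subrr.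
  by rewrite linear0.
have Zp : Z ^+ p = \sum_(i < p) (z i ^+ p * alpha ^+ i) *: 1.
  (* The [p]-th power is expanded in the commutative ring [{poly K}], before [X] is substituted. *)
  have Pp : P ^+ p = \sum_(i < p) (z i ^+ p) *: ('X^p) ^+ i.
    have pP : p \in [pchar {poly K}] by rewrite pchar_poly.
    rewrite /P poly_def; have E : forall m, (\sum_(i < m) z i *: 'X^i : {poly K}) ^+ p = \sum_(i < m) (z i ^+ p) *: ('X^p) ^+ i.
      elim=> [|m IH]; first by rewrite !big_ord0 expr0n eqn0Ngt p_gt0.
      rewrite !big_ord_recr /= -IH -(pFrobenius_autE pP) rmorphD /= !pFrobenius_autE.
      by rewrite exprZn -!exprM mulnC.
    exact: E.
  rewrite /Z /hX -rmorphXn Pp rmorph_sum; apply: eq_bigr => i _ /=.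
  rewrite -mul_polyC rmorphM /= horner_algC !rmorphXn /= horner_algX Xp exprZn expr1n.
  by rewrite -scalerAl mul1r scalerA.
have Yp : (Y ^+ p) 1 = y ^+ p.
  elim: p => [|n IH]; first by rewrite !expr0 id_lfunE.
  by rewrite exprSr lfun_mulE IH YE exprS.
(* By Fermat [i^(p-1)] is 1 except for [i = 0], where it is 0; only the constant term of [Z] is
   lost. *)
have ad1 : iter p.-1 (ad (Y - Z)) Z = Z - z 0%N *: 1.
  have p1 : (0 < p.-1)%N by have := prime_gt1 p_pr; clear; lia.
  rewrite adn ZE -(big_mkord xpredT (fun i => (z i * i%:R ^+ p.-1) *: X ^+ i)).
  rewrite -(big_mkord xpredT (fun i => z i *: X ^+ i)) !(big_ltn p_gt0) expr0.
  rewrite expr0n eqn0Ngt p1 mulr0 scale0r add0r addrAC subrr add0r !big_nat.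
  apply: eq_bigr => i /andP[i0 ip]; congr (_ *: _).
  have iK : i%:R != 0 :> K by rewrite -(dvdn_pcharf pK) gtnNdvd.
  suff -> : i%:R ^+ p.-1 = 1 :> K by rewrite mulr1.
  by apply: (mulIf iK); rewrite -exprSr (prednK p_gt0) (natr_frob pK) mul1r.
apply: algI; rewrite -yE -Yp HH add_lfunE add_lfunE D1 add0r ad1 Zp sum_lfunE.
have -> : (Z - z 0%N *: 1) 1 = y - (z 0%N)%:A by rewrite add_lfunE opp_lfunE scale_lfunE id_lfunE Z1.
rewrite addrA addrAC addrK.
rewrite [RHS]scalerBl scaler_suml; congr (_ - _); apply: eq_bigr => i _.
by rewrite scale_lfunE id_lfunE.
Qed.

End Shift.

(** The displacement [e] of [y] is a root of [X^p - X], hence in the prime field; the power of [s]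
    with exponent [e^-1] displaces [y] by 1. *)
Lemma shift_exists : (forall s, s \in G -> s y = y) \/ exists2 s, s \in G & s y = y + 1.
Proof.
have [[s [sG sy]]|none] := pselect (exists s, s \in G /\ s y <> y); last first.
  by left=> s sG; have [//|H] := pselect (s y = y); case: none; exists s.
right; pose e := s y - y.
have e0 : e != 0 by rewrite subr_eq0; apply/eqP.
have ep : e ^+ p = e.
  rewrite /e (frobB1 pL) -rmorphXn /=; apply/eqP; rewrite -subr_eq0; apply/eqP.
  have := congr1 s yE; rewrite rmorphB /= Gal_alg // -yE => E.
  have -> : s (y ^+ p) - y ^+ p - (s y - y) = (s (y ^+ p) - s y) - (y ^+ p - y) by ring.
  by rewrite E subrr.
have [m Em] : exists m : nat, e^-1 = m%:R.
  by apply: (Fp_natr pL); rewrite exprVn ep.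
have es : s e = e.
  have [m' ->] := Fp_natr pL ep; exact: rmorph_nat.
exists (s ^+ m)%g; first exact: Gal_exp_in.
have H j : (s ^+ j)%g y = y + j%:R * e.
  elim: j => [|j IH]; first by rewrite gal_id mul0r addr0.
  rewrite expgSr GalM IH rmorphD rmorphM rmorph_nat /= es mulrS mulrDl mul1r.
  by rewrite /e; ring.
by rewrite H -Em mulVf.
Qed.

End Orthogonal.

(** In the main case Hochschild's formula writes [beta] as [wp p (z 0)] plus terms [z_i^p alpha^i]
    with [0 < i < p], whose product with [dlog alpha] is exact. If [y] is Galois-fixed, [beta] is
    itself a value of [wp]. *)
Lemma norm_orthogonal (alpha : K) (y : L) (beta : K) : H alpha -> y ^+ p - y = beta%:A -> pairing alpha beta = 0.
Proof.
move=> Ha yE; have a0 := norm_group_neq0 Ha; case: Ha => x x0 aE.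
have [[a ap]|np] := pselect (exists a, a ^+ p = alpha).
  by rewrite -ap; apply: (pairing_frob pK lf valt).
have {}np a : a ^+ p <> alpha by move=> E; apply: np; exists a.
have [fixy|[s sG sy]] := shift_exists x0 yE aE np.
  have [z yz] := fixedby_Gal fixy.
  have -> : beta = wp p z.
    apply: algI; rewrite -yE yz /wp scalerBl; congr (_ - _).
    by rewrite -[RHS]/(in_alg L (z ^+ p)) rmorphXn.
  exact: (pairing_wp pK lf valt).
have [z ->] := hochschild_norm x0 yE aE np sG sy.
have -> : \sum_(i < p) z i ^+ p * alpha ^+ i - z 0%N =
    wp p (z 0%N) + \sum_(1 <= i < p) z i ^+ p * alpha ^+ i.
  rewrite -(big_mkord xpredT (fun i => z i ^+ p * alpha ^+ i)) big_ltn // expr0 mulr1 /wp.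
  by rewrite addrAC.
rewrite (pairingDr pK lf valt) (pairing_wp pK lf valt) // add0r /pairing mulr_suml.
rewrite (ctc_sum pK lf valt) big_nat big1 ?(tr0 pK lf valt) // => i ip.
exact: (ctc_dlogX pK lf valt).
Qed.

(** * Duality between the norm group and B_0 *)

Lemma AS_setP beta : AS_set p L beta <-> exists y : L, y ^+ p - y = beta%:A.
Proof.
pose P : {poly L} := 'X^p - 'X - (beta%:A)%:P.
have szP : size P = p.+1.
  rewrite /P -addrA -opprD size_polyDl size_polyXn // size_polyN.
  by rewrite size_XaddC ltnS prime_gt1.
have PE y : P.[y] = y ^+ p - y - beta%:A.
  by rewrite /P !hornerD !hornerN hornerXn hornerX hornerC.
split=> [[rs Prs]|[y yE]].
  case: rs Prs => [|y rs] Prs.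
    by move: szP; rewrite /P Prs big_nil size_poly1 => -[] p0; move: p_gt0; rewrite -p0.
  exists y; apply/eqP; rewrite -subr_eq0 -PE /P Prs big_cons hornerM.
  by rewrite hornerD hornerN hornerX hornerC subrr mul0r.
pose rs := [seq y + i%:R | i <- iota 0 p]; exists rs.
have lcP : lead_coef P = 1.
  by rewrite lead_coefE szP /= /P !coefB coefXn eqxx coefX coefC !gtn_eqF ?prime_gt1 ?p_gt0 // !subr0.
rewrite -/P [LHS](@all_roots_prod_XsubC _ P rs) ?lcP ?scale1r //.
- by rewrite szP size_map size_iota.
- apply/allP => z /mapP [i _ ->]; rewrite rootE PE (frobD1 pL) (natr_frob pL).
  have -> : y ^+ p + i%:R - (y + i%:R) - beta%:A = y ^+ p - y - beta%:A by ring.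
  by rewrite yE subrr.
- rewrite uniq_rootsE map_inj_in_uniq ?iota_uniq // => i j; rewrite !mem_iota !add0n /= => ip jp.
  move/addrI; wlog ij : i j ip jp / (i <= j)%N.
    by move=> W E; case/orP: (leq_total i j) => ij; [exact: W|apply/esym/W].
  move=> E; apply/eqP; rewrite eqn_leq ij /= -subn_eq0; apply/eqP.
  have : (p %| j - i)%N by rewrite (dvdn_pcharf pL) natrB // E subrr.
  by move/dvdn_leq; case: (j - i)%N (leq_subr i j) => // k; lia.
Qed.

Local Notation tr := (Ktrace pK lf).

Lemma wpD x y : wp p (x + y) = wp p x + wp p y :> K.
Proof. by rewrite /wp (frobD1 pK) opprD addrACA. Qed.

(** On M_K the map [s - s^p] is a contraction away from the identity, hence onto. *)
Lemma mpow1_wp w : MK 1 w -> exists2 z, MK 1 z & w = wp p z.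
Proof.
move=> Hw; pose F (s : K) := s - s ^+ p.
have F0 : F 0 = 0 by rewrite /F expr0n eqn0Ngt p_gt0 subrr.
have contr (r : int) s s' : 1%N%:Z <= r -> MK 1%N s -> MK 1%N s' -> MK r (s - s') ->
     MK (r + 1) (F s - F s' - (s - s')).
  move=> r1 _ _ Hs; have -> : F s - F s' - (s - s') = - (s - s') ^+ p.
    by rewrite /F (frobB1 pK); ring.
  apply: (mpowN dvK); apply: mpow_le (mpowX dvK p Hs).
  by have := prime_gt1 p_pr; clear -r1; nia.
have [s Hs Fs] := contraction_surj dvK (local_complete lf) F0 contr (lexx _) (mpowN dvK Hw).
by exists s => //; rewrite /wp -[w]opprK -Fs /F opprB.
Qed.

(** * The spaces K_0 and B_0 and their pole orders *)

Variable Kbar0 : set K.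
Hypothesis acK : additive_complement Kbar (wp p @` Kbar)%classic Kbar0.
Local Notation K0 := (K_0 p Kbar Kbar0 t).
Local Notation B0 := (B_0 p L Kbar Kbar0 t).

Let Kbar0_sub c : Kbar0 c -> Kbar c. Proof. by case: acK => H _ _ _ _; apply: H. Qed.
Let Kbar00 : Kbar0 0. Proof. by case: acK. Qed.
Let Kbar0B c c' : Kbar0 c -> Kbar0 c' -> Kbar0 (c - c'). Proof. by case: acK => _ _ H _ _; apply: H. Qed.
Let Kbar0D c c' : Kbar0 c -> Kbar0 c' -> Kbar0 (c + c').
Proof. by move=> Hc Hc'; rewrite -[c']opprK; apply: Kbar0B => //; rewrite -sub0r; apply: Kbar0B. Qed.

Let t0 : t != 0 := val_neq0 dvK valt.

Lemma texpN i : t ^- i = t ^ (- i%:Z). Proof. by rewrite exprnN. Qed.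

Lemma K_0_add x y : K0 x -> K0 y -> K0 (x + y).
Proof.
move=> [s [a [a0 aK ap ->]]] [s' [a' [a0' aK' ap' ->]]].
pose z m (a : nat -> K) i := if (i < m)%N then a i else 0.
have zE n (u : nat -> K) n' : (n <= n')%N ->
    \sum_(i < n) u i * t ^- i = \sum_(i < n') z n u i * t ^- i.
  move=> nn'; rewrite (big_ord_widen _ (fun i => u i * t ^- i) nn').
  by rewrite big_mkcond; apply: eq_bigr => i _; rewrite /z; case: ifP; rewrite ?mul0r.
exists (maxn s s'), (fun i => z s.+1 a i + z s'.+1 a' i); split.
- by rewrite /z /=; apply: Kbar0D.
- by move=> i i1; rewrite /z; apply: (KbarD pK lf); case: ifP => _; [exact: aK|exact: (Kbar_zero pK lf)|exact: aK'|exact: (Kbar_zero pK lf)].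
- by move=> i i1; rewrite /z !ap ?ap' // !if_same addr0.
rewrite (zE _ _ (maxn s s').+1) ?ltnS ?leq_maxl // (zE _ a' (maxn s s').+1) ?ltnS ?leq_maxr //.
by rewrite -big_split; apply: eq_bigr => i _; rewrite mulrDl.
Qed.

Lemma K_0_const c : Kbar0 c -> K0 c.
Proof.
move=> Hc; exists 0%N, (fun i => if i == 0%N then c else 0); split=> //.
- by move=> [|i] // _; exact: (Kbar_zero pK lf).
- by move=> i i1; rewrite ifF //; apply/negbTE; rewrite muln_eq0 negb_or -!lt0n p_gt0.
by rewrite big_ord_recl big_ord0 expr0 invr1 mulr1 addr0.
Qed.

Lemma K_0_monomial c m : Kbar c -> ~~ (p %| m)%N -> K0 (c * t ^- m).
Proof.
move=> Hc pm; exists m, (fun i => if i == m then c else 0); split.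
- by rewrite ifF //; apply/negbTE; apply: contra pm => /eqP <-; rewrite dvdn0.
- by move=> i i1; case: ifP => // _; exact: (Kbar_zero pK lf).
- by move=> i i1; rewrite ifF //; apply/negbTE; apply: contra pm => /eqP <-; rewrite dvdn_mulr.
rewrite big_ord_recr /= eqxx big1 ?add0r // => i _.
by rewrite ifF ?mul0r //; apply/negbTE; rewrite ltn_eqF.
Qed.

Lemma K_0_nat n x : K0 x -> K0 (n%:R * x).
Proof.
move=> Hx; elim: n => [|n IH]; first by rewrite mul0r; apply: K_0_const.
by rewrite mulrS mulrDl mul1r; apply: K_0_add.
Qed.

Lemma K_0_coef x (m : int) : K0 x -> 0 < m -> ctc (x * t ^ (- m)) = 0.
Proof.
move=> [s [a [a0 aK _ ->]]] m0; rewrite mulr_suml (ctc_sum pK lf valt) big1 // => i _.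
rewrite texpN -mulrA -(texpD pK lf valt) (ctc_mono pK lf valt) ?ifF //.
  by apply/negbTE/eqP; clear -m0; lia.
by case: (i : nat) => [|j]; [exact: Kbar0_sub|exact: aK].
Qed.

Lemma K_0_coefp x m : K0 x -> (0 < m)%N -> (p %| m)%N -> ctc (x * t ^+ m) = 0.
Proof.
move=> [s [a [a0 aK ap ->]]] m0 /dvdnP [k mk]; rewrite mulr_suml (ctc_sum pK lf valt) big1 // => i _.
rewrite texpN exprnP -mulrA -(texpD pK lf valt) (ctc_mono pK lf valt).
  case: eqP => // E; have -> : (i : nat) = (p * k)%N by rewrite mulnC -mk; clear -E; lia.
  by rewrite ap //; move: m0; rewrite mk muln_gt0 => /andP[].
by case: (i : nat) => [|j]; [exact: Kbar0_sub|exact: aK].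
Qed.

(** Positive degrees are absorbed by [wp], constants by the complement. For a pole order [p k], the
    monomial [c t^(-pk)] is congruent to [e t^(-k)] with [e^p = c], which lowers the pole order. *)
Lemma K_0_reduce x : exists y z, K0 y /\ x = y + wp p z.
Proof.
apply: (laurent_ind pK lf valt (N := 1) (Q := fun x => exists y z, K0 y /\ x = y + wp p z)).
- move=> u u' [y [z [Hy ->]]] [y' [z' [Hy' ->]]]; exists (y + y'), (z + z').
  by split; [exact: K_0_add|rewrite wpD addrACA].
- move=> c n Hc; have [n0|n0] := ltP 0 n.
    have [|z _ E] := @mpow1_wp (c * t ^ n); first by apply: mpow_le (mpow_ct pK lf valt n Hc); clear -n0; lia.
    by exists 0, z; split; [exact: K_0_const|rewrite add0r].
  have -> : n = - (`|n|%N)%:Z by clear -n0; lia.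
  elim/ltn_ind: `|n|%N c Hc => m IH c Hc.
  have [m0|m0] := posnP m.
    have [_ _ _ W _] := acK; have := Hc; rewrite [X in X c]W => -[_ [a Ha <-]] [c' Hc' <-].
    by exists c', a; rewrite m0 oppr0 expr0z mulr1; split; [exact: K_0_const|rewrite addrC].
  have [/dvdnP [k mk]|pm] := boolP (p %| m)%N; last first.
    by exists (c * t ^- m), 0; split; [exact: K_0_monomial|rewrite /wp expr0n eqn0Ngt p_gt0 subrr addr0 texpN].
  have [e He ec] := Kbar_root pK lf 1 Hc; rewrite expn1 in ec.
  have km : (k < m)%N by rewrite mk ltn_Pmulr ?prime_gt1 //; move: m0; rewrite mk muln_gt0 => /andP[].
  have [y [z [Hy E]]] := IH k km e He; exists y, (z + e * t ^ (- k%:Z)); split=> //.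
  rewrite wpD addrA -E /wp exprMn ec (exprnP (t ^ _)) exprz_exp mk PoszM mulNr.
  by rewrite addrC subrK.
- by move=> y /mpow1_wp [z _ ->]; exists 0, z; split; [exact: K_0_const|rewrite add0r].
Qed.

Lemma B_0D x y : B0 x -> B0 y -> B0 (x + y).
Proof.
move=> [/AS_setP [a Ha] Hx] [/AS_setP [a' Ha'] Hy]; split; last exact: K_0_add.
by apply/AS_setP; exists (a + a'); rewrite (frobD1 pL) opprD addrACA Ha Ha' scalerDl.
Qed.

Lemma B_0_0 : B0 0.
Proof.
split; last exact: K_0_const.
by apply/AS_setP; exists 0; rewrite expr0n eqn0Ngt p_gt0 subrr scale0r.
Qed.

Lemma B_0Z r x : r ^+ p = r -> B0 x -> B0 (r * x).
Proof.
move=> /(Fp_natr pK) [n ->] [/AS_setP [a Ha] Hx]; split; last exact: K_0_nat.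
apply/AS_setP; exists (n%:R * a); rewrite exprMn (natr_frob pL) -mulrBr Ha.
by rewrite -[RHS]/(in_alg L (n%:R * x)) rmorphM rmorph_nat.
Qed.

Lemma B_0_sum (c F : nat -> K) n : (forall j, c j ^+ p = c j) -> (forall j, (j < n)%N -> B0 (F j)) ->
  B0 (\sum_(j < n) c j * F j).
Proof.
move=> Hc HF; elim: n HF => [|n IH] HF; first by rewrite big_ord0; exact: B_0_0.
rewrite big_ord_recr /=; apply: B_0D; last by apply: B_0Z => //; apply: HF.
by apply: IH => j jn; apply: HF; apply: ltnW.
Qed.

Lemma B_0_orthogonal alpha beta : H alpha -> B0 beta -> pairing alpha beta = 0.
Proof. by move=> Ha [/AS_setP [y yE] _]; apply: norm_orthogonal yE. Qed.

Lemma wp_int (F : fieldType) (v : F -> \bar int) : discrete_valuation v ->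
  forall y, mpow v 0 (y ^+ p - y) -> mpow v 0 y.
Proof.
move=> dv y Hy; have [->|/(val_fin dv) [n E]] := eqVneq y 0; first exact: mpow0.
apply/(mpowE _ E); rewrite leNgt; apply/negP => n0.
have : v (y ^+ p - y) = (n * p%:Z)%:E.
  apply: (val_addl dv (valX dv p E)); apply: (mpowN dv); apply/(mpowE _ E).
  by have := prime_gt1 p_pr; clear -n0; nia.
by move=> E'; move: Hy => /(mpowE _ E'); have := prime_gt1 p_pr; clear -n0; nia.
Qed.

Lemma AS_Gal_diff (y : L) (beta : K) s : y ^+ p - y = beta%:A -> s \in G -> (s y - y) ^+ p = s y - y.
Proof.
move=> yE sG; rewrite (frobB1 pL) -rmorphXn /=; apply/eqP; rewrite -subr_eq0; apply/eqP.
have := congr1 s yE; rewrite rmorphB /= Gal_alg // -yE => E.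
have -> : s (y ^+ p) - y ^+ p - (s y - y) = (s (y ^+ p) - s y) - (y ^+ p - y) by ring.
by rewrite E subrr.
Qed.

(** An integral [beta] makes [y] integral, so the break gives [s y - y] positive valuation; but it
    lies in the prime field, hence is 0. *)
Lemma AS_int (y : L) (beta : K) : y ^+ p - y = beta%:A -> MK 0 beta -> exists z : K, y = z%:A.
Proof.
move=> yE Hb; have Hy : ML 0 y by apply: (wp_int dvL); rewrite yE; apply: mpowA0.
apply: fixedby_Gal => s sG; apply/eqP; rewrite -subr_eq0; apply/eqP.
have [m Em] := Fp_natr pL (AS_Gal_diff yE sG).
have Hs : ML 1 (s y - y).
  have fix1 : fixedby 1%G y by move=> a /set1P ->; rewrite gal_id.
  have := tw_shift tower1 (m := 0) sG fix1; rewrite !mul1n add0n => /(_ Hy).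
  by apply: mpow_le; clear -b_gt0; lia.
have mE : (m%:R : L) = (m%:R : K)%:A by rewrite -[RHS]/(in_alg L m%:R) rmorph_nat.
rewrite Em mE; rewrite Em mE in Hs.
by rewrite (KbarA_M1 (Kbar_nat pK lf m) Hs) scale0r.
Qed.

Lemma B_0_int beta : B0 beta -> MK 0 beta -> beta = 0.
Proof.
move=> [/AS_setP [y yE] HK] Hb; have [z yz] := AS_int yE Hb.
have bz : beta = wp p z.
  apply: algI; rewrite -yE yz /wp scalerBl; congr (_ - _).
  by rewrite -[RHS]/(in_alg L (z ^+ p)) rmorphXn.
have Hz : MK 0 z by apply: (wp_int dvK); rewrite -/(wp p z) -bz.
have [c Hc zc] := teich_exists pK lf Hz.
have Hbc : beta = wp p c + wp p (z - c) by rewrite bz -wpD addrC subrK.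
have Hw : MK 1 (wp p (z - c)).
  apply: (mpowB dvK) => //; apply: mpow_le (mpowX dvK p zc).
  by clear -p_gt0; lia.
have Kwc : Kbar (wp p c) by apply: (KbarB pK lf) => //; apply: (KbarX pK lf).
have [s [a [a0 aK ap bE]]] := HK.
have c0E : ctc beta = a 0%N.
  rewrite bE (ctc_sum pK lf valt) big_ord_recl big1 ?addr0 => [|i _].
    by rewrite expr0 invr1 -(expr0z t) (ctc_mono pK lf valt) //; apply: Kbar0_sub.
  rewrite texpN (ctc_mono pK lf valt) //; exact: aK.
have b0E : beta = a 0%N.
  apply/eqP; rewrite -subr_eq0; apply/eqP/(ctc_detect pK lf valt) => n.
  have Ka0 : Kbar (a 0%N) by exact: Kbar0_sub.
  rewrite mulrBl (ctcB pK lf valt) (ctc_mono pK lf valt n Ka0).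
  have [->|n0] := eqVneq n 0; first by rewrite expr0z mulr1 c0E subrr.
  rewrite subr0; have [n1|n1] := ltP 0 n.
    apply: (ctcM1 pK lf valt); apply: mpow_le (mpow_texp pK lf valt n Hb); clear -n1; lia.
  have := K_0_coef (m := - n) HK; rewrite opprK; apply; move: n0; clear -n1; lia.
have ctcwc : ctc beta = wp p c.
  rewrite Hbc (ctcD pK lf valt) (ctcM1 pK lf valt Hw) addr0.
  by have := ctc_mono pK lf valt 0 Kwc; rewrite expr0z mulr1.
have [_ _ _ _ W] := acK; have : ((wp p @` Kbar) `&` Kbar0)%classic beta.
  split; last by rewrite b0E.
  by exists c => //; rewrite -ctcwc c0E.
by rewrite W.
Qed.

Lemma lead_pairing m u a beta : (0 < m)%N -> Kbar a -> MK m.+1%:Z (u - 1 - a * t ^+ m) -> MK (- m%:Z) beta ->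
  pairing u beta = m%:R * tr (a * ctc (beta * t ^+ m)).
Proof. by move=> m0 Ha Hu Hb; rewrite exprnP (pairing_unit pK lf valt m0 Ha). Qed.

Lemma ctc_lead beta m : vK beta = (- m%:Z)%:E -> ctc (beta * t ^+ m) != 0.
Proof.
move=> E; apply/eqP => g0; have Hb := mpow_val E; have : MK (1 - m%:Z) beta.
  apply: (ctc_mpow pK lf valt) => k km; have [kE|kE] := eqVneq k (- m%:Z).
    by rewrite kE opprK -exprnP.
  apply: (ctcM1 pK lf valt); apply: mpow_le (mpow_texp pK lf valt (- k) Hb).
  by move: kE; clear -km; lia.
by move/(mpowE _ E); clear; lia.
Qed.

(** At pole order [m] a unit of level [m] can be chosen that pairs nontrivially with [beta]. If
    [m < b], it is a norm times an element of U^b, and both factors pair to 0; if [m > b], it is a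
    norm. Orthogonality leaves only [m = b]. *)
Lemma B_0_val beta : B0 beta -> beta != 0 -> vK beta = (- b%:Z)%:E.
Proof.
move=> HB b0; have [n En] := val_fin dvK b0; rewrite En; congr EFin.
have n0 : n < 0.
  by rewrite ltNge; apply/negP => n0; case/negP: b0; rewrite (B_0_int HB) //; apply/(mpowE _ En).
pose m := `|n|%N; have nm : n = - m%:Z by rewrite /m; clear -n0; lia.
have m0 : (0 < m)%N by rewrite /m; clear -n0; lia.
have Hb : MK (- m%:Z) beta by apply/(mpowE _ En); rewrite nm.
pose g := ctc (beta * t ^+ m); have gK : Kbar g by exact: (ctc_Kbar pK lf valt).
have g0 : g != 0 by apply: ctc_lead; rewrite En nm.
have pm : ~~ (p %| m)%N.
  by apply/negP => pm; case/negP: g0; rewrite /g (K_0_coefp _ m0 pm) //; case: HB.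
have [c cK tc] := tr_neq0 pK lf valt.
(* Dividing [c] by the leading digit [g] makes the pairing equal to [m] times the nonzero trace of
   [c]. *)
pose u := 1 + (c / g) * t ^+ m.
have cgK : Kbar (c / g) by apply: (KbarM pK lf) => //; apply: (KbarV pK lf).
have Hu : MK m.+1%:Z (u - 1 - (c / g) * t ^+ m).
  by have -> : u - 1 - c / g * t ^+ m = 0 by [rewrite /u; ring]; exact: mpow0.
have Pu : pairing u beta != 0.
  rewrite (lead_pairing m0 cgK Hu Hb) -/g divfK // mulf_neq0 //.
  by rewrite -(dvdn_pcharf pK).
have Hum : MK m%:Z (u - 1).
  have -> : u - 1 = (c / g) * t ^+ m by rewrite /u; ring.
  by rewrite exprnP; apply: (mpow_ct pK lf valt).
have [mb|bm|mb] := ltngtP m b; last by rewrite nm mb.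
  case/negP: Pu; have [|y Hy Huy] := @norm_group_reduce u.
    by apply: mpow_le Hum; clear -m0; lia.
  have y0 := norm_group_neq0 Hy.
  have uy0 : u / y != 0.
    by apply: (val_neq0 dvK); apply: (unit1_val dvK); apply: mpow_le Huy; clear -b_gt0; lia.
  rewrite -(divfK y0 u) (pairingM pK lf valt) // (B_0_orthogonal Hy HB) addr0.
  apply/eqP; apply: (pairing_mpow0 pK lf valt _ Huy); first by rewrite lez_nat.
  by apply: mpow_le Hb; clear -mb; lia.
case/negP: Pu; rewrite (B_0_orthogonal _ HB) //; apply: norm_group_top.
by apply: mpow_le Hum; clear -bm; lia.
Qed.

Lemma B_0_pole beta : B0 beta -> MK (- b%:Z) beta.
Proof.
move=> HB; have [->|b0] := eqVneq beta 0; first exact: mpow0.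
exact: mpow_val (B_0_val HB b0).
Qed.

Lemma B_0_break beta : B0 beta -> beta != 0 -> ~~ (p %| b)%N.
Proof.
move=> HB b0; have := ctc_lead (B_0_val HB b0); apply: contra => pb.
by rewrite (K_0_coefp _ b_gt0 pb) //; case: HB.
Qed.

Lemma trace_one : exists th : L, \sum_(s in G) s th = 1.
Proof.
have [th Hth] := trace_surj; pose T := \sum_(s in G) s th.
have TG u : u \in G -> u T = T.
  move=> uG; rewrite /T rmorph_sum (reindex_inj (mulIg u^-1%g)) /=.
  by apply: eq_big => s; rewrite ?groupMr ?groupV // => _; rewrite -GalM mulgKV.
exists (T^-1 * th); transitivity (\sum_(s in G) T^-1 * s th).
  by apply: eq_bigr => s sG; rewrite rmorphM /= fmorphV /= TG.
by rewrite -mulr_sumr mulVf.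
Qed.

(** The values of [chi] are fixed by the group, so a homomorphism is a cocycle; averaging against an
    element of trace 1 solves it. *)
Lemma additive_hilbert90 (chi : gal_of {:L} -> K) :
  (forall s u, s \in G -> u \in G -> chi (s * u)%g = chi s + chi u) ->
  exists y : L, forall s, s \in G -> s y - y = (chi s)%:A.
Proof.
move=> chiM; have [th Hth] := trace_one; exists (- \sum_(u in G) (chi u)%:A * u th) => s sG.
rewrite rmorphN rmorph_sum opprK.
have -> : \sum_(u in G) s ((chi u)%:A * u th) = \sum_(u in G) (chi u - chi s)%:A * u th.
  rewrite [RHS](reindex_inj (mulIg s)) /=.
  apply: eq_big => u; rewrite ?groupMr // => uG.
  by rewrite rmorphM /= Gal_alg // chiM // addrK GalM.
rewrite addrC -sumrB -[RHS]mulr1 -[X in _ = _ * X]Hth mulr_sumr; apply: eq_bigr => u uG.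
by rewrite -mulrBl -scalerBl opprB addrC subrK.
Qed.

(** Artin-Schreier theory: Hilbert 90 gives [y], and subtracting an element of [K] moves [y^p - y]
    into [K_0] without altering the character. *)
Lemma AS_character (chi : gal_of {:L} -> K) :
  (forall s u, s \in G -> u \in G -> chi (s * u)%g = chi s + chi u) ->
  (forall s, s \in G -> chi s ^+ p = chi s) ->
  exists (y : L) (beta : K), [/\ B0 beta, y ^+ p - y = beta%:A &
    forall s, s \in G -> s y - y = (chi s)%:A].
Proof.
move=> chiM chip; have [y Hy] := additive_hilbert90 chiM.
have frA (c : K) : c%:A ^+ p = (c ^+ p)%:A :> L by rewrite -[RHS]/(in_alg L _) rmorphXn.
have [x yx] : exists x : K, y ^+ p - y = x%:A.
  apply: fixedby_Gal => s sG; have E : s y = y + (chi s)%:A by rewrite -Hy // addrC subrK.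
  by rewrite rmorphB rmorphXn /= E (frobD1 pL) frA chip //; ring.
have [beta [z [Hb xE]]] := K_0_reduce x.
have E : (y - z%:A) ^+ p - (y - z%:A) = beta%:A.
  rewrite (frobB1 pL) frA.
  have -> : beta = x - wp p z by rewrite xE addrK.
  by rewrite scalerBl -yx /wp scalerBl; ring.
exists (y - z%:A), beta; split=> //; first by split=> //; apply/AS_setP; exists (y - z%:A).
by move=> s sG; rewrite rmorphB /= Gal_alg // -Hy //; ring.
Qed.

Lemma AS_fixed (y : L) s : y ^+ p - y = 0 -> s \in G -> s y = y.
Proof.
move=> /eqP; rewrite subr_eq0 => /eqP /(Fp_natr pL) [n ->] _; exact: rmorph_nat.
Qed.

Lemma natr_FpD (x y : 'F_p) : (nat_of_ord (GRing.add x y))%:R = (x : nat)%:R + (y : nat)%:R :> K.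
Proof.
have -> : nat_of_ord (GRing.add x y) = ((x + y) %% p)%N by rewrite /=; congr modn; exact: Fp_cast.
rewrite -natrD; move: (x + y)%N => n.
by rewrite [in RHS](divn_eq n p) natrD natrM (pcharf0 pK) mulr0 add0r.
Qed.

(** The elements come from the [nu] coordinate characters of the group. Independence is stated
    triangularly, the form in which each new element cuts a count by a factor [p]. *)
Lemma B_0_independent : exists beta : nat -> K, (forall j, (j < nu)%N -> B0 (beta j)) /\
  forall k (c : nat -> K), (k < nu)%N -> (forall j, c j ^+ p = c j) -> beta k <> \sum_(j < k) c j * beta j.
Proof.
have [phi _ phiG] := isogP isoG.
pose chi j s : K := if insub j is Some i then (phi s 0 i : nat)%:R else 0.
have chip j s : chi j s ^+ p = chi j s.
  rewrite /chi; case: insub => [i|]; first exact: (natr_frob pK).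
  by rewrite expr0n eqn0Ngt p_gt0.
have chiM j s u : s \in G -> u \in G -> chi j (s * u)%g = chi j s + chi j u.
  move=> sG uG; rewrite /chi; case: insub => [i|]; last by rewrite addr0.
  by rewrite morphM // mxE natr_FpD.
have W j : exists yb : L * K, [/\ B0 yb.2, yb.1 ^+ p - yb.1 = yb.2%:A &
    forall s, s \in G -> s yb.1 - yb.1 = (chi j s)%:A].
  by have [y [beta H]] := AS_character (chiM j) (fun s _ => chip j s); exists (y, beta).
have [yb Hyb] := choice W; exists (fun j => (yb j).2); split=> [j _|k c knu cp E].
  by case: (Hyb j).
(* A relation makes [z] a root of [X^p - X], hence Galois-fixed; an automorphism mapping to the
   [k]-th basis vector nevertheless moves it by 1. *)
pose z := (yb k).1 - \sum_(j < k) (c j)%:A * (yb j).1.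
have frA (x : K) : x%:A ^+ p = (x ^+ p)%:A :> L by rewrite -[RHS]/(in_alg L _) rmorphXn.
have z0 : z ^+ p - z = 0.
  transitivity (((yb k).1 ^+ p - (yb k).1) -
      \sum_(j < k) (((c j)%:A * (yb j).1) ^+ p - (c j)%:A * (yb j).1)).
    by rewrite /z (frobB1 pL) (frob_sum1 pL) sumrB; ring.
  have [_ -> _] := Hyb k; rewrite E -[X in X - _]/(in_alg L _) rmorph_sum -sumrB big1 // => j _ /=.
  have [_ Ej _] := Hyb j; rewrite exprMn frA cp algM -Ej; ring.
have [s sG sE] : exists2 s, s \in G & phi s = delta_mx 0 (Ordinal knu).
  have : delta_mx 0 (Ordinal knu) \in [set: 'rV['F_p]_nu]%SET by rewrite finset.in_setT.
  by rewrite -phiG => /morphimP [s _ sG ->]; exists s.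
have := AS_fixed z0 sG; rewrite /z rmorphB rmorph_sum => /eqP; rewrite -subr_eq0 => /eqP.
have [_ _ /(_ s sG) Ek] := Hyb k.
have -> : s (yb k).1 - \sum_(j < k) s ((c j)%:A * (yb j).1) -
   ((yb k).1 - \sum_(j < k) (c j)%:A * (yb j).1) =
   (s (yb k).1 - (yb k).1) - \sum_(j < k) (c j)%:A * (s (yb j).1 - (yb j).1).
  rewrite [X in _ = _ - X](eq_bigr (fun j : 'I_k => s ((c j)%:A * (yb j).1) - (c j)%:A * (yb j).1)).
    by rewrite sumrB; ring.
  by move=> j _; rewrite rmorphM /= Gal_alg // mulrBr.
rewrite Ek big1 => [|j _].
  have -> : chi k s = 1 by rewrite /chi insubT /= sE mxE !eqxx.
  by rewrite subr0 scale1r => /eqP; rewrite oner_eq0.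
have [_ _ /(_ s sG) ->] := Hyb j; have jnu := ltn_trans (ltn_ord j) knu.
rewrite /chi (insubT (fun j => (j < nu)%N) jnu) /= sE mxE eqxx /= -(inj_eq val_inj) /=.
by rewrite ltn_eqF // scale0r mulr0.
Qed.

(* The values [f c] of the norm map at the break exhaust the orthogonal of the leading
   coefficients of [B_0]: both have [q / p^nu] elements. *)
Lemma norm_break_image (f : K -> K) (g : nat -> K) :
  (forall c c', Kbar c -> Kbar c' -> f (c + c') = f c + f c') ->
  (forall c, Kbar c -> Kbar (f c)) ->
  (forall c, Kbar c -> f c = 0 -> exists2 a, a \in G & c = dG a) ->
  (forall j, Kbar (g j)) ->
  (forall k (c : nat -> K), (k < nu)%N -> (forall j, c j ^+ p = c j) -> g k <> \sum_(j < k) c j * g j) ->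
  (forall c j, Kbar c -> (j < nu)%N -> tr (f c * g j) = 0) ->
  forall a, Kbar a -> (forall j, (j < nu)%N -> tr (a * g j) = 0) -> exists2 c, Kbar c & a = f c.
Proof.
move=> fD fK fker gK gfree fg.
have [s us [szs sK]] := Kbar_seq pK lf valt.
pose S k := [seq a <- s | all (fun j => tr (a * g j) == 0) (iota 0 k)].
have SP k a : a \in S k <-> Kbar a /\ forall j, (j < k)%N -> tr (a * g j) = 0.
  rewrite mem_filter; split=> [/andP[/allP H /sK aK]|[/sK aK H]].
    by split=> // j jk; apply/eqP/H; rewrite mem_iota.
  by rewrite aK andbT; apply/allP => j; rewrite mem_iota => /H ->.
have uS k : uniq (S k) by exact: filter_uniq.
(* Each condition divides the number of solutions by [p] at least: the translates of [S k.+1] by the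
   multiples of a suitable [a0] are disjoint in [S k]. *)
have Sstep k : (k < nu)%N -> (p * size (S k.+1) <= size (S k))%N.
  move=> knu; have [a0 /SP [a0K Ha0] r0] : exists2 a, a \in S k & tr (a * g k) != 0.
    apply: contrapT => none.
    (* If condition [k] were implied by the earlier ones, nondegeneracy of the trace would make
       [g k] a combination of them. [ctc], the identity on [Kbar], makes the functionals take
       prime-field values on all of [K]. *)
    have [|||||||||c cp Hc] := @functional_combination p K vK kK res t pK lf valt Kbar k
       (fun j a => tr (ctc a * g j)) (fun a => tr (ctc a * g k)).
    - exact: (KbarD pK lf).
    - by move=> r x Hr; apply: (KbarM pK lf); exact: (Fp_Kbar pK lf valt).
    - by move=> j x y; rewrite (ctcD pK lf valt) mulrDl (trD pK lf valt).
    - by move=> j r x Hr; rewrite (ctcZ pK lf valt _ (Fp_Kbar pK lf valt Hr)) -mulrA (trZ pK lf valt).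
    - by move=> j x; apply: (tr_Fp pK lf valt); apply: (KbarM pK lf) => //; exact: (ctc_Kbar pK lf valt).
    - by move=> x y; rewrite (ctcD pK lf valt) mulrDl (trD pK lf valt).
    - by move=> r x Hr; rewrite (ctcZ pK lf valt _ (Fp_Kbar pK lf valt Hr)) -mulrA (trZ pK lf valt).
    - by move=> x; apply: (tr_Fp pK lf valt); apply: (KbarM pK lf) => //; exact: (ctc_Kbar pK lf valt).
    - move=> x Kx Hx; have cx : ctc x = x by have := ctc_mono pK lf valt 0 Kx; rewrite expr0z mulr1.
      rewrite cx in Hx *; apply/eqP/negPn/negP => nz; apply: none; exists x => //.
      apply/SP; split=> // j /Hx; by rewrite cx.
    apply: (gfree k c knu cp); apply/eqP; rewrite -subr_eq0; apply/eqP.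
    set h := _ - _; have hK : Kbar h.
      apply: (KbarB pK lf) => //; apply: (Kbar_sum pK lf) => j _.
      by apply: (KbarM pK lf) => //; apply: (Fp_Kbar pK lf valt).
    have [e eK te] := tr_neq0 pK lf valt.
    apply/eqP; apply: contraNT te => h0; have xK : Kbar (e / h).
      by apply: (KbarM pK lf) => //; apply: (KbarV pK lf).
    have cx : ctc (e / h) = e / h by have := ctc_mono pK lf valt 0 xK; rewrite expr0z mulr1.
    have := Hc _ xK; rewrite cx => E.
    have -> : e = e / h * (g k - \sum_(j < k) c j * g j) by rewrite -/h divfK.
    rewrite mulrBr (trD pK lf valt) (trN pK lf valt) E.
    rewrite mulr_sumr.
    have tr_sum (F : 'I_k -> K) : tr (\sum_j F j) = \sum_j tr (F j).
      by elim/big_rec2: _ => [|j y1 y2 _ <-]; rewrite ?(tr0 pK lf valt) // (trD pK lf valt).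
    rewrite tr_sum -sumrB big1 // => j _.
    by rewrite [e / h * (c j * _)]mulrCA (trZ pK lf valt _ (cp j)) subrr.
  have -> : (p * size (S k.+1))%N = size [seq a + i%:R * a0 | i <- iota 0 p, a <- S k.+1].
    by rewrite size_allpairs size_iota.
  have trX i a : tr ((a + i%:R * a0) * g k) = tr (a * g k) + i%:R * tr (a0 * g k).
    by rewrite mulrDl (trD pK lf valt) -mulrA (trZ pK lf valt _ (natr_frob pK i)).
  apply: uniq_leq_size.
    apply: allpairs_uniq => //; first exact: iota_uniq.
    move=> [i a] [i' a'] /allpairsP [[u v] /= [ui vS [-> ->]]] /allpairsP [[u' v'] /= [ui' vS' [-> ->]]] E.
    have [Hv Hv'] := ((SP k.+1 v).1 vS, (SP k.+1 v').1 vS').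
    have := congr1 (fun x => tr (x * g k)) E; rewrite /= !trX Hv.2 // Hv'.2 // !add0r => /(mulIf r0) uu.
    have uu' : u = u'.
      move: ui ui'; rewrite !mem_iota !add0n /= => ui ui'.
      wlog le : u u' v v' vS vS' E Hv Hv' ui ui' uu / (u <= u')%N.
        by move=> W; case/orP: (leq_total u u') => le; [apply: (W u u' v v')|apply/esym/(W u' u v' v)].
      apply/eqP; rewrite eqn_leq le /= -subn_eq0; apply/eqP.
      have : (p %| u' - u)%N by rewrite (dvdn_pcharf pK) natrB // uu subrr.
      by move/dvdn_leq; case: (u' - u)%N (leq_subr u u') => // m; clear -ui'; lia.
    by move: E; rewrite uu' => /addIr ->.
  move=> x /allpairsP [[i a] /= [_ /SP [aK Ha] ->]]; apply/SP; split.
    by apply: (KbarD pK lf) => //; apply: (KbarM pK lf) => //; apply: (Kbar_nat pK lf).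
  move=> j jk; rewrite mulrDl (trD pK lf valt) (Ha _ (leqW jk)) -mulrA (trZ pK lf valt _ (natr_frob pK i)).
  by rewrite Ha0 // mulr0 addr0.
have Sz k : (k <= nu)%N -> (p ^ k * size (S k) <= q)%N.
  elim: k => [|k IH] knu; first by rewrite expn0 mul1n -szs size_filter count_size.
  apply: leq_trans (IH (ltnW knu)).
  by rewrite expnSr -mulnA leq_mul2l Sstep ?orbT.
pose Y := undup (map f s).
have YS : {subset Y <= S nu}.
  move=> x; rewrite mem_undup => /mapP [c /sK cK ->]; apply/SP; split; first exact: fK.
  by move=> j; apply: fg.
have qY : (q <= d * size Y)%N.
  (* A chosen preimage of each value: the fibre above it consists of translates by elements [dG a],
     at most [d] of them. *)
  pose rep x := nth 0 s (index x (map f s)).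
  have repP c : c \in s -> rep (f c) \in s /\ f (rep (f c)) = f c.
    move=> cs; have fcs : f c \in map f s by apply: map_f.
    have lt : (index (f c) (map f s) < size s)%N by rewrite -(size_map f) index_mem.
    by split; [exact: mem_nth|rewrite /rep -(nth_map 0 0) // nth_index].
  rewrite -szs; have -> : (d * size Y)%N = size [seq rep x + dG a | a <- enum G, x <- Y].
    by rewrite size_allpairs -cardE card_Gal.
  apply: uniq_leq_size => // c cs; have [rs Er] := repP c cs.
  have [cK rK] := ((sK c).1 cs, (sK _).1 rs).
  have [a aG aE] : exists2 a, a \in G & c - rep (f c) = dG a.
    apply: fker; first exact: (KbarB pK lf).
    have HB : Kbar (c - rep (f c)) by exact: (KbarB pK lf).
    by apply: (addIr (f (rep (f c)))); rewrite -fD // subrK add0r.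
  apply/allpairsP; exists (a, f c); split=> /=; first by rewrite mem_enum.
    by rewrite mem_undup; apply: map_f.
  by rewrite -aE addrC subrK.
have YE : (size (S nu) <= size Y)%N.
  by rewrite -(leq_pmul2l d_gt0); apply: leq_trans (Sz nu (leqnn nu)) qY.
move=> a aK Ha; have : a \in S nu by apply/SP.
have [_ <-] := uniq_min_size (undup_uniq _) YS YE.
by rewrite mem_undup => /mapP [c /sK cK ->]; exists c.
Qed.

(** Dividing by a norm brings [u] into U^b, where orthogonality constrains only the leading
    coefficient. [norm_break_image] makes that coefficient the one of a norm, and the remaining
    quotient lies in U^(b+1). *)
Lemma norm_group_dual : exists2 beta : nat -> K, (forall j, (j < nu)%N -> B0 (beta j)) &
  forall u, MK 1 (u - 1) -> (forall j, (j < nu)%N -> pairing u (beta j) = 0) -> H u.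
Proof.
have [beta [HB bfree]] := B_0_independent; exists beta => // u Hu Pu.
have [f [fD fK fker fN]] := norm_group_break.
pose g j := ctc (beta j * t ^+ b).
have gK j : Kbar (g j) by exact: (ctc_Kbar pK lf valt).
have lead v a j : (j < nu)%N -> Kbar a -> MK b.+1%:Z (v - 1 - a * t ^+ b) ->
    pairing v (beta j) = 0 -> tr (a * g j) = 0.
  move=> jnu aK Hv; rewrite (lead_pairing b_gt0 aK Hv (B_0_pole (HB j jnu))) -/(g j).
  (* A nonzero element of [B_0] forces [b] prime to [p], so the factor [b] of the pairing can be
     cancelled. *)
  have [b0|b0] := eqVneq (beta j) 0; first by rewrite /g b0 mul0r (ctc0 pK lf valt) mulr0 (tr0 pK lf valt).
  by move=> /eqP; rewrite mulf_eq0 -(dvdn_pcharf pK) (negbTE (B_0_break (HB j jnu) b0)) => /eqP.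
(* A relation between leading coefficients would give a nonzero element of [B_0] without a term of
   degree [-b], against [B_0_val]. *)
have gfree k (c : nat -> K) : (k < nu)%N -> (forall j, c j ^+ p = c j) -> g k <> \sum_(j < k) c j * g j.
  move=> knu cp E; apply: (bfree k c knu cp); apply/eqP; rewrite -subr_eq0.
  apply/negPn/negP => z0; pose z := beta k + \sum_(j < k) (- c j) * beta j.
  have zE : beta k - \sum_(j < k) c j * beta j = z.
    by rewrite /z -sumrN; congr (_ + _); apply: eq_bigr => j _; rewrite mulNr.
  have HBz : B0 z.
    apply: B_0D; first exact: HB.
    apply: (@B_0_sum (fun j => - c j) beta) => [j|j jk]; first by have := frobN pK 1 (c j); rewrite expn1 cp.
    by apply: HB; apply: ltn_trans knu.
  rewrite zE in z0; case/negP: (ctc_lead (B_0_val HBz z0)).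
  rewrite -zE mulrBl (ctcB pK lf valt) -/(g k) E mulr_suml (ctc_sum pK lf valt) -sumrB big1 // => j _.
  by rewrite -mulrA (ctcZ pK lf valt _ (Fp_Kbar pK lf valt (cp j))) subrr.
have fg c j : Kbar c -> (j < nu)%N -> tr (f c * g j) = 0.
  move=> cK jnu; have [y Hy Ey] := fN c cK; apply: (lead _ _ _ jnu (fK c cK) Ey).
  exact: B_0_orthogonal Hy (HB j jnu).
have [y Hy Huy] := norm_group_reduce Hu.
have y0 := norm_group_neq0 Hy.
have unit0 v : MK b%:Z (v - 1) -> v != 0.
  by move=> Hv; apply: (val_neq0 dvK); apply: (unit1_val dvK); apply: mpow_le Hv; clear -b_gt0; lia.
have [a aK Ha] := unit_digit Huy.
have Pa j : (j < nu)%N -> tr (a * g j) = 0.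
  move=> jnu; apply: (lead _ _ _ jnu aK Ha); have := Pu j jnu.
  rewrite -[u in pairing u _](divfK y0) (pairingM pK lf valt _ (unit0 _ Huy) y0).
  by rewrite (B_0_orthogonal Hy (HB j jnu)) addr0.
have [c cK ac] := norm_break_image fD fK fker gK gfree fg aK Pa.
have [y' Hy' Ey'] := fN c cK; rewrite -ac in Ey'.
have Ht := norm_group_top (unit_step b_gt0 aK Ha Ey').
rewrite -(divfK y0 u); apply: norm_groupM => //.
by rewrite -[u / y](divfK (norm_group_neq0 Hy')); apply: norm_groupM.
Qed.

(** * Transfer of the orthogonality to the image under Lambda *)

Variable k : int.
Hypothesis bk : Num.ceil (b%:R / p%:R : rat) - 1 <= k.

(** As [b > 0], the ceiling is at least 1; clearing the denominator gives the second bound. *)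
Let k1 : 1 <= k + 1 /\ b%:Z <= p%:Z * (k + 1).
Proof.
have p0 : (0 : rat) < p%:R by rewrite ltr0n.
have := ceil_ge (b%:R / p%:R : rat); rewrite ler_pdivrMr // => H.
have {H} H : b%:Z <= Num.ceil (b%:R / p%:R : rat) * p%:Z.
  by rewrite -(ler_int rat) rmorphM /=.
split; last by move: bk H p_gt0; clear; move: (Num.ceil _) => c; nia.
by move: bk H b_gt0 p_gt0; clear; move: (Num.ceil _) => c; nia.
Qed.

Let F (y a : K) := tr (ctc (y * delta vK kK t a)).

Let FD y a a' : F y (a + a') = F y a + F y a'.
Proof. by rewrite /F (deltaD pK lf valt) mulrDr (ctcD pK lf valt) (trD pK lf valt). Qed.

Let FDl y y' a : F (y + y') a = F y a + F y' a.
Proof. by rewrite /F mulrDl (ctcD pK lf valt) (trD pK lf valt). Qed.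

Let FK c y a : Kbar c -> F y (c * a) = F (c * y) a.
Proof. by move=> Hc; rewrite /F (deltaZ pK lf valt _ Hc) mulrCA mulrA. Qed.

Let FpK r : r ^+ p = r -> Kbar r. Proof. exact: (Fp_Kbar pK lf valt). Qed.

Let FZl y r a : r ^+ p = r -> F (r * y) a = r * F y a.
Proof.
by move=> rp; rewrite /F -mulrA (ctcZ pK lf valt _ (FpK rp)) (trZ pK lf valt _ rp).
Qed.

Let FZ y r a : r ^+ p = r -> F y (r * a) = r * F y a.
Proof. by move=> rp; rewrite FK ?FZl //; exact: FpK. Qed.

Let FF y a : F y a ^+ p = F y a.
Proof. by apply: (tr_Fp pK lf valt); exact: (ctc_Kbar pK lf valt). Qed.

Let pairing_B_0 a beta : MK (k + 1) a -> B0 beta ->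
  pairing (Ep vK p a) beta = F beta a.
Proof.
move=> Ha HB; have [->|b0] := eqVneq beta 0.
  by rewrite /F /pairing !mul0r.
have [k0 bpk] := k1; apply: (pairing_Ep pK lf valt k0 Ha); apply: mpow_le (B_0_pole HB).
(* The precision [p (k + 1)] must exceed the pole order strictly. Equality would make [p] divide
   [b], excluded once [B_0] has a nonzero element. *)
suff : b%:Z != p%:Z * (k + 1) by move: bpk; clear; lia.
apply: contraNneq (B_0_break HB b0) => E; have [n nE] : exists n : nat, k + 1 = n%:Z.
  by exists `|(k + 1)%R|%N; move: k0; clear; lia.
by apply/dvdnP; exists n; move: E; rewrite nE; clear; lia.
Qed.

Let S : set K := [set a | MK (k + 1) a /\ H (Ep vK p a)].

Let SP a : S a <-> MK (k + 1) a /\ forall beta, B0 beta -> F beta a = 0.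
Proof.
have [k0 _] := k1; split=> [[Ha HE]|[Ha Hb]]; split=> //.
  by move=> beta HB; rewrite -(pairing_B_0 Ha HB); exact: B_0_orthogonal.
have [beta HB dual] := norm_group_dual; apply: dual.
  by apply: Ep_unit pK lf valt _ _ _ _ => //; apply: mpow_le Ha.
by move=> j jnu; rewrite (pairing_B_0 Ha (HB j jnu)); apply: Hb; apply: HB.
Qed.

Let F_pole (m a : K) : MK (- k) m -> MK (k + 1) a -> F m a = 0.
Proof.
move=> Hm Ha; rewrite /F (ctcM1 pK lf valt) ?(tr0 pK lf valt) //.
by apply: mpow_le (mpowM dvK Hm (delta_mpow pK lf valt Ha)); clear; lia.
Qed.

Local Notation V := (sum_set B0 (MK (- k))).

Let V_S (c : K) : Kbar c -> (forall x, V x -> V (c * x)) -> forall a, S a -> S (c * a).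
Proof.
move=> Hc HV a /SP [Ha Hb]; have Hca : MK (k + 1) (c * a).
  by apply: (mpow0M dvK) => //; apply: (Kbar_int pK lf).
apply/SP; split=> [|beta HB]; first exact: Hca.
rewrite (FK _ _ Hc); have [|beta' HB' [m Hm <-]] := HV beta.
  by exists beta; [exact: HB|exists 0; [exact: mpow0|exact: addr0]].
by rewrite FDl (Hb _ HB') (F_pole Hm Ha) addr0.
Qed.

(** On M^(k+1), [F (c * beta)] vanishes where all [F (bj j)] do, so it agrees there with [F beta']
    for a combination [beta'] of the [bj j]. It remains to see that the difference has no pole
    beyond order [k]. *)
Let S_V (c : K) : Kbar c -> (forall a, S a -> S (c * a)) -> forall x, V x -> V (c * x).
Proof.
move=> Hc HS _ [beta HB [m Hm <-]]; have [k0 _] := k1.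
have [bj [HBj dual]] : exists bj : nat -> K, (forall j, (j < nu)%N -> B0 (bj j)) /\
    forall a, MK (k + 1) a -> (forall j, (j < nu)%N -> F (bj j) a = 0) -> S a.
  have [bj HBj dual] := norm_group_dual; exists bj; split=> // a Ha Hj; split=> //; apply: dual.
    by apply: Ep_unit pK lf valt _ _ _ _ => //; apply: mpow_le Ha.
  by move=> j jnu; rewrite (pairing_B_0 Ha (HBj j jnu)); apply: Hj.
have [||| e ep Fe] := @functional_combination p K vK kK res t pK lf valt (MK (k + 1)) nu
  (fun j => F (bj j)) (F (c * beta)) _ _ (fun j => FD (bj j)) (fun j => FZ (bj j)) (fun j => FF (bj j))
  (FD _) (FZ _) (FF _).
- by move=> x y; apply: (mpowD dvK).
- by move=> r x rp; apply: (mpow0M dvK); apply: (Kbar_int pK lf); exact: FpK.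
- move=> a Ha Hj; have /HS /SP [_ /(_ beta HB)] := dual a Ha Hj.
  by rewrite (FK _ _ Hc).
pose beta' := \sum_(j < nu) e j * bj j.
have HB' : B0 beta' by exact: B_0_sum.
suff Hy : MK (- k) (c * beta - beta').
  exists beta' => //; exists (c * beta - beta' + c * m); last by ring.
  by apply: (mpowD dvK) => //; apply: (mpow0M dvK) => //; apply: (Kbar_int pK lf).
set y := c * beta - beta'.
have Fy a : MK (k + 1) a -> F y a = 0.
  move=> Ha; have yE : c * beta = y + beta' by rewrite subrK.
  have := Fe a Ha; rewrite yE FDl.
  have -> : F beta' a = \sum_(j < nu) e j * F (bj j) a.
    rewrite /beta'; elim/big_rec2: _ => [|j y1 y2 _ <-].
      by rewrite /F mul0r (ctc0 pK lf valt) (tr0 pK lf valt).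
    by rewrite FDl (FZl _ _ (ep j)).
  by rewrite -[RHS]add0r => /addIr.
apply: (ctc_mpow pK lf valt) => n nk.
have [i iE] : exists i : nat, - n = i%:Z by exists `|n|%N; move: nk k0; clear; lia.
have ki : k + 1 <= i%:Z by move: nk; rewrite -iE; clear; lia.
have i0 : (0 < i)%N by move: ki k0; clear; lia.
(* Degrees divisible by [p] are invisible to [F], as [delta] kills those monomials; there the shape
   of [K_0] gives the vanishing, and multiplication by [c] preserves it. *)
rewrite iE -exprnP; have [pi|pi] := boolP (p %| i)%N.
  have K0c x : B0 x -> ctc (x * t ^+ i) = 0 by case=> _ /K_0_coefp; apply.
  by rewrite /y mulrBl (ctcB pK lf valt) -mulrA (ctcZ pK lf valt _ Hc) !K0c // mulr0 subrr.
set g := ctc _; have gK : Kbar g by exact: (ctc_Kbar pK lf valt).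
apply/eqP/negPn/negP => g0; have [u uK tu] := tr_neq0 pK lf valt.
have wK : Kbar (u / g) by apply: (KbarM pK lf) => //; apply: (KbarV pK lf).
(* On this monomial [F y] equals [i] times the trace of [u], nonzero because [p] does not divide
   [i]. *)
have /Fy : MK (k + 1) (u / g * t ^ i%:Z) by apply: mpow_le (mpow_ct pK lf valt i%:Z wK).
have iF : (i%:R : K) ^+ p = i%:R by exact: (natr_frob pK).
rewrite (FK _ _ wK) /F -{1}[t ^ _]mul1r (delta_ct pK lf valt _ (Kbar1 pK lf)) mul1r.
rewrite -[i%:Z%:~R]/(i%:R) mulrCA (ctcZ pK lf valt _ (FpK iF)) (trZ pK lf valt _ iF).
rewrite -[u / g * y * _]mulrA (ctcZ pK lf valt _ wK) -exprnP -/g divfK //.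
move=> /eqP; rewrite mulf_eq0 (negbTE tu) orbF -(dvdn_pcharf pK).
by rewrite (negbTE pi).
Qed.

Lemma LambdaK_norm_subspace :
  Fq_subspace Kbar d (LambdaK vK p @` (H `&` punits vK (k + 1)))%classic (MK 1) <->
  Fq_subspace Kbar d V [set: K]%classic.
Proof.
have [k0 _] := k1; rewrite (LambdaK_image pK lf valt H k0) -/S.
have SD a a' : S a -> S a' -> S (a + a').
  move=> /SP [Ha Hb] /SP [Ha' Hb']; apply/SP; split=> [|beta HB]; first exact: (mpowD dvK).
  by rewrite FD (Hb _ HB) (Hb' _ HB) addr0.
(* The same embedding of the field with [p^nu] elements serves both sides; only stability under its
   image has to be transferred. *)
split=> -[E [iota [cE Esub _ _ [_ EZ]]]]; exists E, iota; split=> //.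
- by exists 0; [exact: B_0_0|exists 0; rewrite ?addr0 //; exact: mpow0].
- split=> [_ _ [x Hx [m Hm <-]] [x' Hx' [m' Hm' <-]]|c].
    exists (x + x'); first exact: B_0D.
    by exists (m + m'); [exact: (mpowD dvK)|rewrite addrACA].
  by apply: S_V (EZ c); apply: Esub; exists c.
- by move=> a [Ha _]; apply: mpow_le Ha.
- by split; [exact: mpow0|rewrite (Ep0 pK lf valt); exact: norm_group1].
- by split=> // c; apply: V_S (EZ c); apply: Esub; exists c.
Qed.

End Extension.

Theorem theorem5p8 (p nu b : nat) (k : int)
    (K : fieldType) (vK : K -> \bar int) (kK : finFieldType) (res : K -> kK)
    (L : splittingFieldType K) (vL : L -> \bar int)
    (piL : L) (t : K) (Kbar0 : set K) :
  let Kbar := teichmuller vK #|kK| in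
  p \in [pchar K] ->
  local_field vK res ->
  galois 1 {:L} ->
  'Gal({:L} / 1) \isog [set: 'rV['F_p]_nu]%SET ->
  discrete_valuation vL ->
  totally_ramified vK vL ->
  vL piL = 1%:E ->
  (1 <= b)%N ->
  single_break vL piL b ->
  t%:A = galNorm 1 {:L} piL ->
  additive_complement Kbar (wp p @` Kbar) Kbar0 ->
  Num.ceil (b%:R / p%:R : rat) - 1 <= k ->
  Fq_subspace Kbar (p ^ nu)
    (LambdaK vK p @` (norm_group L `&` punits vK (k + 1)))
    (mpow vK 1)
  <-> Fq_subspace Kbar (p ^ nu)
    (sum_set (B_0 p L Kbar Kbar0 t) (mpow vK (- k)))
    [set: K].
Proof.
move=> Kbar pK lf galL isoG dvL tram vpi b_gt0 brk tN acK bk.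
exact: (LambdaK_norm_subspace pK lf galL isoG dvL tram vpi b_gt0 brk tN acK bk).
Qed.
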